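(* For any $p\in[1,\infty)$, the set $\mathbf{DI}_p\setminus\mathbf{BA}$ has full Hausdorff dimension, i.e. $\dim_H(\mathbf{DI}_p\setminus\mathbf{BA})=1$.
   Context: For $p\in[1,\infty)$ let $F^{[p]}(x,y)=(|x|^p+|y|^p)^{1/p}$ on $\mathbb R^2$, let $\mathcal B_p=\{F^{[p]}\le1\}$, and let $\Delta_p=\inf\det\Lambda$, the infimum over (full rank) lattices $\Lambda\subset\mathbb R^2$ having no nonzero point in the interior of $\mathcal B_p$ (the critical determinant). For $\alpha\in\mathbb R$ and $t\ge1$ let $$\Lambda_\alpha(t)=\{(t^{-1}q,\ t(m-q\alpha)):\ q,m\in\mathbb Z\},\qquad \lambda_1(t)=\min\{F^{[p]}(z):0\ne z\in\Lambda_\alpha(t)\},\qquad d^{[p]}(\alpha)=\limsup_{t\to\infty}\lambda_1(t).$$ One always has $d^{[p]}(\alpha)\le\Delta_p^{-1/2}$. $\mathbf{DI}_p$ is the set of $p$-Dirichlet improvable numbers, i.e. of $\alpha\in\mathbb R$ with $d^{[p]}(\alpha)<\Delta_p^{-1/2}$. $\mathbf{BA}$ is the set of badly approximable real numbers: $\alpha$ for which there is $c>0$ with $|\alpha-\frac mq|>\frac c{q^2}$ for all rationals $\frac mq$. *)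

(* Defs.v *)
From HB Require Import structures.
From mathcomp Require Import all_boot all_order all_algebra.
From mathcomp Require Import all_classical all_reals all_analysis.

Set Implicit Arguments.
Unset Strict Implicit.
Unset Printing Implicit Defensive.

Import Order.TTheory GRing.Theory Num.Theory.
Import numFieldNormedType.Exports.

Local Open Scope classical_set_scope.
Local Open Scope ring_scope.

Section HausdorffDimension.
Context {R : realType}.
Implicit Types (A U : set R) (s delta : R).

Definition diam U : \bar R :=
  ereal_sup [set (`|z.1 - z.2|)%:E | z in U `*` U].

(* The empty set weighs 0 also for s = 0 (a junk value would arise from
   x `^ 0 = 1), and a one-point set weighs 0 `^ 0 = 1 for s = 0, so that the
   zero-dimensional measure below is the counting measure. *)
Definition diam_pow s U : \bar R :=
  if `[< U = set0 >] then 0%E else (diam U `^ s)%E.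

Definition hausdorff_premeasure s delta A : \bar R :=
  ereal_inf [set (\sum_(0 <= i <oo) diam_pow s (U i))%E |
    U in [set U : (set R)^nat |
      A `<=` \bigcup_i U i /\ forall i, (diam (U i) <= delta%:E)%E]].

(* The premeasure is nonincreasing in delta, so its limit as delta tends to 0
   is a supremum. *)
Definition hausdorff_measure s A : \bar R :=
  ereal_sup [set hausdorff_premeasure s delta A | delta in [set d | 0 < d]].

Definition hausdorff_dim A : \bar R :=
  ereal_inf [set s%:E | s in [set s | 0 <= s /\ hausdorff_measure s A = 0%E]].

End HausdorffDimension.

Section DirichletImprovable.
Context {R : realType}.
Implicit Types (p alpha t : R) (u v z : R * R).

Definition lpnorm2 p z : R := (`|z.1| `^ p + `|z.2| `^ p) `^ p^-1.

Definition lpball2 p : set (R * R) := [set z | lpnorm2 p z <= 1].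

Definition det2 u v : R := u.1 * v.2 - u.2 * v.1.

(* When det2 u v != 0 this is a full rank lattice, of determinant
   `|det2 u v|, and every full rank lattice of the plane is of this form. *)
Definition lattice2 u v : set (R * R) :=
  [set z | exists a b : int, z = u *~ a + v *~ b].

Definition critical_det p : R :=
  inf [set D : R | exists u v, [/\ det2 u v != 0, D = `|det2 u v| &
    forall z, lattice2 u v z -> z != 0 -> ~ interior (lpball2 p) z]].

Definition Lambda alpha t : set (R * R) :=
  [set z | exists q m : int, z = (t^-1 * q%:~R, t * (m%:~R - q%:~R * alpha))].

(* For t > 0 the infimum is attained, Lambda alpha t being a lattice. *)
Definition lambda1 p alpha t : R :=
  inf [set lpnorm2 p z | z in [set z | Lambda alpha t z /\ z != 0]].

Definition dirichlet_const p alpha : \bar R :=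
  limf_esup (fun t => (lambda1 p alpha t)%:E) (pinfty_nbhs R).

Definition DI p : set R :=
  [set alpha | (dirichlet_const p alpha < (critical_det p `^ (- 2^-1))%:E)%E].

Definition BA : set R :=
  [set alpha | exists2 c : R, 0 < c & forall m q : int, q != 0 ->
    `|alpha - m%:~R / q%:~R| > c / q%:~R ^+ 2].

End DirichletImprovable.

(* Main.v *)
(* A lattice of covolume 1 whose nonzero vectors have norm at least the critical
   radius r = Delta_p^(-1/2) carries an inscribed hexagon: a basis u, v with u, v
   and u + v all of norm r; otherwise it could be deformed into an admissible
   lattice of smaller covolume. Along the orbit of a lattice under the diagonal
   flow and the unipotent flow alpha |-> alpha + b, a given hexagon is critical
   for at most one b: the abscissae are scaled by s and the ordinate of largest
   modulus must be the sum of the two others, which fixes s by convexity of t^p,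
   and then b. By compactness, in an interval of length T^-2, the alpha whose
   lattice comes within eps of being critical at some time of [T, 2T] are
   covered by boundedly many arbitrarily short intervals.

   In a Cantor construction with n = 4^m children per interval only O(m) children
   are therefore dangerous. Moreover, since r > 1, every interval contains, at a
   bounded relative scale, an interval of numbers very close to a rational M/N
   which is safe: take M/N to be a distant Farey mediant of a Dirichlet
   approximation m/q, so that the vectors of m/q and M/N take turns in being
   short, and avoid the dangerous numbers by having many mediants to choose from.
   Inserting such steps makes the limit points not badly approximable.

   For s < 1 the dimension bound is a game: given a cover with small total
   weight sum diam^s, descend to a child meeting the least weight; with at least
   n/2 safe children each gain n^(1-s)/8 leaves room for the rare insertions, and
   the limit point is in no set of the cover. *)
From HB Require Import structures.
Require Import Defs.
From mathcomp Require Import all_boot all_order all_algebra.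
From mathcomp Require Import all_classical all_reals all_analysis.
From mathcomp Require Import ring lra zify.

Import Order.TTheory GRing.Theory Num.Theory.
Import numFieldNormedType.Exports.

Set Implicit Arguments.
Unset Strict Implicit.
Unset Printing Implicit Defensive.

Local Open Scope classical_set_scope.
Local Open Scope ring_scope.

(** * Convexity of powers and the plane l^p norm *)

Section PowR.
Context {R : realType}.
Implicit Types (p x y m a b d e l : R).

(** The order in which the constants are chosen shapes the proof. Among more than [C] numbers
    separated on the scale [eta], one has a vector shorter than r - [eps]; here [C] must not depend
    on [eta]. Then [m] is chosen from [C] and s, so that at most half of the 4^m children are lost
    and 4^(m(1-s)) >= 8; then [eta] from [m]; and only then [eps], so that one [rho] < r serves at
    all times. [C] can come first because a limit argument attaches to each number a critical
    hexagon whose integer coefficients, in one common reduced basis, lie in a box depending on p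
    alone: two numbers with the same coefficients coincide in the limit, whatever [eta] was. The
    approach to rationals must become arbitrarily close, within c/N^2 with c tending to 0, while
    [rho] and hence [eta] stay fixed. So only the loss of scale [kap] in such a step may depend on
    c. When the vectors of m/q and M/N change roles the shorter one may have norm close to 1; r > 1,
    that is Delta_p < 1, is the room needed there. *)

Lemma powR_bernoulli_lt p x : 1 < p -> 0 <= x -> x != 1 ->
  1 + p * (x - 1) < x `^ p.
Proof.
move=> p1 x0 x1; have p0 : 0 < p by lra.
have [->|xn0] := eqVneq x 0; first by rewrite powR0; lra.
have xp : 0 < x by rewrite lt_def xn0.
have lnx : ln x != 0 by rewrite ln_eq0.
rewrite -(lnK xp) /=.
set L := ln x in lnx *; rewrite -expRM.
(* With x = exp L: multiplied by x, this bound gives x L > x - 1, and the next one gives x^p > x +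
   (p - 1) x L. *)
have e1 : 1 - L < expR (- L).
  by rewrite -[X in X + _]addr0 addr0 expR_gt1Dx // oppr_eq0.
have e2 : 1 + (p * L - L) < expR (p * L - L).
  rewrite expR_gt1Dx // -[X in _ - X]mul1r -mulrBl mulf_neq0 //.
  by rewrite subr_eq0 gt_eqF.
have := expR_gt0 L => EL.
have : expR L * (1 - L) < expR L * expR (- L) by rewrite ltr_pM2l.
have : expR L * (1 + (p * L - L)) < expR L * expR (p * L - L) by rewrite ltr_pM2l.
rewrite -!expRD subrr expR0 (_ : L + (p * L - L) = L * p); last by ring.
move=> h1 h2.
have h3 : (p - 1) * (expR L * (1 - L)) < (p - 1) * 1 by rewrite ltr_pM2l//; lra.
apply: le_lt_trans h1; rewrite -subr_ge0.
have -> : expR L * (1 + (p * L - L)) - (1 + p * (expR L - 1)) =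
  (p - 1) * 1 - (p - 1) * (expR L * (1 - L)) by ring.
by rewrite subr_ge0 ltW.
Qed.


Lemma powR_tangent_lt p m x : 1 < p -> 0 < m -> 0 <= x -> x != m ->
  m `^ p + p * m `^ (p - 1) * (x - m) < x `^ p.
Proof.
move=> p1 m0 x0 xm.
have xm0 : 0 <= x / m by rewrite divr_ge0// ltW.
have xm1 : x / m != 1 by rewrite -(inj_eq (mulIf (lt0r_neq0 m0))) divfK ?mul1r// lt0r_neq0.
have mp : 0 < m `^ p by rewrite powR_gt0.
have := powR_bernoulli_lt p1 xm0 xm1; rewrite -(ltr_pM2l mp) => h.
have e : m * m `^ (p - 1) = m `^ p by rewrite mulr_powRB1 ?ltW//; lra.
have -> : x `^ p = m `^ p * (x / m) `^ p.
  rewrite -powRM ?(ltW m0)//; congr (_ `^ p); field; exact: lt0r_neq0.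
apply: le_lt_trans h; rewrite -e le_eqVlt; apply/orP; left; apply/eqP.
by field; rewrite lt0r_neq0.
Qed.

Lemma powR_tangent_le p m x : 1 <= p -> 0 < m -> 0 <= x ->
  m `^ p + p * m `^ (p - 1) * (x - m) <= x `^ p.
Proof.
rewrite le_eqVlt => /orP[/eqP<- m0 x0|p1 m0 x0].
  by rewrite subrr powRr0 !powRr1 // ?(ltW m0)//; lra.
have [->|xm] := eqVneq x m; first by rewrite subrr mulr0 addr0.
exact/ltW/powR_tangent_lt.
Qed.

Lemma powR_conv p l x y : 1 <= p -> 0 <= l <= 1 -> 0 <= x -> 0 <= y ->
  (l * x + (1 - l) * y) `^ p <= l * x `^ p + (1 - l) * y `^ p.
Proof.
move=> p1 /andP[l0 l1] x0 y0; set m := l * x + _.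
have m0 : 0 <= m by rewrite addr_ge0 ?mulr_ge0 ?subr_ge0.
have := m0; rewrite le_eqVlt => /orP[/eqP<-|mp].
  by rewrite powR0 ?addr_ge0 ?mulr_ge0 ?subr_ge0 ?powR_ge0//; lra.
have hx := powR_tangent_le p1 mp x0; have hy := powR_tangent_le p1 mp y0.
have : l * (m `^ p + p * m `^ (p - 1) * (x - m)) <= l * x `^ p by rewrite ler_wpM2l.
have : (1 - l) * (m `^ p + p * m `^ (p - 1) * (y - m)) <= (1 - l) * y `^ p.
  by rewrite ler_wpM2l ?subr_ge0.
move=> h1 h2; have := lerD h2 h1; apply: le_trans.
by rewrite le_eqVlt /m; apply/orP; left; apply/eqP; ring.
Qed.

(** The points a + d and b are convex combinations of a and b + d with exchanged weights; the two
    convexity inequalities add up to the claim. *)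
Lemma powR_incr p a b d : 1 <= p -> 0 <= a <= b -> 0 <= d ->
  (a + d) `^ p - a `^ p <= (b + d) `^ p - b `^ p.
Proof.
move=> p1 /andP[a0 ab] d0.
have [->|ba] := eqVneq b a; first by [].
have w0 : 0 < b - a + d by rewrite ltr_pwDl// subr_gt0 lt_def ba ab.
pose l := (b - a) / (b - a + d).
have l01 : 0 <= l <= 1.
  rewrite divr_ge0 ?subr_ge0 ?(ltW w0)//= ler_pdivrMr// mul1r; lra.
have l01' : 0 <= 1 - l <= 1 by case/andP: l01 => *; apply/andP; split; lra.
have wn0 := lt0r_neq0 w0.
have e1 : a + d = l * a + (1 - l) * (b + d) by rewrite /l; field.
have e2 : b = (1 - l) * a + (1 - (1 - l)) * (b + d) by rewrite /l; field.
have bd : 0 <= b + d by lra.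
have := powR_conv p1 l01 a0 bd; rewrite -e1 => h1.
have := powR_conv p1 l01' a0 bd; rewrite -e2 => h2.
lra.
Qed.

Lemma ltr_powR p x y : 0 < p -> 0 <= x -> x < y -> x `^ p < y `^ p.
Proof.
by move=> p0 x0 xy; apply: gt0_ltr_powR; rewrite // nnegrE; lra.
Qed.

Lemma ler_powRl p x y : 0 < p -> 0 <= x -> x <= y -> x `^ p <= y `^ p.
Proof.
by move=> p0 x0 xy; apply: ge0_ler_powR; rewrite // ?nnegrE; lra.
Qed.

(** Up to a common sign the barycentre m is nonnegative. If m > 0, the tangent of t^p at m lies
    below |z|^p also for z < 0, its slope being positive and |z| >= z; m = 0 is treated directly. *)
Lemma powR_abs_conv_lt p l x y : 1 < p -> 0 < l < 1 -> x != y ->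
  `|l * x + (1 - l) * y| `^ p < l * `|x| `^ p + (1 - l) * `|y| `^ p.
Proof.
move=> p1 /andP[l0 l1] xy.
have p0 : 0 < p by lra.
wlog : x y xy / 0 <= l * x + (1 - l) * y.
  move=> H; have [/H|] := leP 0 (l * x + (1 - l) * y); first exact.
  move=> h; rewrite -(normrN x) -(normrN y) -(normrN (l * x + _)).
  have -> : - (l * x + (1 - l) * y) = l * - x + (1 - l) * - y by ring.
  by apply: H; rewrite ?eqr_opp//; lra.
rewrite le_eqVlt => /orP[/eqP e|m0].
  rewrite -e normr0 powR0 ?lt0r_neq0//.
  have [x0|x0] := eqVneq x 0.
    rewrite x0 normr0 powR0 ?lt0r_neq0// mulr0 add0r mulr_gt0 ?subr_gt0//.
    by rewrite powR_gt0 // normr_gt0 eq_sym -x0.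
  apply: ltr_pwDl; first by rewrite mulr_gt0// powR_gt0// normr_gt0.
  by rewrite mulr_ge0 ?powR_ge0 ?subr_ge0 ?(ltW l1).
rewrite (gtr0_norm m0); set m := l * x + _ in m0 *.
have key z : z != m -> m `^ p + p * m `^ (p - 1) * (z - m) < `|z| `^ p.
  move=> zm; have [z0|z0] := leP 0 z.
    by rewrite ger0_norm //; apply: powR_tangent_lt.
  apply: lt_le_trans (powR_tangent_le (ltW p1) m0 (normr_ge0 z)).
  rewrite ltrD2l ltr_pM2l ?mulr_gt0 ?powR_gt0//.
  by have := normr_ge0 z; lra.
have xm : x != m.
  apply: contra_neq xy => xm; have : (1 - l) * (x - y) = 0.
    by rewrite {1}xm /m; rewrite /m in xm; nra.
  by move/eqP; rewrite mulf_eq0 subr_eq0 gt_eqF//= subr_eq0 => /eqP.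
have ym : y != m.
  apply: contra_neq xy => ym; have : l * (x - y) = 0 by rewrite /m in ym; nra.
  by move/eqP; rewrite mulf_eq0 gt_eqF//= subr_eq0 => /eqP.
have h1 := key _ xm; have h2 := key _ ym.
have : l * (m `^ p + p * m `^ (p - 1) * (x - m)) < l * `|x| `^ p by rewrite ltr_pM2l.
have : (1 - l) * (m `^ p + p * m `^ (p - 1) * (y - m)) < (1 - l) * `|y| `^ p.
  by rewrite ltr_pM2l ?subr_gt0.
move=> h3 h4; have := ltrD h4 h3; apply: le_lt_trans.
by rewrite le_eqVlt /m; apply/orP; left; apply/eqP; ring.
Qed.

End PowR.

(* Locked: comparing two norms by unfolding them down to the exponential
   diverges in practice. *)
HB.lock Definition nm {R : realType} (p x y : R) : R := lpnorm2 p (x, y).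

Section LpNorm.
Context {R : realType}.
Variable p : R.
Hypothesis p1 : 1 <= p.
Implicit Types (x y a r : R) (z : R * R).

Let p0 : 0 < p. Proof. by apply: lt_le_trans p1. Qed.
Let pn0 : p != 0. Proof. exact: lt0r_neq0. Qed.

Lemma nmE x y : nm p x y = (`|x| `^ p + `|y| `^ p) `^ p^-1.
Proof. by rewrite nm.unlock. Qed.

Lemma nm_ge0 x y : 0 <= nm p x y. Proof. by rewrite nmE powR_ge0. Qed.

Lemma nm_powR x y : nm p x y `^ p = `|x| `^ p + `|y| `^ p.
Proof. by rewrite nmE -powRrM mulVf// powRr1// addr_ge0 ?powR_ge0. Qed.

Lemma nm_leP r x y : 0 <= r ->
  reflect (`|x| `^ p + `|y| `^ p <= r `^ p) (nm p x y <= r).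
Proof.
move=> r0; rewrite -nm_powR; apply: (iffP idP) => [|h].
  by apply: ler_powRl => //; exact: nm_ge0.
rewrite leNgt; apply/negP => /(ltr_powR p0 r0); lra.
Qed.

Lemma nmZ a x y : nm p (a * x) (a * y) = `|a| * nm p x y.
Proof.
rewrite !nmE !normrM !powRM// -mulrDr powRM ?powR_ge0 ?addr_ge0 ?powR_ge0//.
by rewrite -powRrM mulfV// powRr1.
Qed.

Lemma nmN x y : nm p (- x) (- y) = nm p x y.
Proof. by rewrite !nmE !normrN. Qed.

Lemma nm_axis1 x : nm p x 0 = `|x|.
Proof. by rewrite !nmE normr0 powR0// addr0 -powRrM mulfV// powRr1. Qed.

Lemma nm_axis2 y : nm p 0 y = `|y|.
Proof. by rewrite !nmE normr0 powR0// add0r -powRrM mulfV// powRr1. Qed.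

Lemma nm_ge1 x y : `|x| <= nm p x y.
Proof.
rewrite leNgt; apply/negP => h.
have := ltr_powR p0 (nm_ge0 _ _) h; rewrite nm_powR /=.
by have := powR_ge0 `|y| p; lra.
Qed.

Lemma nm_ge2 x y : `|y| <= nm p x y.
Proof.
rewrite leNgt; apply/negP => h.
have := ltr_powR p0 (nm_ge0 _ _) h; rewrite nm_powR /=.
by have := powR_ge0 `|x| p; lra.
Qed.

Lemma nm_eq0 x y : nm p x y = 0 -> x = 0 /\ y = 0.
Proof.
move=> h; have := nm_ge1 x y; have := nm_ge2 x y.
by rewrite h !normr_le0 => /eqP-> /eqP->.
Qed.

Lemma nm_conv l x y x' y' r : 0 <= l <= 1 -> 0 <= r ->
  nm p x y <= r -> nm p x' y' <= r ->
  nm p (l * x + (1 - l) * x') (l * y + (1 - l) * y') <= r.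
Proof.
move=> l01 r0 /(nm_leP _ _ r0) /= h /(nm_leP _ _ r0) /= h'.
apply/(nm_leP _ _ r0) => /=.
have key u v : `|l * u + (1 - l) * v| `^ p <= l * `|u| `^ p + (1 - l) * `|v| `^ p.
  apply: le_trans (powR_conv p1 l01 (normr_ge0 u) (normr_ge0 v)).
  apply: ler_powRl => //; apply: le_trans (ler_normD _ _) _.
  case/andP: l01 => l0 l1; have l2 : 0 <= 1 - l by lra.
  by rewrite !normrM (ger0_norm l0) (ger0_norm l2).
case/andP: l01 => l0 l1.
have : l * (`|x| `^ p + `|y| `^ p) <= l * r `^ p by rewrite ler_wpM2l.
have : (1 - l) * (`|x'| `^ p + `|y'| `^ p) <= (1 - l) * r `^ p.
  by rewrite ler_wpM2l// subr_ge0.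
by have := key x x'; have := key y y'; lra.
Qed.

(** Minkowski's inequality from the convexity of the unit ball: the sum divided by A + B is a convex
    combination of the two normalised vectors. *)
Lemma nmD x y x' y' :
  nm p (x + x') (y + y') <= nm p x y + nm p x' y'.
Proof.
have [A eA] : exists A, A = nm p x y by eexists.
have [B eB] : exists B, B = nm p x' y' by eexists.
rewrite -eA -eB.
have A0 : 0 <= A by rewrite eA; exact: nm_ge0.
have B0 : 0 <= B by rewrite eB; exact: nm_ge0.
have [An0|An0] := eqVneq A 0.
  have [-> ->] : x = 0 /\ y = 0 by apply: nm_eq0; rewrite -eA.
  by rewrite An0 !add0r -eB.
have [Bn0|Bn0] := eqVneq B 0.
  have [-> ->] : x' = 0 /\ y' = 0 by apply: nm_eq0; rewrite -eB.
  by rewrite Bn0 !addr0 -eA.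
have Ap : 0 < A by rewrite lt_def An0.
have Bp : 0 < B by rewrite lt_def Bn0.
have ABp : 0 < A + B by lra.
have ABn := lt0r_neq0 ABp.
have l01 : 0 <= A / (A + B) <= 1.
  by rewrite divr_ge0 ?(ltW ABp)//= ler_pdivrMr// mul1r; lra.
have h1 : nm p (A^-1 * x) (A^-1 * y) <= 1.
  by rewrite nmZ ger0_norm ?invr_ge0// -eA mulVf.
have h2 : nm p (B^-1 * x') (B^-1 * y') <= 1.
  by rewrite nmZ ger0_norm ?invr_ge0// -eB mulVf.
have := nm_conv l01 ler01 h1 h2.
have -> : A / (A + B) * (A^-1 * x) + (1 - A / (A + B)) * (B^-1 * x') =
  (A + B)^-1 * (x + x') by field; rewrite An0 Bn0 ABn.
have -> : A / (A + B) * (A^-1 * y) + (1 - A / (A + B)) * (B^-1 * y') =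
  (A + B)^-1 * (y + y') by field; rewrite An0 Bn0 ABn.
by rewrite nmZ ger0_norm ?invr_ge0 ?(ltW ABp)// mulrC ler_pdivrMr// mul1r.
Qed.

Lemma nm_l1 x y : nm p x y <= `|x| + `|y|.
Proof.
by have := nmD x 0 0 y; rewrite addr0 add0r nm_axis1 nm_axis2.
Qed.

Lemma nmB x y x' y' :
  nm p x y - (`|x - x'| + `|y - y'|) <= nm p x' y'.
Proof.
have := nmD (x - x') (y - y') x' y'; rewrite !subrK.
by have := nm_l1 (x - x') (y - y'); lra.
Qed.

Lemma lpball2_notin_interior x y :
  1 <= nm p x y -> ~ interior (lpball2 p) (x, y).
Proof.
move=> h /nbhs_ballP[e /= e0 he].
set M := `|x| + `|y| + 1.
have M0 : 0 < M by rewrite /M; have := normr_ge0 x; have := normr_ge0 y; lra.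
(* The point dilated by 1 + d is still in the neighbourhood of radius e, but its norm exceeds 1. *)
pose d := e / (2 * M).
have d0 : 0 < d by rewrite divr_gt0// mulr_gt0.
have dM : d * M = e / 2 by rewrite /d; field; exact: lt0r_neq0.
have : lpball2 p ((1 + d) * x, (1 + d) * y).
  apply: he; split => /=; rewrite -ball_normE /ball_ /=.
    have -> : x - (1 + d) * x = - (d * x) by ring.
    rewrite normrN normrM ger0_norm ?(ltW d0)//.
    have : d * `|x| <= d * M by rewrite ler_pM2l// /M; have := normr_ge0 y; lra.
    by rewrite dM; lra.
  have -> : y - (1 + d) * y = - (d * y) by ring.
  rewrite normrN normrM ger0_norm ?(ltW d0)//.
  have : d * `|y| <= d * M by rewrite ler_pM2l// /M; have := normr_ge0 x; lra.
  by rewrite dM; lra.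
rewrite /lpball2 /mkset (_ : lpnorm2 _ _ = nm p ((1 + d) * x) ((1 + d) * y));
  last by rewrite nm.unlock.
rewrite nmZ ger0_norm; last by lra.
have : (1 + d) * 1 <= (1 + d) * nm p x y by rewrite ler_pM2l//; lra.
lra.
Qed.

Lemma lpball2_interior x y : `|x| < 2^-1 -> `|y| < 2^-1 ->
  interior (lpball2 p) (x, y).
Proof.
move=> hx hy; apply/nbhs_ballP.
exists (Num.min (2^-1 - `|x|) (2^-1 - `|y|)) => /=.
  by rewrite lt_min !subr_gt0 hx hy.
move=> [x' y'] [/=]; rewrite -!ball_normE /ball_ /= !lt_min => /andP[h1 _] /andP[_ h2].
rewrite /lpball2 /mkset (_ : lpnorm2 _ _ = nm p x' y'); last by rewrite nm.unlock.
apply: le_trans (nm_l1 _ _) _.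
have := ler_normB x (x - x'); have := ler_normB y (y - y').
rewrite !opprB ![_ + (_ - _)]addrC !subrK; lra.
Qed.

End LpNorm.

(** * Reduced bases and the critical determinant *)

Section Reduction.
Context {R : realType}.

Lemma int_round (t : R) : exists k : int, `|t - k%:~R| <= 2^-1.
Proof.
exists (Num.floor (t + 2^-1)).
have h1 := ge_floor (t + 2^-1); have h2 := floorD1_gt (t + 2^-1).
rewrite intrD in h2; rewrite ler_norml; lra.
Qed.

(** Gauss reduction for the Euclidean form: the first vector nearly minimises the form among
    primitive vectors, the second is reduced modulo the first. Lagrange's identity, A B = D^2 plus
    the squared inner product, then bounds both lengths. *)
Lemma reduced_basis (x1 y1 x2 y2 m : R) : 0 < m ->
  x1 * y2 - x2 * y1 != 0 ->
  (forall a b : int, (a, b) != (0, 0) ->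
    m <= (a%:~R * x1 + b%:~R * x2) ^+ 2 + (a%:~R * y1 + b%:~R * y2) ^+ 2) ->
  exists a b c d : int, [/\ a * d - b * c = 1,
    (a%:~R * x1 + b%:~R * x2) ^+ 2 + (a%:~R * y1 + b%:~R * y2) ^+ 2 <=
      2 * `|x1 * y2 - x2 * y1| &
    (c%:~R * x1 + d%:~R * x2) ^+ 2 + (c%:~R * y1 + d%:~R * y2) ^+ 2 <=
      (x1 * y2 - x2 * y1) ^+ 2 / m + `|x1 * y2 - x2 * y1| / 2].
Proof.
move=> m0 D0 hm; set D := x1 * y2 - x2 * y1 in D0 *.
pose q (a b : int) : R :=
  (a%:~R * x1 + b%:~R * x2) ^+ 2 + (a%:~R * y1 + b%:~R * y2) ^+ 2.
(* Primitivity is expressed by a completion to a matrix of determinant 1, so that a basis comes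
   along with the vector. *)
pose S : set R := [set v | exists a b c d : int, a * d - b * c = 1 /\ v = q a b].
have Sm v : S v -> m <= v.
  move=> [a [b [c [d [e ->]]]]]; apply: hm; apply/eqP => -[ea eb].
  by move: e; rewrite ea eb !mul0r subr0.
have Si : has_inf S.
  split; last by exists m => v /Sm.
  by exists (q 1 0), 1, 0, 0, 1; split => //; rewrite mul0r subr0 mulr1.
have mi : m <= inf S by apply: lb_le_inf => [|v /Sm//]; case: Si.
have i0 : 0 < inf S by apply: lt_le_trans mi.
(* A value below twice the infimum is enough, without showing that the minimum is attained; this is
   the 2 in [A <= 2 * B] below. *)
have [_ [a [b [c [d [e ->]]]]] h2] := inf_adherent i0 Si.
set X := a%:~R * x1 + b%:~R * x2; set Y := a%:~R * y1 + b%:~R * y2.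
pose X' : R := c%:~R * x1 + d%:~R * x2; pose Y' : R := c%:~R * y1 + d%:~R * y2.
have eD : X * Y' - X' * Y = D.
  have : ((a * d - b * c)%:~R : R) = 1 by rewrite e.
  rewrite intrB !intrM => e'.
  transitivity ((a%:~R * d%:~R - b%:~R * c%:~R) * D); last by rewrite e' mul1r.
  by rewrite /X /Y /X' /Y' /D; ring.
have qab : q a b = X ^+ 2 + Y ^+ 2 by [].
have wi : inf S <= X ^+ 2 + Y ^+ 2.
  by apply: ge_inf; [case: Si|exists a, b, c, d].
rewrite qab in h2.
set A := X ^+ 2 + Y ^+ 2 in wi h2.
have A0 : 0 < A by apply: lt_le_trans wi.
have [k hk] := int_round ((X * X' + Y * Y') / A).
have bi : inf S <= q (c - k * a) (d - k * b).
  apply: ge_inf; first by case: Si.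
  exists (c - k * a), (d - k * b), (- a), (- b); split => //.
  by rewrite -[RHS]e; ring.
set V := X' - k%:~R * X; set W := Y' - k%:~R * Y.
have qV : q (c - k * a) (d - k * b) = V ^+ 2 + W ^+ 2.
  by rewrite /q !intrB !intrM /V /W /X' /Y' /X /Y; ring.
set B := V ^+ 2 + W ^+ 2 in qV.
have lag : A * B = D ^+ 2 + (X * V + Y * W) ^+ 2.
  by rewrite -eD /A /B /V /W; ring.
have pr : (X * V + Y * W) ^+ 2 <= A ^+ 2 / 4.
  have -> : X * V + Y * W = A * ((X * X' + Y * Y') / A - k%:~R).
    transitivity ((X * X' + Y * Y') - k%:~R * A); first by rewrite /V /W /A; ring.
    by field; exact: lt0r_neq0.
  move: ((X * X' + Y * Y') / A - _) hk => t ht.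
  rewrite exprMn.
  have : t ^+ 2 <= 4^-1.
    rewrite -real_normK ?num_real// (_ : 4^-1 = 2^-1 ^+ 2); last by field.
    by rewrite lerXn2r// nnegrE; lra.
  by move=> ht2; rewrite ler_wpM2l ?sqr_ge0.
have AB : A <= 2 * B by rewrite qV in bi; lra.
have D20 : 0 <= D ^+ 2 by exact: sqr_ge0.
have A2 : A ^+ 2 <= 4 * D ^+ 2.
  have : A * A <= A * (2 * B) by rewrite ler_pM2l.
  rewrite mulrCA lag -expr2; lra.
have AD : A <= 2 * `|D|.
  rewrite -ler_sqr ?nnegrE ?(ltW A0) ?mulr_ge0//.
  by rewrite exprMn real_normK ?num_real//; lra.
exists a, b, (c - k * a), (d - k * b); split; [by rewrite -[RHS]e; ring|exact: AD|].
have -> : ((c - k * a)%:~R * x1 + (d - k * b)%:~R * x2) ^+ 2 +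
  ((c - k * a)%:~R * y1 + (d - k * b)%:~R * y2) ^+ 2 = B by rewrite -qV.
have -> : B = D ^+ 2 / A + (X * V + Y * W) ^+ 2 / A.
  by rewrite -mulrDl -lag mulrAC divff ?mul1r// lt0r_neq0.
apply: lerD.
  by rewrite ler_wpM2l// lef_pV2 ?posrE//; lra.
by rewrite ler_pdivrMr//; nra.
Qed.

End Reduction.

Section CriticalRadius.
Context {R : realType}.
Variable p : R.
Hypothesis p1 : 1 <= p.

Let p0 : 0 < p. Proof. by apply: lt_le_trans p1. Qed.

Definition admissible (r u1 u2 v1 v2 : R) : Prop :=
  forall a b : int, (a, b) != (0, 0) ->
    r <= nm p (a%:~R * u1 + b%:~R * v1) (a%:~R * u2 + b%:~R * v2).

Lemma nm_le x y x' y' : `|x| <= `|x'| -> `|y| <= `|y'| ->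
  nm p x y <= nm p x' y'.
Proof.
move=> hx hy; apply/nm_leP; [exact: p1|exact: nm_ge0|].
by rewrite nm_powR//; apply: lerD; apply: ler_powRl.
Qed.

Lemma lattice2E (u v z : R * R) : lattice2 u v z <->
  exists a b : int, z = (a%:~R * u.1 + b%:~R * v.1, a%:~R * u.2 + b%:~R * v.2).
Proof.
have e a b : u *~ a + v *~ b =
    (a%:~R * u.1 + b%:~R * v.1, a%:~R * u.2 + b%:~R * v.2).
  by rewrite !mulrzl [LHS]surjective_pairing /= !raddfMz.
by split=> -[a [b ->]]; exists a, b; rewrite e.
Qed.

Definition critical_dets : set R := [set D : R | exists u v,
  [/\ det2 u v != 0, D = `|det2 u v| &
  forall z, lattice2 u v z -> z != 0 -> ~ interior (lpball2 p) z]].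

Lemma intr_norm_ge1 (a : int) : a != 0 -> 1 <= `|a%:~R : R|.
Proof. by move=> a0; rewrite -intr_norm ler1z -gtz0_ge1 normr_gt0. Qed.

(** Keeps the critical determinant away from 0. A nonzero lattice vector cannot have both
    coordinates below 1/2 in modulus, so its squared length is at least 1/4, while the reduced basis
    contains one of squared length at most 2 D. *)
Lemma critical_dets_ge D : critical_dets D -> 8^-1 <= D.
Proof.
move=> [u [v [d0 -> h]]].
have hq (a b : int) : (a, b) != (0, 0) ->
    4^-1 <= (a%:~R * u.1 + b%:~R * v.1) ^+ 2 + (a%:~R * u.2 + b%:~R * v.2) ^+ 2.
  move=> ab0; set x := (X in X ^+ 2 + _); set y := (X in _ + X ^+ 2).
  have q4 : (4^-1 : R) = 2^-1 ^+ 2 by field.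
  have [hx|hx] := ltP `|x| 2^-1; last first.
    apply: ler_wpDr; first exact: sqr_ge0.
    by rewrite -real_normK ?num_real// q4 lerXn2r// nnegrE.
  have [hy|hy] := ltP `|y| 2^-1; last first.
    apply: ler_wpDl; first exact: sqr_ge0.
    by rewrite -[y ^+ 2]real_normK ?num_real// q4 lerXn2r// nnegrE.
  exfalso; apply: (h (x, y)); last exact: lpball2_interior.
    by apply/lattice2E; exists a, b.
  apply: contra ab0 => /eqP[ex ey].
  have ea : a%:~R * det2 u v = 0.
    transitivity (x * v.2 - y * v.1); last by rewrite ex ey !mul0r subr0.
    by rewrite /x /y /det2; ring.
  have eb : b%:~R * det2 u v = 0.
    transitivity (y * u.1 - x * u.2); last by rewrite ex ey !mul0r subr0.
    by rewrite /x /y /det2; ring.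
  move/eqP: ea; rewrite mulf_eq0 (negPf d0) orbF intr_eq0 => /eqP->.
  by move/eqP: eb; rewrite mulf_eq0 (negPf d0) orbF intr_eq0 => /eqP->.
have d0' : u.1 * v.2 - v.1 * u.2 != 0 by rewrite [v.1 * _]mulrC.
have q0 : 0 < (4^-1 : R) by rewrite invr_gt0.
have hq' (a b : int) : (a, b) != (0, 0) ->
    4^-1 <= (a%:~R * u.1 + b%:~R * v.1) ^+ 2 + (a%:~R * u.2 + b%:~R * v.2) ^+ 2.
  exact: hq.
have [a [b [c [d [abcd hw _]]]]] := reduced_basis q0 d0' hq'.
have : (a, b) != (0, 0).
  by apply/eqP => -[ea eb]; move: abcd; rewrite ea eb !mul0r subr0.
by move=> /hq; rewrite -[det2 u v]/(_ - _) [u.2 * _]mulrC; lra.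
Qed.

Lemma admissible_critical_dets u1 u2 v1 v2 : u1 * v2 - u2 * v1 != 0 ->
  admissible 1 u1 u2 v1 v2 -> critical_dets `|u1 * v2 - u2 * v1|.
Proof.
move=> d0 h; exists (u1, u2), (v1, v2); split => //.
move=> z /lattice2E[a [b /= ->]] z0.
apply: lpball2_notin_interior => //; apply: h.
by apply: contra z0 => /eqP[-> ->]; rewrite !mul0r addr0.
Qed.

(** The basis is (1, 0), (1/2, h) with (1/2, h) on the unit sphere; the rows with |b| >= 2 are far
    enough because h >= 1/2. This lattice is the reason why the critical radius exceeds 1. *)
Lemma exists_lattice_lt1 : exists2 h : R, 0 < h < 1 & critical_dets h.
Proof.
pose t : R := 2^-1 `^ p.
have i2 : `|2^-1 : R| = 2^-1 by rewrite ger0_norm.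
have t0 : 0 < t by rewrite powR_gt0.
have th : t <= 2^-1.
  by rewrite /t -[leRHS]powRr1// ger_powR//; apply/andP; split; lra.
pose h := (1 - t) `^ p^-1.
have hp : h `^ p = 1 - t by rewrite /h -powRrM mulVf ?lt0r_neq0// powRr1//; lra.
have h0 : 0 < h by rewrite powR_gt0; lra.
have h1 : h < 1.
  rewrite ltNge; apply/negP => h1.
  have : 1 `^ p <= h `^ p by apply: ler_powRl.
  by rewrite powR1 hp; lra.
have h2 : 2^-1 <= h.
  rewrite leNgt; apply/negP => h2.
  have : h `^ p < 2^-1 `^ p by apply: ltr_powR => //; exact: ltW.
  by rewrite hp -/t; lra.
have nh : nm p 2^-1 h = 1.
  by rewrite nmE i2 (gtr0_norm h0) hp -/t addrCA subrr addr0 powR1.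
exists h; first by rewrite h0.
have -> : h = `|1 * h - 0 * 2^-1| by rewrite mul1r mul0r subr0 gtr0_norm.
apply: admissible_critical_dets; first by rewrite mul1r mul0r subr0 lt0r_neq0.
move=> a b; rewrite !mulr1 mulr0 add0r.
have [->|b0] := eqVneq b 0.
  rewrite mul0r mul0r addr0 nm_axis1// => a0; apply: intr_norm_ge1.
  by apply: contra a0 => /eqP->.
move=> _; have [b1|b1] := eqVneq `|b| 1.
  rewrite -[leLHS]nh; apply: nm_le; last first.
    by rewrite normrM -intr_norm b1 mul1r.
  have -> : a%:~R + b%:~R / 2 = (a * 2 + b)%:~R / 2 :> R.
    by rewrite intrD intrM; field.
  rewrite normrM -[leLHS]mul1r ler_wpM2r//; apply: intr_norm_ge1.
  by apply/eqP => e; move: b1; lia.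
apply: le_trans (nm_ge2 p1 _ _); rewrite normrM (gtr0_norm h0) -intr_norm.
have : (2%:~R : R) <= (`|b|)%:~R by rewrite ler_int; lia.
rewrite -[2%:~R]/(2 : R) => h3; have : 2 * h <= (`|b|)%:~R * h by rewrite ler_pM2r.
lra.
Qed.

Lemma critical_detE : critical_det p = inf critical_dets. Proof. by []. Qed.

Lemma critical_det_bounds : 8^-1 <= critical_det p < 1.
Proof.
have [h /andP[h0 h1] ch] := exists_lattice_lt1; rewrite critical_detE.
apply/andP; split.
  by apply: lb_le_inf; [exists h|move=> D; exact: critical_dets_ge].
by apply: le_lt_trans h1; apply: ge_inf => //; exists 8^-1 => D; exact: critical_dets_ge.
Qed.

Definition critical_radius : R := critical_det p `^ (- 2^-1).

Lemma critical_radius_gt1 : 1 < critical_radius.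
Proof.
have /andP[d0 d1] := critical_det_bounds.
have dp : 0 < critical_det p by lra.
rewrite /critical_radius powRN invf_gt1 ?powR_gt0//.
have := @ltr_powR _ 2^-1 (critical_det p) 1; rewrite powR1; apply => //.
exact: ltW.
Qed.

Lemma critical_radius_sqr : critical_radius ^+ 2 * critical_det p = 1.
Proof.
have /andP[d0 d1] := critical_det_bounds.
have dp : 0 < critical_det p by lra.
rewrite /critical_radius -powR_mulrn ?powR_ge0// -powRrM.
rewrite (_ : - 2^-1 * 2%:R = -1); last by field.
by rewrite powR_inv1 ?mulVf ?lt0r_neq0// ltW.
Qed.

(** Divided by the critical radius, the lattice becomes one of those over which the critical
    determinant is the infimum. *)
Lemma admissible_det u1 u2 v1 v2 : u1 * v2 - u2 * v1 != 0 ->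
  admissible critical_radius u1 u2 v1 v2 -> 1 <= `|u1 * v2 - u2 * v1|.
Proof.
move=> d0 h.
have r1 := critical_radius_gt1; set r := critical_radius in r1 h.
have r0 : 0 < r by lra.
have rn := lt0r_neq0 r0.
pose s x : R := r^-1 * x.
have ds : s u1 * s v2 - s u2 * s v1 = r ^- 2 * (u1 * v2 - u2 * v1).
  by rewrite /s; field.
have : critical_dets `|s u1 * s v2 - s u2 * s v1|.
  apply: admissible_critical_dets; first by rewrite ds mulf_neq0// invr_eq0 sqrf_eq0.
  move=> a b /h ab.
  have e x y : a%:~R * s x + b%:~R * s y = r^-1 * (a%:~R * x + b%:~R * y).
    by rewrite /s; ring.
  by rewrite !e nmZ// gtr0_norm ?invr_gt0// mulrC ler_pdivlMr// mul1r.
rewrite ds => hD.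
have : critical_det p <= `|r ^- 2 * (u1 * v2 - u2 * v1)|.
  by apply: ge_inf => //; exists 8^-1 => D; exact: critical_dets_ge.
have r20 : 0 < r ^+ 2 by rewrite exprn_gt0.
rewrite normrM gtr0_norm ?invr_gt0// mulrC ler_pdivlMr//.
by rewrite mulrC critical_radius_sqr.
Qed.

End CriticalRadius.

(** * Critical hexagons *)

Lemma finite_gap (R : realType) (I : finType) (P : pred I) (f : I -> R) (r : R) :
  (forall i, P i -> r < f i) ->
  exists2 d, 0 < d & forall i, P i -> r + d <= f i.
Proof.
move=> h; exists (\big[Num.min/1]_(i | P i) (f i - r)).
  by apply: lt_bigmin => // i Pi; rewrite subr_gt0 h.
move=> i Pi; have := bigmin_le_cond 1 (fun i => f i - r) Pi; lra.
Qed.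

Lemma nat_bound (R : realType) (x : R) : exists B : nat, x <= B%:R.
Proof.
by exists (Num.truncn x).+1; exact/ltW/truncnS_gt.
Qed.

Lemma box_gap (R : realType) (B : nat) (P : int -> int -> Prop)
    (f : int -> int -> R) (r : R) :
  (forall j k, P j k -> r < f j k) ->
  exists2 d, 0 < d & forall j k : int, `|j| <= B%:Z -> `|k| <= B%:Z -> P j k ->
    r + d <= f j k.
Proof.
move=> h; pose z (i : 'I_(B + B).+1) : int := i%:Z - B%:Z.
have [d d0 hd] := @finite_gap R _ (fun i : 'I_(B + B).+1 * 'I_(B + B).+1 =>
  `[< P (z i.1) (z i.2) >]) (fun i => f (z i.1) (z i.2)) r
  (fun i Pi => h _ _ (asboolW Pi)).
have zz (j : int) : `|j| <= B%:Z -> exists i, z i = j.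
  move=> jB; have lt : (absz (j + B%:Z)%R < (B + B).+1)%N by lia.
  by exists (Ordinal lt); rewrite /z /=; lia.
exists d => // j k /zz[i <-] /zz[i' <-] Pjk.
by apply: (hd (i, i')) => /=; apply/asboolP.
Qed.

Section Hexagon.
Context {R : realType}.
Variable p : R.
Hypothesis p1 : 1 <= p.

Local Notation r := (critical_radius p).

Let rad1 : 1 < r. Proof. exact: critical_radius_gt1. Qed.

(** Together with Cramer's rule, this bounds the integer coordinates of a vector of bounded norm in
    a basis of determinant 1. *)
Lemma norm_det_le (x1 x2 y1 y2 : R) :
  `|x1 * y2 - x2 * y1| <= (`|x1| + `|x2|) * nm p y1 y2.
Proof.
apply: le_trans (ler_normB _ _) _; rewrite !normrM mulrDl.
by apply: lerD; rewrite ler_wpM2l//; [exact: nm_ge2|exact: nm_ge1].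
Qed.

(* If all the vectors off the line of u were longer than the critical radius,
   the lattice could be compressed onto that line. *)
Lemma critical_off_axis (u1 u2 w1 w2 : R) : u1 * w2 - u2 * w1 = 1 ->
  (forall j : int, j != 0 -> r <= nm p (j%:~R * u1) (j%:~R * u2)) ->
  ~ forall j k : int, k != 0 ->
    r < nm p (j%:~R * u1 + k%:~R * w1) (j%:~R * u2 + k%:~R * w2).
Proof.
move=> D1 h0 h1; have r1 := rad1.
pose M := `|u1| + `|u2| + `|w1| + `|w2|.
have nu1 := normr_ge0 u1; have nu2 := normr_ge0 u2.
have nw1 := normr_ge0 w1; have nw2 := normr_ge0 w2.
have M0 : 0 <= M by rewrite /M; lra.
have [B hB] := nat_bound (2 * M * r).
have B0 : (0 : R) <= B%:R by [].
have [d1 d10 hd1] := @box_gap R B (fun j k => k != 0)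
  (fun j k => nm p (j%:~R * u1 + k%:~R * w1) (j%:~R * u2 + k%:~R * w2)) r h1.
have BM : 0 <= B%:R * M by rewrite mulr_ge0.
have BM1 : 0 < B%:R * M + 1 by lra.
(* Replacing w by (1 - d) w lowers the determinant to 1 - d < 1. Vectors with coefficients up to [B]
   move by at most [d1]; by Cramer's rule the others have norm at least r, where [d <= 2^-1]
   accounts for the factor 2 in [B]. *)
pose d := Num.min 2^-1 (d1 / (B%:R * M + 1)).
have d0 : 0 < d by rewrite lt_min invr_gt0 ltr0n/= divr_gt0.
have d2 : d <= 2^-1 by rewrite /d ge_min lexx.
have dB : d * (B%:R * M) <= d1.
  have : d * (B%:R * M + 1) <= d1 by rewrite -ler_pdivlMr// /d ge_min lexx orbT.
  by rewrite mulrDr; lra.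
have D2 : u1 * ((1 - d) * w2) - u2 * ((1 - d) * w1) = 1 - d.
  by rewrite -[RHS]mulr1 -D1; ring.
have dn0 : 1 - d != 0 by rewrite gt_eqF//; lra.
suff adm : admissible p r u1 u2 ((1 - d) * w1) ((1 - d) * w2).
  have := admissible_det p1 _ adm; rewrite D2 => /(_ dn0).
  by rewrite ger0_norm; lra.
move=> j k jk; rewrite leNgt; apply/negP => hz.
set z1 := _ + _ in hz; set z2 := (j%:~R * u2 + _) in hz.
have Mr n : n <= M -> n * nm p z1 z2 <= M * r.
  move=> nM; have nz := nm_ge0 p z1 z2.
  apply: le_trans (_ : M * nm p z1 z2 <= _); first by rewrite ler_wpM2r.
  by rewrite ler_wpM2l// ltW.
have hk : `|k%:~R : R| * (1 - d) <= M * r.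
  have -> : `|k%:~R : R| * (1 - d) = `|u1 * z2 - u2 * z1|.
    have -> : u1 * z2 - u2 * z1 = k%:~R * (u1 * ((1 - d) * w2) - u2 * ((1 - d) * w1)).
      by rewrite /z1 /z2; ring.
    by rewrite D2 normrM [`|1 - d|]ger0_norm//; lra.
  by apply: le_trans (norm_det_le _ _ _ _) _; apply: Mr; rewrite /M; lra.
have hj : `|j%:~R : R| <= M * r.
  have -> : `|j%:~R : R| = `|w1 * z2 - w2 * z1|.
    have -> : w1 * z2 - w2 * z1 = - (j%:~R * (u1 * w2 - u2 * w1)).
      by rewrite /z1 /z2; ring.
    by rewrite D1 mulr1 normrN.
  by apply: le_trans (norm_det_le _ _ _ _) _; apply: Mr; rewrite /M; lra.
have Mr0 : 0 <= M * r by rewrite mulr_ge0//; lra.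
have kB : `|k| <= B%:Z.
  rewrite -(ler_int R) intr_norm -[(B%:Z)%:~R]/(B%:R : R).
  have : `|k%:~R : R| * 2^-1 <= `|k%:~R : R| * (1 - d) by rewrite ler_wpM2l//; lra.
  by lra.
have jB : `|j| <= B%:Z.
  by rewrite -(ler_int R) intr_norm -[(B%:Z)%:~R]/(B%:R : R); lra.
have [k0|k0] := eqVneq k 0.
  have j0 : j != 0 by apply: contra jk => /eqP->; rewrite k0.
  by have := h0 _ j0; move: hz; rewrite /z1 /z2 k0 !mul0r !addr0; lra.
have := hd1 _ _ jB kB k0.
set y1 := (X in nm p X _); set y2 := (X in nm p _ X) => hy.
have := nmB p1 y1 y2 z1 z2.
have -> : y1 - z1 = k%:~R * d * w1 by rewrite /y1 /z1; ring.
have -> : y2 - z2 = k%:~R * d * w2 by rewrite /y2 /z2; ring.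
rewrite !normrM -mulrDr (gtr0_norm d0).
have kBR : `|k%:~R : R| <= B%:R.
  by rewrite -intr_norm -[B%:R]/((B%:Z)%:~R : R) ler_int.
have : `|k%:~R : R| * d * (`|w1| + `|w2|) <= d * (B%:R * M).
  rewrite [_ * d]mulrC -mulrA ler_pM2l//.
  have wM : `|w1| + `|w2| <= M by rewrite /M; lra.
  by apply: ler_pM => //; lra.
lra.
Qed.

Lemma norm_flip (a b : R) : a = - b -> `|a| = `|b|.
Proof. by move=> ->; rewrite normrN. Qed.

(** The hypotheses force u to be parallel to the edge of the square that contains v. That edge has
    length 2 rr in the norm of the square and u has length rr, so one of the steps u, -u stays on
    the edge. *)
Lemma flat_l1 (rr u1 u2 v1 v2 s y : R) : 0 < s -> 0 < y ->
  `|u1| + `|u2| = rr -> `|v1| + `|v2| = rr ->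
  `|v1 + s * u1| + `|v2 + s * u2| <= rr ->
  `|v1 - y * u1| + `|v2 - y * u2| <= rr ->
  (`|v1 + u1| + `|v2 + u2| <= rr) \/ (`|v1 - u1| + `|v2 - u2| <= rr).
Proof.
move=> s0 y0.
wlog v10 : v1 u1 / 0 <= v1.
  move=> H; have [/H|/ltW v1n] := leP 0 v1; first exact.
  have := H (- v1) (- u1); rewrite oppr_ge0 !normrN.
  rewrite (@norm_flip (- v1 + s * - u1) (v1 + s * u1)); last by ring.
  rewrite (@norm_flip (- v1 - y * - u1) (v1 - y * u1)); last by ring.
  rewrite (@norm_flip (- v1 + - u1) (v1 + u1)); last by ring.
  rewrite (@norm_flip (- v1 - - u1) (v1 - u1)); last by ring.
  exact.
wlog v20 : v2 u2 / 0 <= v2.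
  move=> H; have [/H|/ltW v1n] := leP 0 v2; first exact.
  have := H (- v2) (- u2); rewrite oppr_ge0 !normrN.
  rewrite (@norm_flip (- v2 + s * - u2) (v2 + s * u2)); last by ring.
  rewrite (@norm_flip (- v2 - y * - u2) (v2 - y * u2)); last by ring.
  rewrite (@norm_flip (- v2 + - u2) (v2 + u2)); last by ring.
  rewrite (@norm_flip (- v2 - - u2) (v2 - u2)); last by ring.
  exact.
rewrite (ger0_norm v10) (ger0_norm v20) => hu hv hs hy.
have a1 := ler_norm (v1 + s * u1); have a2 := ler_norm (v2 + s * u2).
have a3 := ler_norm (v1 - y * u1); have a4 := ler_norm (v2 - y * u2).
have b1 : u1 + u2 <= 0 by rewrite -(pmulr_rle0 _ s0) mulrDr; lra.
have b2 : 0 <= u1 + u2 by rewrite -(pmulr_rge0 _ y0) mulrDr; lra.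
have e : u2 = - u1 by lra.
move: hu; rewrite e normrN => hu.
have [u0|u0] := leP 0 u1.
  rewrite (ger0_norm u0) in hu.
  by have [h|h] := leP u1 v2; [left|right]; rewrite !ger0_norm; lra.
rewrite (ltr0_norm u0) in hu.
by have [h|h] := leP (- u1) v1; [left|right]; rewrite !ger0_norm; lra.
Qed.

(** Here v is an interior point of a chord of the ball of radius r and lies on its sphere: strict
    convexity excludes this for p > 1, and for p = 1 the chord lies on an edge. *)
Lemma flat_edge (u1 u2 v1 v2 s y : R) : 0 < s -> 0 < y ->
  nm p u1 u2 = r -> nm p v1 v2 = r ->
  nm p (v1 + s * u1) (v2 + s * u2) <= r -> nm p (v1 - y * u1) (v2 - y * u2) <= r ->
  (nm p (v1 + u1) (v2 + u2) <= r) \/ (nm p (v1 - u1) (v2 - u2) <= r).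
Proof.
have r1 := rad1.
move=> s0 y0; have r0 : 0 <= r by lra.
move: (p1); rewrite le_eqVlt => /orP[/eqP<-|p1'].
  have e x z : nm 1 x z = `|x| + `|z| by rewrite nmE invr1 !powRr1// addr_ge0.
  rewrite !e; exact: flat_l1.
move=> hu hv /nm_leP h1 /nm_leP h2; exfalso.
have {}h1 := h1 p1 r0; have {}h2 := h2 p1 r0.
have := nm_powR p1 v1 v2; rewrite hv => h3.
pose l := y / (s + y).
have l0 : 0 < l < 1.
  by rewrite /l divr_gt0 ?addr_gt0//= ltr_pdivrMr ?addr_gt0// mul1r; lra.
have l01 : 0 <= l <= 1 by lra.
have cv v u : l * (v + s * u) + (1 - l) * (v - y * u) = v.
  by rewrite /l; field; rewrite gt_eqF ?addr_gt0.
have ne v u : u != 0 -> v + s * u != v - y * u.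
  move=> u0; rewrite -subr_eq0.
  have -> : v + s * u - (v - y * u) = (s + y) * u by ring.
  by rewrite mulf_neq0// gt_eqF ?addr_gt0.
have le v u : `|v| `^ p <= l * `|v + s * u| `^ p + (1 - l) * `|v - y * u| `^ p.
  have [->|u0] := eqVneq u 0; first by rewrite !mulr0 addr0 subr0; lra.
  by rewrite -[X in `|X| `^ p <= _](cv v u); apply/ltW/powR_abs_conv_lt; rewrite ?ne.
have lt v u : u != 0 -> `|v| `^ p < l * `|v + s * u| `^ p + (1 - l) * `|v - y * u| `^ p.
  by move=> u0; rewrite -[X in `|X| `^ p < _](cv v u); apply: powR_abs_conv_lt; rewrite ?ne.
case/andP: l0 => l0 l2.
have : l * (`|v1 + s * u1| `^ p + `|v2 + s * u2| `^ p) <= l * r `^ p by rewrite ler_pM2l.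
have : (1 - l) * (`|v1 - y * u1| `^ p + `|v2 - y * u2| `^ p) <= (1 - l) * r `^ p.
  by rewrite ler_pM2l// subr_gt0.
have [e1|n1] := eqVneq u1 0; last by have := lt v1 u1 n1; have := le v2 u2; lra.
have [e2|n2] := eqVneq u2 0; last by have := lt v2 u2 n2; have := le v1 u1; lra.
by move: hu; rewrite e1 e2 nm_axis1// normr0; lra.
Qed.


(** The s for which v + s u has norm at most r form an interval. It meets every coset of Z, since
    otherwise the sheared lattice of u and v + s u would contradict [critical_off_axis]. So it
    contains an integer [j0]. If it extends to both sides of [j0], then [flat_edge] provides a
    neighbour; if to one side only, it fills an open unit interval next to [j0], and continuity
    gives the neighbour. *)
Lemma hexagon_completion (u1 u2 v1 v2 : R) : u1 * v2 - u2 * v1 = 1 ->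
  admissible p r u1 u2 v1 v2 -> nm p u1 u2 = r ->
  exists j : int, nm p (v1 + j%:~R * u1) (v2 + j%:~R * u2) = r /\
    nm p (v1 + (j + 1)%:~R * u1) (v2 + (j + 1)%:~R * u2) = r.
Proof.
move=> D1 adm hu; have r1 := rad1.
have r0 : 0 <= r by lra.
pose f s := nm p (v1 + s * u1) (v2 + s * u2).
have fZ (j : int) : r <= f j%:~R.
  have := adm j 1; rewrite !mul1r ![_ + v1]addrC ![_ + v2]addrC; apply.
  by apply/eqP => -[].
have fconv l x y : 0 <= l <= 1 -> f x <= r -> f y <= r -> f (l * x + (1 - l) * y) <= r.
  move=> l01 hx hy; have := nm_conv p1 l01 r0 hx hy.
  by rewrite /f; congr (nm p _ _ <= r); ring.
have fbetween x y z : f x <= r -> f z <= r -> x <= y <= z -> x < z -> f y <= r.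
  move=> hx hz /andP[xy yz] xz.
  have -> : y = (z - y) / (z - x) * x + (1 - (z - y) / (z - x)) * z.
    by field; lra.
  apply: fconv => //; rewrite divr_ge0 ?subr_ge0 ?(ltW xz)//=.
  by rewrite ler_pdivrMr ?subr_gt0// mul1r; lra.
have flip x y : f x <= f y + `|x - y| * r.
  have := nmD p1 (v1 + y * u1) (v2 + y * u2) ((x - y) * u1) ((x - y) * u2).
  by rewrite nmZ// hu /f; congr (nm p _ _ <= _); ring.
have cover s : exists j : int, f (s + j%:~R) <= r.
  apply: contrapT => /forallNP H.
  have {}H (j : int) : r < f (s + j%:~R) by rewrite ltNge; apply/negP/H.
  (* For the vectors with |k| >= 2 below: x is within 1/2 of s + Z, where f > r, and f is Lipschitz
     with constant r. *)
  have half x : r < 2 * f x.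
    rewrite ltNge; apply/negP => fx.
    have [j hj] := int_round (x - s).
    have := flip (s + j%:~R) x; have := H j.
    rewrite (@norm_flip _ (x - s - j%:~R)); last by ring.
    have : `|x - s - j%:~R| * r <= 2^-1 * r by rewrite ler_wpM2r.
    lra.
  apply: (@critical_off_axis u1 u2 (v1 + s * u1) (v2 + s * u2)).
  - by rewrite -[RHS]D1; ring.
  - move=> j j0; rewrite nmZ// hu; have := @intr_norm_ge1 R j j0 => h.
    by rewrite -[leLHS]mul1r ler_wpM2r.
  move=> j k k0.
  have kR : (k%:~R : R) != 0 by rewrite intr_eq0.
  have -> : nm p (j%:~R * u1 + k%:~R * (v1 + s * u1)) (j%:~R * u2 + k%:~R * (v2 + s * u2))
     = `|k%:~R| * f (s + j%:~R / k%:~R).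
    by rewrite /f -nmZ//; congr (nm p _ _); field.
  have [k1|k1] := eqVneq `|k| 1.
    rewrite -intr_norm k1 mul1r.
    have [ek|ek] : k = 1 \/ k = - 1 by lia.
      by rewrite ek divr1.
    rewrite ek; have -> : (j%:~R / (-1)%:~R : R) = (- j)%:~R by rewrite !intrN; field.
    exact: H.
  have k2 : (2 : R) <= `|k%:~R| by rewrite -intr_norm -[2]/((2 : int)%:~R) ler_int; lia.
  apply: lt_le_trans (half (s + j%:~R / k%:~R)) _.
  by rewrite ler_wpM2r// /f nm_ge0.
have [j0 hj0] := cover 0; rewrite add0r in hj0.
suff [h|h] : f (j0%:~R + 1) <= r \/ f (j0%:~R - 1) <= r.
- exists j0; split; apply/le_anti; rewrite fZ andbT//.
  by rewrite intrD.
- exists (j0 - 1); split; apply/le_anti; rewrite fZ andbT// ?subrK//.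
  by rewrite intrB.
apply: contrapT => /not_orP[/negP + /negP]; rewrite -!ltNge.
pose F x := f (j0%:~R + x); rewrite -/(F 1) -/(F (-1)) => F1 FN1.
have F0 : F 0 <= r by rewrite /F addr0.
have Fb x y z : F x <= r -> F z <= r -> x <= y <= z -> x < z -> F y <= r.
  by move=> hx hz xyz xz; apply: (fbetween _ _ _ hx hz); lra.
have Fc s : 0 < s < 1 -> F s <= r \/ F (s - 1) <= r.
  move=> s01; have [j hj] := cover (j0%:~R + s).
  have {}hj : F (s + j%:~R) <= r by rewrite /F addrA.
  have [jn|jp] := ltP j 0; last first.
    have [j00|jn0] := eqVneq j 0; first by left; rewrite j00 addr0 in hj.
    have j1 : (1 : R) <= j%:~R by rewrite ler1z -gtz0_ge1 lt_def jn0.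
    have : F 1 <= r by apply: (Fb 0 1 _ F0 hj); lra.
    by lra.
  have [j00|jn0] := eqVneq j (-1); first by right; rewrite j00 in hj.
  have j2 : j <= -2 by clear -jn jn0; lia.
  rewrite -(ler_int R) -[(-2)%:~R]/(-2 : R) in j2.
  have : F (-1) <= r by apply: (Fb _ (-1) _ hj F0); lra.
  by lra.
have Fn : ~ exists s y, [/\ 0 < s, 0 < y, F s <= r & F (- y) <= r].
  move=> [s [y [s0 y0 hs hy]]].
  have e0 : f j0%:~R = r by apply/le_anti; rewrite hj0 fZ.
  have := @flat_edge u1 u2 (v1 + j0%:~R * u1) (v2 + j0%:~R * u2) s y s0 y0 hu e0.
  have -> : v1 + j0%:~R * u1 + s * u1 = v1 + (j0%:~R + s) * u1 by ring.
  have -> : v2 + j0%:~R * u2 + s * u2 = v2 + (j0%:~R + s) * u2 by ring.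
  have -> : v1 + j0%:~R * u1 - y * u1 = v1 + (j0%:~R - y) * u1 by ring.
  have -> : v2 + j0%:~R * u2 - y * u2 = v2 + (j0%:~R - y) * u2 by ring.
  move=> /(_ hs hy).
  have -> : v1 + j0%:~R * u1 + u1 = v1 + (j0%:~R + 1) * u1 by ring.
  have -> : v2 + j0%:~R * u2 + u2 = v2 + (j0%:~R + 1) * u2 by ring.
  have -> : v1 + j0%:~R * u1 - u1 = v1 + (j0%:~R - 1) * u1 by ring.
  have -> : v2 + j0%:~R * u2 - u2 = v2 + (j0%:~R - 1) * u2 by ring.
  by rewrite -/(f _) -/(f _) -/(F 1) -/(F (-1)) => -[]; lra.
have FL x y : F x <= F y + `|x - y| * r.
  by have := flip (j0%:~R + x) (j0%:~R + y); rewrite opprD addrACA subrr add0r.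
have h12 : 0 < (2^-1 : R) < 1 by lra.
have [h|h] := Fc _ h12.
(* The point g is so close to 1 that F 1 > r would give F g > r by the Lipschitz bound, whereas F <=
   r on all of (0, 1). *)
- pose g := Num.max 2^-1 (1 - (F 1 - r) / (2 * r)).
  have g1 : 0 < g < 1.
    rewrite lt_max gt_max; apply/andP; split; first by apply/orP; left; lra.
    apply/andP; split; first lra.
    by rewrite ltrBlDr ltrDl divr_gt0//; lra.
  have hg : F g <= r.
    have [//|hg] := Fc _ g1; exfalso; apply: Fn; exists 2^-1, (1 - g).
    by rewrite opprB; split=> //; lra.
  have := FL 1 g; rewrite ger0_norm; last by lra.
  have gl : 1 - (F 1 - r) / (2 * r) <= g by rewrite /g le_max lexx orbT.
  have : (1 - g) * r <= (F 1 - r) / (2 * r) * r by rewrite ler_wpM2r//; lra.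
  have -> : (F 1 - r) / (2 * r) * r = (F 1 - r) / 2 by field; lra.
  by lra.
- pose g := Num.max 2^-1 (1 - (F (-1) - r) / (2 * r)).
  have g1 : 0 < g < 1.
    rewrite lt_max gt_max; apply/andP; split; first by apply/orP; left; lra.
    apply/andP; split; first lra.
    by rewrite ltrBlDr ltrDl divr_gt0//; lra.
  have g2 : 0 < 1 - g < 1 by lra.
  have hg : F (- g) <= r.
    have [hg|] := Fc _ g2; last by rewrite addrAC subrr sub0r.
    exfalso; apply: Fn; exists (1 - g), 2^-1; split => //; try lra.
    by move: h; congr (F _ <= r); lra.
  have := FL (-1) (- g); rewrite ler0_norm; last by lra.
  have gl : 1 - (F (-1) - r) / (2 * r) <= g by rewrite /g le_max lexx orbT.
  have : (1 - g) * r <= (F (-1) - r) / (2 * r) * r by rewrite ler_wpM2r//; lra.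
  have -> : (F (-1) - r) / (2 * r) * r = (F (-1) - r) / 2 by field; lra.
  by lra.
Qed.

Lemma critical_hexagon (u1 u2 v1 v2 : R) : u1 * v2 - u2 * v1 = 1 ->
  admissible p r u1 u2 v1 v2 ->
  exists a b c d : int, [/\ a * d - b * c = 1,
    nm p (a%:~R * u1 + b%:~R * v1) (a%:~R * u2 + b%:~R * v2) = r,
    nm p (c%:~R * u1 + d%:~R * v1) (c%:~R * u2 + d%:~R * v2) = r &
    nm p ((a + c)%:~R * u1 + (b + d)%:~R * v1)
         ((a + c)%:~R * u2 + (b + d)%:~R * v2) = r].
Proof.
move=> D1 adm; have r1 := rad1; have r0 : 0 <= r by lra.
pose g (a b : int) := nm p (a%:~R * u1 + b%:~R * v1) (a%:~R * u2 + b%:~R * v2).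
(* If all vectors were longer than r, [critical_off_axis] would apply to the given basis. *)
have [a [b [ab0 hab]]] : exists a b : int, (a, b) != (0, 0) /\ g a b <= r.
  apply: contrapT => H.
  have {}H (a b : int) : (a, b) != (0, 0) -> r < g a b.
    move=> ab; rewrite ltNge; apply/negP => h; apply: H.
    by exists a, b.
  apply: (critical_off_axis D1) => [j j0|j k k0].
    have := H j 0; rewrite /g !mul0r !addr0 => h; apply/ltW/h.
    by apply: contra j0 => /eqP[->].
  by apply: H; apply: contra k0 => /eqP[_ ->].
pose d := gcdz a b.
have d0 : 0 < d.
  by rewrite lt_def gcdz_eq0 lez_nat andbT; apply: contra ab0 => /andP[/eqP-> /eqP->].
have [a' ea] : exists a', a = a' * d by apply/dvdzP; exact: dvdz_gcdl.
have [b' eb] : exists b', b = b' * d by apply/dvdzP; exact: dvdz_gcdr.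
have gd : g a b = d%:~R * g a' b'.
  rewrite /g -[d%:~R]ger0_norm ?ler0z ?(ltW d0)// -nmZ// ea eb !intrM.
  by congr (nm p _ _); ring.
(* For d >= 2 the primitive vector would have norm at most r/2, against admissibility. *)
have d1 : d = 1.
  have h : r <= g a' b'.
    by apply: adm; apply: contra ab0 => /eqP[a0 b0]; rewrite ea eb a0 b0 !mul0r.
  apply/eqP; rewrite eq_le -(gtz0_ge1 d) d0 andbT -(ler_int R).
  have dR : 0 <= (d%:~R : R) by rewrite ler0z ltW.
  have : d%:~R * r <= d%:~R * g a' b' by rewrite ler_wpM2l.
  rewrite -gd => h2; rewrite -(ler_pM2r (_ : 0 < r)) ?mul1r; lra.
have [x [y exy]] := Bezoutz a b; rewrite -/d d1 in exy.
pose c0 : int := - y; pose d2 : int := x.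
have e1 : a * d2 - b * c0 = 1 by rewrite -exy /c0 /d2; ring.
have e1R : a%:~R * d2%:~R - b%:~R * c0%:~R = 1 :> R by rewrite -!intrM -intrB e1.
have D2 : (a%:~R * u1 + b%:~R * v1) * (c0%:~R * u2 + d2%:~R * v2) -
    (a%:~R * u2 + b%:~R * v2) * (c0%:~R * u1 + d2%:~R * v1) = 1.
  transitivity ((a%:~R * d2%:~R - b%:~R * c0%:~R) * (u1 * v2 - u2 * v1)); first by ring.
  by rewrite e1R D1 mulr1.
have adm2 : admissible p r (a%:~R * u1 + b%:~R * v1) (a%:~R * u2 + b%:~R * v2)
    (c0%:~R * u1 + d2%:~R * v1) (c0%:~R * u2 + d2%:~R * v2).
  move=> i k ik.
  have := adm (i * a + k * c0) (i * b + k * d2).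
  rewrite !intrD !intrM; have e (s t : R) : i%:~R * (a%:~R * s + b%:~R * t) +
      k%:~R * (c0%:~R * s + d2%:~R * t) =
      (i%:~R * a%:~R + k%:~R * c0%:~R) * s + (i%:~R * b%:~R + k%:~R * d2%:~R) * t by ring.
  rewrite !e; apply; apply: contra ik => /eqP[h1 h2].
  have hi : i = 0.
    transitivity (i * (a * d2 - b * c0)); first by rewrite e1 mulr1.
    transitivity ((i * a + k * c0) * d2 - (i * b + k * d2) * c0); first by ring.
    by rewrite h1 h2 !mul0r subr0.
  have hk : k = 0.
    transitivity (k * (a * d2 - b * c0)); first by rewrite e1 mulr1.
    transitivity ((i * b + k * d2) * a - (i * a + k * c0) * b); first by ring.
    by rewrite h1 h2 !mul0r subr0.
  by rewrite hi hk.
have gr : nm p (a%:~R * u1 + b%:~R * v1) (a%:~R * u2 + b%:~R * v2) = r.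
  by apply/le_anti; rewrite [X in X && _]hab adm.
have [j [h1 h2]] := hexagon_completion D2 adm2 gr.
exists a, b, (c0 + j * a), (d2 + j * b); split => //.
- by rewrite -[RHS]e1; ring.
- by rewrite -h1; congr (nm p _ _); rewrite !intrD !intrM; ring.
- by rewrite -h2; congr (nm p _ _); rewrite !intrD !intrM; ring.
Qed.

End Hexagon.

(** * Critical lattices along a horocycle *)

Section Leaf.
Context {R : realType}.
Variable p : R.
Hypothesis p1 : 1 <= p.

Let p0 : 0 < p. Proof. by apply: lt_le_trans p1. Qed.

Lemma abs_sum3 (a b c : R) : a + b + c = 0 -> `|b| <= `|a| -> `|c| <= `|a| ->
  `|a| = `|b| + `|c|.
Proof.
move=> abc ba ca; have [b0|b0] := leP 0 b; have [c0|c0] := leP 0 c.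
- by rewrite (ger0_norm b0) (ger0_norm c0) ler0_norm; lra.
- move: ba ca; rewrite (ger0_norm b0) (ltr0_norm c0).
  by have [a0|a0] := leP 0 a; [rewrite ger0_norm//|rewrite ltr0_norm//]; lra.
- move: ba ca; rewrite (ger0_norm c0) (ltr0_norm b0).
  by have [a0|a0] := leP 0 a; [rewrite ger0_norm//|rewrite ltr0_norm//]; lra.
- by rewrite (ltr0_norm b0) (ltr0_norm c0) ger0_norm; lra.
Qed.

Lemma abs_sum3_eq (a b c a' b' c' : R) : a + b + c = 0 -> a' + b' + c' = 0 ->
  `|b| <= `|a| -> `|a| = `|a'| -> `|b| = `|b'| -> `|c| = `|c'| ->
  (a = a' /\ b = b') \/ (a = - a' /\ b = - b').
Proof.
move=> h h' ba.
wlog ea : a' b' c' h' / a = a'.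
  move=> H /eqP; rewrite eqr_norm2 => /orP[]/eqP ea hb hc.
    by apply: (H a' b' c') => //; rewrite ea.
  have [] := H (- a') (- b') (- c'); rewrite ?normrN ?ea ?normrN//; first by lra.
    by move=> [_ ->]; right.
  by rewrite !opprK => -[h1 ->]; left.
move=> _ /eqP; rewrite eqr_norm2 => /orP[]/eqP hb /eqP; first by left.
rewrite eqr_norm2 => /orP[]/eqP hc; first by left; lra.
have a0 : a = 0 by lra.
by move: ba; rewrite a0 normr0 normr_le0 => /eqP b0; left; split; lra.
Qed.

(* As the scale S increases, the largest ordinate decreases too slowly to
   remain the sum of the two others. *)
Lemma leaf_scale_lt (rho a1 a2 a3 S S' y1 y2 y3 y1' y2' y3' : R) :
  a1 <= a2 -> 0 < a3 -> S < S' ->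
  0 <= y1 -> 0 <= y2 -> 0 <= y3 -> 0 <= y1' -> 0 <= y2' -> 0 <= y3' ->
  0 <= a1 ->
  a1 * S + y1 `^ p = rho -> a2 * S + y2 `^ p = rho -> a3 * S + y3 `^ p = rho ->
  a1 * S' + y1' `^ p = rho -> a2 * S' + y2' `^ p = rho ->
  a3 * S' + y3' `^ p = rho ->
  y1 = y2 + y3 -> y1' = y2' + y3' -> False.
Proof.
move=> a12 a30 SS hy1 hy2 hy3 hy1' hy2' hy3' a10 e1 e2 e3 e1' e2' e3' s s'.
have tau : 0 < S' - S by lra.
have le (y y' a : R) : 0 <= y -> a * S + y `^ p = rho -> 0 <= a ->
    a * S' + y' `^ p = rho -> y' <= y.
  move=> y0 e a0 e'; rewrite leNgt; apply/negP => /(ltr_powR p0 y0) lt.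
  have : 0 <= a * (S' - S) by rewrite mulr_ge0// ltW.
  by rewrite mulrBr; lra.
have a20 : 0 <= a2 by lra.
have l1 := le _ _ _ hy1 e1 a10 e1'.
have l2 := le _ _ _ hy2 e2 a20 e2'.
have l3 : y3' < y3.
  rewrite lt_neqAle (le _ _ _ hy3 e3 (ltW a30) e3') andbT; apply/eqP => e.
  have : 0 < a3 * (S' - S) by rewrite mulr_gt0.
  by rewrite mulrBr; move: e3'; rewrite e; lra.
(* Raising [y2'] by d increases its p-th power by at most a1 (S' - S) <= a2 (S' - S), by convexity,
   and the latter is the difference of the p-th powers of [y2] and [y2']. But y2 < y2' + d, because
   the third ordinate strictly decreases. *)
pose d := y1 - y1'.
have d0 : 0 <= d by rewrite /d; lra.
have y12 : 0 <= y2' <= y1' by lra.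
have := powR_incr p1 y12 d0.
have -> : y1' + d = y1 by rewrite /d; ring.
have : y2 `^ p < (y2' + d) `^ p by apply: ltr_powR => //; rewrite /d; lra.
have : a1 * (S' - S) <= a2 * (S' - S) by rewrite ler_wpM2r// ltW.
by rewrite !mulrBr; lra.
Qed.

(** The smallest abscissa goes with the largest ordinate, so |y1| = |y2| + |y3| for both parameters,
    and [leaf_scale_lt] forces s = s'. The ordinates then have equal moduli, hence agree up to one
    common sign. *)
Lemma leaf_unique_ord (rho x1 x2 x3 Y1 Y2 Y3 s g b s' g' b' : R) :
  0 <= rho -> `|x1| <= `|x2| -> `|x1| <= `|x3| ->
  x1 + x2 + x3 = 0 -> Y1 + Y2 + Y3 = 0 -> x1 * Y2 - x2 * Y1 != 0 ->
  0 < s -> 0 < s' -> s * g = 1 -> s' * g' = 1 ->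
  nm p (s * x1) ((Y1 - b * x1) * g) = rho ->
  nm p (s * x2) ((Y2 - b * x2) * g) = rho ->
  nm p (s * x3) ((Y3 - b * x3) * g) = rho ->
  nm p (s' * x1) ((Y1 - b' * x1) * g') = rho ->
  nm p (s' * x2) ((Y2 - b' * x2) * g') = rho ->
  nm p (s' * x3) ((Y3 - b' * x3) * g') = rho ->
  b = b'.
Proof.
move=> rho0 x12 x13 sx sY det s0 s0' sg sg' n1 n2 n3 n1' n2' n3'.
have x30 : 0 < `|x3|.
  rewrite normr_gt0; apply: contra det => /eqP x30.
  move: x13; rewrite x30 normr0 normr_le0 => /eqP x10.
  have -> : x2 = 0 by lra.
  by rewrite x10 !mul0r subr0.
have E (z y t : R) : 0 < t -> nm p (t * z) y = rho ->
    `|z| `^ p * t `^ p + `|y| `^ p = rho `^ p.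
  move=> t0 <-; rewrite nm_powR// normrM powRM// (gtr0_norm t0).
  by rewrite mulrC.
have e1 := E _ _ _ s0 n1; have e2 := E _ _ _ s0 n2; have e3 := E _ _ _ s0 n3.
have e1' := E _ _ _ s0' n1'; have e2' := E _ _ _ s0' n2'; have e3' := E _ _ _ s0' n3'.
set y1 := (Y1 - b * x1) * g in e1; set y2 := (Y2 - b * x2) * g in e2.
set y3 := (Y3 - b * x3) * g in e3; set y1' := (Y1 - b' * x1) * g' in e1'.
set y2' := (Y2 - b' * x2) * g' in e2'; set y3' := (Y3 - b' * x3) * g' in e3'.
have sy : y1 + y2 + y3 = 0.
  transitivity (((Y1 + Y2 + Y3) - b * (x1 + x2 + x3)) * g); first by rewrite /y1 /y2 /y3; ring.
  by rewrite sx sY mulr0 subr0 mul0r.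
have sy' : y1' + y2' + y3' = 0.
  transitivity (((Y1 + Y2 + Y3) - b' * (x1 + x2 + x3)) * g'); first by rewrite /y1' /y2' /y3'; ring.
  by rewrite sx sY mulr0 subr0 mul0r.
have a12 : `|x1| `^ p <= `|x2| `^ p by apply: ler_powRl.
have a13 : `|x1| `^ p <= `|x3| `^ p by apply: ler_powRl.
have a30 : 0 < `|x3| `^ p by rewrite powR_gt0.
have le (y y' a a' t : R) : a * t `^ p + `|y| `^ p = rho `^ p ->
    a' * t `^ p + `|y'| `^ p = rho `^ p -> a <= a' -> `|y'| <= `|y|.
  move=> f f' aa; rewrite leNgt; apply/negP => /(ltr_powR p0 (normr_ge0 _)) lt.
  have : a * t `^ p <= a' * t `^ p by rewrite ler_wpM2r// powR_ge0.
  lra.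
have sa := abs_sum3 sy (le _ _ _ _ _ e1 e2 a12) (le _ _ _ _ _ e1 e3 a13).
have sa' := abs_sum3 sy' (le _ _ _ _ _ e1' e2' a12) (le _ _ _ _ _ e1' e3' a13).
have eS : s `^ p = s' `^ p.
  have nn z : 0 <= `|z : R| by [].
  have a10 := powR_ge0 `|x1| p.
  case: (ltgtP (s `^ p) (s' `^ p)) => // lt; exfalso.
    exact: (leaf_scale_lt a12 a30 lt (nn _) (nn _) (nn _) (nn _) (nn _) (nn _)
      a10 e1 e2 e3 e1' e2' e3' sa sa').
  exact: (leaf_scale_lt a12 a30 lt (nn _) (nn _) (nn _) (nn _) (nn _) (nn _)
    a10 e1' e2' e3' e1 e2 e3 sa' sa).
have es : s = s' by apply: (powR_injective p0); rewrite ?nnegrE ?ltW.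
have eg : g = g'.
  by apply: (mulfI (lt0r_neq0 s0)); rewrite sg es sg'.
have abs (y y' a : R) : a * s `^ p + `|y| `^ p = rho `^ p ->
    a * s' `^ p + `|y'| `^ p = rho `^ p -> `|y| = `|y'|.
  move=> f f'; apply: (powR_injective p0); rewrite ?nnegrE//.
  by move: f f'; rewrite eS; lra.
have g0 : g != 0 by apply/eqP => g0; move: sg; rewrite g0 mulr0 => /esym/eqP; rewrite oner_eq0.
have bx (x Y : R) : (Y - b * x) * g = (Y - b' * x) * g' -> (b - b') * x = 0.
  rewrite -eg => /(mulIf g0); lra.
have bxN (x Y : R) : (Y - b * x) * g = - ((Y - b' * x) * g') -> 2 * Y = (b + b') * x.
  by rewrite -eg -[RHS]mulNr => /(mulIf g0); lra.
have [[h1 h2]|[h1 h2]] := abs_sum3_eq sy sy' (le _ _ _ _ _ e1 e2 a12)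
  (abs _ _ _ e1 e1') (abs _ _ _ e2 e2') (abs _ _ _ e3 e3').
- have := bx _ _ h1; have := bx _ _ h2; move=> k2 k1.
  apply/eqP; rewrite -subr_eq0; apply: contraT => bb.
  move/eqP: k1; rewrite mulf_eq0 (negPf bb) => /eqP k1.
  move/eqP: k2; rewrite mulf_eq0 (negPf bb) => /eqP k2.
  by move: det; rewrite k1 k2 !mul0r subrr eqxx.
(* Opposite signs would make (Y1, Y2) proportional to (x1, x2), against the nonzero determinant. *)
- have k1 := bxN _ _ h1; have k2 := bxN _ _ h2; exfalso.
  have : 2 * (x1 * Y2 - x2 * Y1) = 0.
    transitivity (x1 * (2 * Y2) - x2 * (2 * Y1)); first by ring.
    by rewrite k1 k2; ring.
  by move/eqP; rewrite mulf_eq0 (negPf det) orbF pnatr_eq0.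
Qed.

(** With -(x1 + x2) as third vector the triple is symmetric, and whichever abscissa is smallest can
    be put first. *)
Lemma leaf_unique (rho x1 x2 Y1 Y2 s g b s' g' b' : R) :
  0 <= rho -> x1 * Y2 - x2 * Y1 != 0 ->
  0 < s -> 0 < s' -> s * g = 1 -> s' * g' = 1 ->
  nm p (s * x1) ((Y1 - b * x1) * g) = rho ->
  nm p (s * x2) ((Y2 - b * x2) * g) = rho ->
  nm p (s * (x1 + x2)) ((Y1 + Y2 - b * (x1 + x2)) * g) = rho ->
  nm p (s' * x1) ((Y1 - b' * x1) * g') = rho ->
  nm p (s' * x2) ((Y2 - b' * x2) * g') = rho ->
  nm p (s' * (x1 + x2)) ((Y1 + Y2 - b' * (x1 + x2)) * g') = rho ->
  b = b'.
Proof.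
move=> rho0 det s0 s0' sg sg' n1 n2 n3 n1' n2' n3'.
pose x3 := - (x1 + x2); pose Y3 := - (Y1 + Y2).
have neg t c h : nm p (t * x3) ((Y3 - c * x3) * h) =
    nm p (t * (x1 + x2)) ((Y1 + Y2 - c * (x1 + x2)) * h).
  by rewrite -[RHS]nmN; congr nm; rewrite /x3 /Y3; ring.
rewrite -neg in n3; rewrite -neg in n3'.
have sx : x1 + x2 + x3 = 0 by rewrite /x3 subrr.
have sY : Y1 + Y2 + Y3 = 0 by rewrite /Y3 subrr.
have sx' : x2 + x1 + x3 = 0 by rewrite /x3; ring.
have sY' : Y2 + Y1 + Y3 = 0 by rewrite /Y3; ring.
have sx2 : x3 + x1 + x2 = 0 by rewrite /x3; ring.
have sY2 : Y3 + Y1 + Y2 = 0 by rewrite /Y3; ring.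
have det' : x2 * Y1 - x1 * Y2 != 0 by rewrite -oppr_eq0 opprB.
have det3 : x3 * Y1 - x1 * Y3 != 0.
  by apply: contra det' => /eqP e; rewrite -oppr_eq0 -e /x3 /Y3; apply/eqP; ring.
have [x12|/ltW x21] := leP `|x1| `|x2|.
  have [x13|/ltW x31] := leP `|x1| `|x3|.
    exact: (leaf_unique_ord rho0 x12 x13 sx sY det s0 s0' sg sg' n1 n2 n3 n1' n2' n3').
  exact: (leaf_unique_ord rho0 x31 (le_trans x31 x12) sx2 sY2 det3 s0 s0' sg sg'
    n3 n1 n2 n3' n1' n2').
have [x23|/ltW x32] := leP `|x2| `|x3|.
  exact: (leaf_unique_ord rho0 x21 x23 sx' sY' det' s0 s0' sg sg' n2 n1 n3 n2' n1' n3').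
exact: (leaf_unique_ord rho0 (le_trans x32 x21) x32 sx2 sY2 det3 s0 s0' sg sg'
  n3 n1 n2 n3' n1' n2').
Qed.

End Leaf.

(** * Limits along an ultrafilter *)

Section UltraLimits.
Context {R : realType} (U : set_system nat) {UU : UltraFilter U}.

(** One ultrafilter makes all bounded sequences converge at once, which replaces successive
    extractions of subsequences. *)
Lemma ultra_bounded_cvg (f : nat -> R) (M : R) : (forall k, `|f k| <= M) ->
  exists l : R, f k @[k --> U] --> l.
Proof.
move=> fM; have H := @segment_compact R (- M) M.
have FA : U (f @^-1` `[- M, M]%classic).
  by apply: filterE => k; rewrite /= in_itv /= -ler_norml.
have [l [_ cl]] := H (fmap f U) _ FA; exists l => A nA.
have [//|nAf] := in_ultra_setVsetC (f @^-1` A) UU.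
have [y [/=]] := cl (~` A) A nAf nA; by [].
Qed.

Lemma ultra_le (f : nat -> R) (l c : R) : f k @[k --> U] --> l ->
  (forall k, c <= f k) -> c <= l.
Proof.
move=> fl cf; rewrite leNgt; apply/negP => lc.
have lc0 : 0 < c - l by rewrite subr_gt0.
have /cvgrPdist_lt/(_ _ lc0)/filter_ex[k /=] := fl.
by rewrite distrC => /(le_lt_trans (ler_norm _)); have := cf k; lra.
Qed.

Lemma ultra_norm_ge (f : nat -> R) (l c : R) : f k @[k --> U] --> l ->
  (forall k, c <= `|f k|) -> c <= `|l|.
Proof. by move=> /cvg_norm fl; exact: ultra_le. Qed.

Lemma ultra_norm_le (f : nat -> R) (l c : R) : f k @[k --> U] --> l ->
  (forall k, `|f k| <= c) -> `|l| <= c.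
Proof.
move=> /cvg_norm/cvgN fl cf; rewrite -lerN2.
by apply: (ultra_le fl) => k /=; rewrite lerN2.
Qed.

Lemma ultra_eq (f : nat -> R) (l c : R) : f k @[k --> U] --> l ->
  (forall k, f k = c) -> l = c.
Proof.
move=> fl fc; apply/le_anti/andP; split; last by apply: (ultra_le fl) => k; rewrite fc.
rewrite -lerN2; apply: (ultra_le (cvgN fl)) => k /=; by rewrite fc.
Qed.

Lemma nm_cvg (p : R) (f g : nat -> R) (x y : R) : 1 <= p ->
  f k @[k --> U] --> x -> g k @[k --> U] --> y ->
  nm p (f k) (g k) @[k --> U] --> nm p x y.
Proof.
move=> p1 fx gy; apply/cvgrPdist_lt => e e0.
have e2 : 0 < e / 2 by rewrite divr_gt0.
move: fx gy => /cvgrPdist_lt/(_ _ e2) F /cvgrPdist_lt/(_ _ e2) G.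
near=> k.
have h1 : `|x - f k| < e / 2 by near: k.
have h2 : `|y - g k| < e / 2 by near: k.
have a := nmB p1 x y (f k) (g k).
have b := nmB p1 (f k) (g k) x y; rewrite (distrC (f k)) (distrC (g k)) in b.
by rewrite ltr_norml; lra.
Unshelve. all: by end_near.
Qed.

End UltraLimits.

(** * Separated numbers cannot all have nearly critical lattices *)

Lemma box_index_inj (B : nat) (x y : int) : `|x| <= B%:Z -> `|y| <= B%:Z ->
  inord (absz (x + B%:Z)%R) = inord (absz (y + B%:Z)%R) :> 'I_(B + B).+1 -> x = y.
Proof. by move=> hx hy /(congr1 val); rewrite /= !inordK; lia. Qed.

Section Separation.
Context {R : realType}.
Variable p : R.
Hypothesis p1 : 1 <= p.

Local Notation r := (critical_radius p).

Definition short_vector (rho alpha t : R) : Prop := exists q m : int,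
  (q, m) != (0, 0) /\ nm p (t^-1 * q%:~R) (t * (m%:~R - q%:~R * alpha)) < rho.

Definition not_short (rho alpha t : R) := forall q m : int,
  (q, m) != (0, 0) -> rho <= nm p (t^-1 * q%:~R) (t * (m%:~R - q%:~R * alpha)).

Lemma not_shortP rho alpha t : ~ short_vector rho alpha t -> not_short rho alpha t.
Proof.
by move=> h q m qm; rewrite leNgt; apply/negP => lt; apply: h; exists q, m.
Qed.

Lemma det1_neq0 (a b c d x y : int) : a * d - b * c = 1 -> (x, y) != (0, 0) ->
  (x * a + y * c, x * b + y * d) != (0, 0).
Proof.
move=> e; apply: contra => /eqP[h1 h2].
have hx : x = 0.
  transitivity (x * (a * d - b * c)); first by rewrite e mulr1.
  transitivity ((x * a + y * c) * d - (x * b + y * d) * c); first by ring.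
  by rewrite h1 h2 !mul0r subr0.
have hy : y = 0.
  transitivity (y * (a * d - b * c)); first by rewrite e mulr1.
  transitivity ((x * b + y * d) * a - (x * a + y * c) * b); first by ring.
  by rewrite h1 h2 !mul0r subr0.
by rewrite hx hy.
Qed.

Lemma sqr_le4 (x y : R) : x ^+ 2 + y ^+ 2 <= 4 -> `|x| <= 2 /\ `|y| <= 2.
Proof.
move=> h; have x2 := sqr_ge0 x; have y2 := sqr_ge0 y.
by split; rewrite -ler_sqr ?nnegrE// real_normK ?num_real//; lra.
Qed.

(** Norm at least 1 gives |X| + |Y| >= 1, hence squared Euclidean length at least 1/2; with
    determinant 1 the reduced vectors have squared lengths at most 2 and 5/2. *)
Lemma bounded_reduced_basis (alpha t : R) : 0 < t -> not_short 1 alpha t ->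
  exists a b c d : int, [/\ a * d - b * c = 1,
    `|t^-1 * a%:~R| <= 2 /\ `|t * (b%:~R - a%:~R * alpha)| <= 2 &
    `|t^-1 * c%:~R| <= 2 /\ `|t * (d%:~R - c%:~R * alpha)| <= 2].
Proof.
move=> t0 ns; have tn := lt0r_neq0 t0.
have h0 : 0 < (2^-1 : R) by rewrite invr_gt0.
have D : t^-1 * t - 0 * (- (t * alpha)) = 1 by rewrite mulVf// mul0r subr0.
have Dn : t^-1 * t - 0 * (- (t * alpha)) != 0 by rewrite D oner_eq0.
have e1 (x y : int) : x%:~R * t^-1 + y%:~R * 0 = t^-1 * x%:~R by ring.
have e2 (x y : int) : x%:~R * (- (t * alpha)) + y%:~R * t = t * (y%:~R - x%:~R * alpha) by ring.
have hq (x y : int) : (x, y) != (0, 0) ->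
    2^-1 <= (x%:~R * t^-1 + y%:~R * 0) ^+ 2 + (x%:~R * (- (t * alpha)) + y%:~R * t) ^+ 2.
  move=> /ns; rewrite e1 e2; set X := t^-1 * _; set Y := t * _ => h.
  have {}h := le_trans h (nm_l1 p1 X Y).
  rewrite -real_normK ?num_real// -[Y ^+ 2]real_normK ?num_real//.
  have := sqr_ge0 (`|X| - `|Y|).
  have : 1 <= (`|X| + `|Y|) ^+ 2 by rewrite expr_ge1.
  by rewrite sqrrB sqrrD; lra.
have [a [b [c [d [abcd h1 h2]]]]] := reduced_basis h0 Dn hq.
rewrite D normr1 expr1n !e1 !e2 in h1 h2.
exists a, b, c, d; split => //; apply: sqr_le4; first by lra.
by apply: le_trans h2 _; lra.
Qed.

(** Compactness: given counterexamples with eps tending to 0, the lattices of all the numbers,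
    written in a reduced basis of the lattice of index 0, converge to critical lattices that differ
    by a shear and a scaling. Their hexagons have coefficients in a fixed box with [C]
    possibilities, so two of the [C] + 1 agree, and [leaf_unique] contradicts the separation. *)
Lemma separated_short_ord : exists C : nat, forall eta, 0 < eta ->
  exists2 eps, 0 < eps & forall (alpha t : 'I_C.+1 -> R) (T : R), 0 < T ->
    (forall i, T <= t i <= 2 * T) ->
    (forall i j, `|alpha i - alpha j| <= T ^- 2) ->
    (forall i j, i != j -> eta * T ^- 2 <= `|alpha i - alpha j|) ->
    exists i, short_vector (r - eps) (alpha i) (t i).
Proof.
have r1 := critical_radius_gt1 p1; set r := critical_radius p in r1 *.
have r0 : 0 <= r := le_trans ler01 (ltW r1).
(* In [bnd] below, the abscissa of a limit basis vector is at most 2 * 2 = 4 and the ordinate at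
   most 2 (2 + 8) = 20, whence 24. *)
have [B hB] := nat_bound (24 * r).
pose J := 'I_(B + B).+1; pose K : finType := (J * J * (J * J))%type.
exists #|K| => eta eta0.
(* Tends to 0 and keeps r - e k >= 1, as [bounded_reduced_basis] requires. *)
pose e (k : nat) : R := (r - 1) * k.+1%:R^-1.
have e0 k : 0 < e k by rewrite mulr_gt0 ?invr_gt0// subr_gt0.
have e1 k : e k <= r - 1.
  have h : 0 <= r - 1 by rewrite subr_ge0 ltW.
  by rewrite /e -[leRHS]mulr1 ler_wpM2l// invf_le1 ?ler1n.
apply: contrapT => H.
pose I := 'I_#|K|.+1.
have HH (k : nat) : exists w : (I -> R) * (I -> R) * (int * int * (int * int)),
  let al := w.1.1 in let t := w.1.2 in
  let a := w.2.1.1 in let b := w.2.1.2 in let c := w.2.2.1 in let d := w.2.2.2 in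
  let a0 := al ord0 in let t0 := t ord0 in
  [/\ [/\ forall i, 0 < t i, forall i, t0 <= 2 * t i & forall i, t i <= 2 * t0],
     forall i, `|(al i - a0) * t0 ^+ 2| <= 4,
     forall i j, i != j -> eta <= `|(al i - a0) * t0 ^+ 2 - (al j - a0) * t0 ^+ 2| ,
     forall i, not_short (r - e k) (al i) (t i) &
     [/\ a * d - b * c = 1,
    `|t0^-1 * a%:~R| <= 2 /\ `|t0 * (b%:~R - a%:~R * a0)| <= 2 &
    `|t0^-1 * c%:~R| <= 2 /\ `|t0 * (d%:~R - c%:~R * a0)| <= 2]].
  apply: contrapT => nex; apply: H; exists (e k); first exact: e0.
  move=> al t T T0 tT close far; apply: contrapT => /forallNP ns.
  have {}ns i : not_short (r - e k) (al i) (t i) by exact: not_shortP.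
  have tp i : 0 < t i by have /andP[] := tT i; lra.
  have ns1 : not_short 1 (al ord0) (t ord0).
    by move=> q m /(ns ord0); apply: le_trans; have := e1 k; lra.
  have [a [b [c [d abcd]]]] := bounded_reduced_basis (tp ord0) ns1.
  apply: nex; exists (al, t, (a, b, (c, d))) => /=.
  have T2 : 0 < T ^+ 2 by rewrite exprn_gt0.
  have /andP[l0 u0] := tT ord0.
  have t2l : T ^+ 2 <= t ord0 ^+ 2 by rewrite lerXn2r// nnegrE; lra.
  have t2u : t ord0 ^+ 2 <= 4 * T ^+ 2.
    have -> : 4 * T ^+ 2 = (2 * T) ^+ 2 by ring.
    by rewrite lerXn2r// nnegrE; lra.
  have t20 : 0 < t ord0 ^+ 2 by rewrite exprn_gt0.
  split => //.
  - split => // i; first by have /andP[] := tT i; lra.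
    by have /andP[] := tT i; lra.
  - move=> i; rewrite normrM (gtr0_norm t20).
    apply: le_trans (_ : T ^- 2 * (4 * T ^+ 2) <= _); first by rewrite ler_pM// ltW.
    by rewrite mulrCA mulVf ?mulr1// lt0r_neq0.
  - move=> i j ij; rewrite -mulrBl opprB addrA subrK normrM (gtr0_norm t20).
    have h := far _ _ ij.
    have : (eta * T ^- 2) * T ^+ 2 <= `|al i - al j| * t ord0 ^+ 2.
      by rewrite ler_pM// ?mulr_ge0 ?invr_ge0 ?ltW.
    by rewrite mulfVK// lt0r_neq0.
have {HH}[w hw] := choice HH.
pose al k := (w k).1.1; pose t k := (w k).1.2.
pose a k := (w k).2.1.1; pose b k := (w k).2.1.2.
pose c k := (w k).2.2.1; pose d k := (w k).2.2.2.
pose a0 k := al k ord0; pose t0 k := t k ord0.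
have [U [UU sU]] := ultraFilterLemma (eventually_filter : ProperFilter (\oo)).
pose s k i := t0 k / t k i; pose g k i := t k i / t0 k.
pose be k i := (al k i - a0 k) * t0 k ^+ 2.
pose u1 k := (t0 k)^-1 * (a k)%:~R; pose u2 k := t0 k * ((b k)%:~R - (a k)%:~R * a0 k).
pose v1 k := (t0 k)^-1 * (c k)%:~R; pose v2 k := t0 k * ((d k)%:~R - (c k)%:~R * a0 k).
have tp k i : 0 < t k i by have [[+ _ _] _ _ _ _] := hw k; exact.
have tn k i : t k i != 0 by apply: lt0r_neq0.
have tge k i : 0 <= t k i by exact: ltW.
have sM k i : `|s k i| <= 2.
  rewrite ger0_norm ?divr_ge0 ?tge// ler_pdivrMr//.
  by have [[_ + _] _ _ _ _] := hw k; exact.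
have gM k i : `|g k i| <= 2.
  rewrite ger0_norm ?divr_ge0 ?tge// ler_pdivrMr ?tp//.
  by have [[_ _ +] _ _ _ _] := hw k; exact.
have sg k i : s k i * g k i = 1 by rewrite /s /g; field; rewrite !tn.
have s12 k i : 2^-1 <= s k i.
  rewrite /s ler_pdivlMr// mulrC ler_pdivrMr// [_ * 2]mulrC.
  by have [[_ _ +] _ _ _ _] := hw k; exact.
have beM k i : `|be k i| <= 4 by have [_ + _ _ _] := hw k; exact.
have bed k i j : i != j -> eta <= `|be k i - be k j|.
  by have [_ _ + _ _] := hw k; exact.
have u1M k : `|u1 k| <= 2 by have [_ _ _ _ [_ [] ]] := hw k.
have u2M k : `|u2 k| <= 2 by have [_ _ _ _ [_ [] ]] := hw k.
have v1M k : `|v1 k| <= 2 by have [_ _ _ _ [_ _ []]] := hw k.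
have v2M k : `|v2 k| <= 2 by have [_ _ _ _ [_ _ []]] := hw k.
have abcd k : a k * d k - b k * c k = 1 by have [_ _ _ _ []] := hw k.
have Dk k : u1 k * v2 k - u2 k * v1 k = 1.
  have : ((a k * d k - b k * c k)%:~R : R) = 1 by rewrite abcd.
  rewrite intrB !intrM => <-; rewrite /u1 /v2 /u2 /v1 /t0; field; exact: tn.
(* The lattice of index i is that of index 0, sheared by [be] and then scaled by [s] and its inverse
   [g]. *)
have ns k i (x y : int) : (x, y) != (0, 0) ->
    r <= nm p (s k i * (x%:~R * u1 k + y%:~R * v1 k))
      ((x%:~R * u2 k + y%:~R * v2 k - be k i * (x%:~R * u1 k + y%:~R * v1 k)) * g k i)
      + e k.
  move=> /(det1_neq0 (abcd k)); have [_ _ _ + _] := hw k => /(_ i) /[apply].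
  rewrite lerBlDr; congr (_ <= nm p _ _ + _); rewrite !intrD !intrM;
  rewrite /s /u1 /v1 /u2 /v2 /be /g -/(t k) -/(al k) -/(a k) -/(b k) -/(c k) -/(d k) /a0 /t0.
    by field; rewrite !tn.
  by field; rewrite !tn.
have [lu1 cu1] := ultra_bounded_cvg u1M; have [lu2 cu2] := ultra_bounded_cvg u2M.
have [lv1 cv1] := ultra_bounded_cvg v1M; have [lv2 cv2] := ultra_bounded_cvg v2M.
have [ls cs] := choice (fun i => ultra_bounded_cvg (sM^~ i)).
have [lg cg] := choice (fun i => ultra_bounded_cvg (gM^~ i)).
have [lb cb] := choice (fun i => ultra_bounded_cvg (beM^~ i)).
have LD : lu1 * lv2 - lu2 * lv1 = 1.
  exact: (ultra_eq (cvgB (cvgM cu1 cv2) (cvgM cu2 cv1)) Dk).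
have lsg i : ls i * lg i = 1 by exact: (ultra_eq (cvgM (cs i) (cg i)) (sg^~ i)).
have ls0 i : 0 < ls i.
  have h : 2^-1 <= ls i by exact: (ultra_le (cs i) (s12^~ i)).
  by apply: lt_le_trans h; rewrite invr_gt0.
have ce : e k @[k --> U] --> (0 : R).
  have : e k @[k --> \oo] --> (0 : R).
    rewrite -[X in _ --> X](mulr0 (r - 1)); apply: cvgMr; exact: cvg_harmonic.
  by apply: cvg_trans => A /sU.
have lim_ge i (x y : int) : (x, y) != (0, 0) ->
    r <= nm p (ls i * (x%:~R * lu1 + y%:~R * lv1))
      ((x%:~R * lu2 + y%:~R * lv2 - lb i * (x%:~R * lu1 + y%:~R * lv1)) * lg i).
  move=> xy; rewrite -[leRHS]addr0.
  have cX : x%:~R * u1 k + y%:~R * v1 k @[k --> U] --> x%:~R * lu1 + y%:~R * lv1.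
    by apply: cvgD; apply: cvgMr.
  have cY : x%:~R * u2 k + y%:~R * v2 k @[k --> U] --> x%:~R * lu2 + y%:~R * lv2.
    by apply: cvgD; apply: cvgMr.
  apply: (ultra_le (cvgD (nm_cvg p1 (cvgM (cs i) cX)
    (cvgM (cvgB cY (cvgM (cb i) cX)) (cg i))) ce)) => k.
  exact: ns.
pose U1 i := ls i * lu1; pose U2 i := (lu2 - lb i * lu1) * lg i.
pose V1 i := ls i * lv1; pose V2 i := (lv2 - lb i * lv1) * lg i.
have DD i : U1 i * V2 i - U2 i * V1 i = 1.
  transitivity ((ls i * lg i) * (lu1 * lv2 - lu2 * lv1)).
    by rewrite /U1 /U2 /V1 /V2; ring.
  by rewrite lsg LD mulr1.
have adm i : admissible p r (U1 i) (U2 i) (V1 i) (V2 i).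
  move=> x y /(lim_ge i); congr (_ <= nm p _ _); rewrite /U1 /U2 /V1 /V2; ring.
have bu1 : `|lu1| <= 2 by exact: (ultra_norm_le cu1 u1M).
have bu2 : `|lu2| <= 2 by exact: (ultra_norm_le cu2 u2M).
have bv1 : `|lv1| <= 2 by exact: (ultra_norm_le cv1 v1M).
have bv2 : `|lv2| <= 2 by exact: (ultra_norm_le cv2 v2M).
have bs i : `|ls i| <= 2 by exact: (ultra_norm_le (cs i) (sM^~ i)).
have bg i : `|lg i| <= 2 by exact: (ultra_norm_le (cg i) (gM^~ i)).
have bb i : `|lb i| <= 4 by exact: (ultra_norm_le (cb i) (beM^~ i)).
have bnd (x1 x2 : R) i : `|x1| <= 2 -> `|x2| <= 2 ->
    `|ls i * x1| + `|(x2 - lb i * x1) * lg i| <= 24.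
  move=> h1 h2; have : `|ls i * x1| <= 2 * 2 by rewrite normrM ler_pM.
  have h3 : `|lb i * x1| <= 4 * 2 by rewrite normrM ler_pM.
  have h4 : `|x2 - lb i * x1| <= 10 by apply: le_trans (ler_normB _ _) _; lra.
  have : `|(x2 - lb i * x1) * lg i| <= 10 * 2 by rewrite normrM ler_pM.
  lra.
have coefB i (x y : int) :
    nm p (x%:~R * U1 i + y%:~R * V1 i) (x%:~R * U2 i + y%:~R * V2 i) = r ->
    `|x| <= B%:Z /\ `|y| <= B%:Z.
  set z1 := (X in nm p X _); set z2 := (X in nm p _ X) => hz.
  have ex : x%:~R = - (V1 i * z2 - V2 i * z1).
    transitivity (x%:~R * (U1 i * V2 i - U2 i * V1 i)); first by rewrite DD mulr1.
    by rewrite /z1 /z2; ring.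
  have ey : y%:~R = U1 i * z2 - U2 i * z1.
    transitivity (y%:~R * (U1 i * V2 i - U2 i * V1 i)); first by rewrite DD mulr1.
    by rewrite /z1 /z2; ring.
  rewrite -!(ler_int R) !intr_norm ex ey normrN.
  by split; apply: le_trans hB; apply: le_trans (norm_det_le p1 _ _ _ _) _;
    rewrite hz ler_wpM2r//; apply: bnd.
have HX i : exists m : int * int * (int * int),
    let: (x, y, (x', y')) := m in
    [/\ x * y' - y * x' = 1,
     nm p (x%:~R * U1 i + y%:~R * V1 i) (x%:~R * U2 i + y%:~R * V2 i) = r,
     nm p (x'%:~R * U1 i + y'%:~R * V1 i) (x'%:~R * U2 i + y'%:~R * V2 i) = r &
     nm p ((x + x')%:~R * U1 i + (y + y')%:~R * V1 i)
       ((x + x')%:~R * U2 i + (y + y')%:~R * V2 i) = r].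
  have [x [y [x' [y' h]]]] := critical_hexagon p1 (DD i) (adm i).
  by exists (x, y, (x', y')).
have [m hm] := choice HX.
pose ti (x : int) : J := inord (absz (x + B%:Z)%R).
have tiI (x y : int) := @box_index_inj B x y.
pose F i : K := let: (x, y, (x', y')) := m i in (ti x, ti y, (ti x', ti y')).
have : ~~ injectiveb F.
  apply/negP => /injectiveP /leq_card; rewrite card_ord ltnn //.
move=> /injectivePn[i [j ij]]; rewrite /F.
have := hm i; have := hm j.
case: (m i) => -[x y] [x' y']; case: (m j) => -[z w'] [z' w''].
move=> [dj j1 j2 j3] [di i1 i2 i3].
have [bx bY] := coefB _ _ _ i1; have [bx' by'] := coefB _ _ _ i2.
have [bz bw] := coefB _ _ _ j1; have [bz' bw'] := coefB _ _ _ j2.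
case=> /(tiI _ _ bx bz) ex /(tiI _ _ bY bw) ey /(tiI _ _ bx' bz') ex' /(tiI _ _ by' bw') ey'.
subst z w' z' w''.
pose X1 := x%:~R * lu1 + y%:~R * lv1; pose Y1 := x%:~R * lu2 + y%:~R * lv2.
pose X2 := x'%:~R * lu1 + y'%:~R * lv1; pose Y2 := x'%:~R * lu2 + y'%:~R * lv2.
have det : X1 * Y2 - X2 * Y1 != 0.
  have -> : X1 * Y2 - X2 * Y1 = (x%:~R * y'%:~R - y%:~R * x'%:~R) * (lu1 * lv2 - lu2 * lv1).
    by rewrite /X1 /X2 /Y1 /Y2; ring.
  by rewrite LD -!intrM -intrB di mulr1 oner_eq0.
have E n (q q' : int) : nm p (q%:~R * U1 n + q'%:~R * V1 n) (q%:~R * U2 n + q'%:~R * V2 n) =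
   nm p (ls n * (q%:~R * lu1 + q'%:~R * lv1))
     ((q%:~R * lu2 + q'%:~R * lv2 - lb n * (q%:~R * lu1 + q'%:~R * lv1)) * lg n).
  by congr nm; rewrite /U1 /U2 /V1 /V2; ring.
rewrite !E !intrD in i1 i2 i3 j1 j2 j3.
have S1 : (x%:~R + x'%:~R) * lu1 + (y%:~R + y'%:~R) * lv1 = X1 + X2.
  by rewrite /X1 /X2; ring.
have S2 : (x%:~R + x'%:~R) * lu2 + (y%:~R + y'%:~R) * lv2 = Y1 + Y2.
  by rewrite /Y1 /Y2; ring.
rewrite S1 S2 in i3 j3.
have eb := leaf_unique p1 r0 det (ls0 i) (ls0 j) (lsg i) (lsg j) i1 i2 i3 j1 j2 j3.
have : eta <= `|lb i - lb j|.
  exact: (ultra_norm_ge (cvgB (cb i) (cb j)) (fun k => bed k i j ij)).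
by rewrite eb subrr normr0 leNgt eta0.
Qed.

Lemma separated_short : exists C : nat, forall eta, 0 < eta ->
  exists2 eps, 0 < eps & forall (I : finType) (alpha t : I -> R) (T : R),
    (C < #|I|)%N -> 0 < T ->
    (forall i, T <= t i <= 2 * T) ->
    (forall i j, `|alpha i - alpha j| <= T ^- 2) ->
    (forall i j, i != j -> eta * T ^- 2 <= `|alpha i - alpha j|) ->
    exists i, short_vector (r - eps) (alpha i) (t i).
Proof.
have [C hC] := separated_short_ord; exists C => eta /hC[eps eps0 h].
exists eps => // I alpha t T CI T0 tT close far.
pose f (i : 'I_C.+1) : I := enum_val (widen_ord CI i).
have fI : injective f.
  by move=> i j /enum_val_inj/(congr1 val)/= /val_inj.
have [|||i hi] := h (alpha \o f) (t \o f) T T0; last by exists (f i).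
- by move=> i; exact: tT.
- by move=> i j; exact: close.
- by move=> i j ij; apply: far; rewrite (inj_eq fI).
Qed.

End Separation.

(** * The two steps of the construction *)

Lemma card_le_fibers (I Y : finType) (P : pred I) (f : I -> Y) (C : nat) :
  (forall y, #|[pred i | P i & f i == y]| <= C)%N -> (#|P| <= #|Y| * C)%N.
Proof.
move=> h; rewrite -sum1_card (partition_big f predT)//=.
rewrite -sum_nat_const; apply: leq_sum => y _.
by rewrite sum1dep_card; apply: leq_trans (h y); rewrite cardsE.
Qed.

Lemma dyadic_window (R : realType) (T t : R) (W : nat) :
  0 < T -> T <= t -> t <= 2 ^+ W * T ->
  exists w : 'I_W.+1, 2 ^+ w * T <= t <= 2 * (2 ^+ w * T).
Proof.
move=> T0 Tt; elim: W => [|W IH] h.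
  by exists ord0; rewrite /= expr0 !mul1r in h *; rewrite Tt/=; lra.
have [/IH[w hw]|lt] := leP t (2 ^+ W * T).
  by exists (widen_ord (leqnSn _) w).
by exists (inord W); rewrite inordK// (ltW lt)/= mulrA -exprS.
Qed.

Section Steps.
Context {R : realType}.
Variable p : R.
Hypothesis p1 : 1 <= p.

Definition separation (C : nat) (eta rho : R) : Prop :=
  forall (I : finType) (alpha t : I -> R) (T : R),
    (C < #|I|)%N -> 0 < T ->
    (forall i, T <= t i <= 2 * T) ->
    (forall i j, `|alpha i - alpha j| <= T ^- 2) ->
    (forall i j, i != j -> eta * T ^- 2 <= `|alpha i - alpha j|) ->
    exists i, short_vector p rho (alpha i) (t i).

(** Divided according to [g] and to the dyadic window of the time, each class has at most [C]
    members by [separation]. The gap required in terms of the first window suffices for the later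
    ones, as T^-2 decreases. *)
Lemma few_not_short (C : nat) (eta rho : R) (I Y : finType) (P : pred I)
    (g : I -> Y) (alpha t : I -> R) (T : R) (W : nat) :
  separation C eta rho -> 0 <= eta -> 0 < T ->
  (forall i, P i -> T <= t i <= 2 ^+ W * T) ->
  (forall i, P i -> ~ short_vector p rho (alpha i) (t i)) ->
  (forall i j, P i -> P j -> `|alpha i - alpha j| <= t i ^- 2) ->
  (forall i j, P i -> P j -> g i = g j -> i != j ->
    eta * T ^- 2 <= `|alpha i - alpha j|) ->
  (#|P| <= #|Y| * W.+1 * C)%N.
Proof.
move=> sep eta0 T0 tT ns close far.
have hw i : exists w : 'I_W.+1, P i -> 2 ^+ w * T <= t i <= 2 * (2 ^+ w * T).
  case: (boolP (P i)) => [/tT /andP[h1 h2]|]; last by exists ord0.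
  by have [w hw] := dyadic_window T0 h1 h2; exists w.
have [w {}hw] := choice hw.
have -> : (#|Y| * W.+1)%N = #|{: Y * 'I_W.+1}| by rewrite card_prod card_ord.
apply: (@card_le_fibers _ _ P (fun i => (g i, w i))) => -[y v].
rewrite leqNgt; apply/negP => lt.
pose Q := [pred i | P i & (g i, w i) == (y, v)].
have Qi (i : {i | Q i}) : [/\ P (val i), g (val i) = y & w (val i) = v].
  by case: i => i /= /andP[Pi /eqP[-> ->]].
have T1 : 0 < 2 ^+ v * T by rewrite mulr_gt0 ?exprn_gt0.
have [||||i] := sep {i | Q i} (alpha \o val) (t \o val) _ _ T1.
- by rewrite card_sig.
- by move=> i /=; have [Pi _ wi] := Qi i; have := hw _ Pi; rewrite wi.
- move=> i j /=; have [Pi _ wi] := Qi i; have [Pj _ _] := Qi j.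
  apply: le_trans (close _ _ Pi Pj) _.
  have /andP[h _] := hw _ Pi; rewrite wi in h.
  by rewrite lef_pV2 ?posrE ?exprn_gt0 ?(lt_le_trans T1 h)// lerXn2r ?nnegrE ?(ltW T1)//
    (le_trans (ltW T1) h).
- move=> i j /= ij; have [Pi gi _] := Qi i; have [Pj gj _] := Qi j.
  have := far _ _ Pi Pj; rewrite gi gj (inj_eq val_inj) => /(_ erefl ij).
  apply: le_trans; rewrite ler_wpM2l// lef_pV2 ?posrE ?exprn_gt0//.
  rewrite lerXn2r ?nnegrE ?(ltW T0) ?(ltW T1)// ler_peMl ?(ltW T0)//.
  by rewrite exprn_ege1// ler1n.
by have [Pi _ _] := Qi i => /=; exact: ns.
Qed.

(* [good m rho c s]: up to the time (2 s 4^m)^(-1/2), every point of the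
   ball of centre c and radius s has a vector shorter than rho. *)
Definition good (m : nat) (rho c s : R) : Prop :=
  forall alpha, `|alpha - c| <= s -> forall t, 1 <= t ->
    t ^+ 2 * (2 * s * 4 ^+ m) <= 1 -> short_vector p rho alpha t.

Definition child (n : nat) (c s : R) (i : nat) : R :=
  c - s + (2 * i%:R + 1) * (s / n%:R).

Lemma child_sub (n : nat) (c s x : R) (i : nat) : 0 < s -> (i < n)%N ->
  `|x - child n c s i| <= s / n%:R -> `|x - c| <= s.
Proof.
move=> s0 ni; have n0 : (0 : R) < n%:R by rewrite ltr0n (leq_ltn_trans _ ni).
have u0 : 0 < s / n%:R by rewrite divr_gt0.
have e : n%:R * (s / n%:R) = s by field; exact: lt0r_neq0.
have i0 : (0 : R) <= i%:R by [].
have i1 : i%:R + 1 <= (n%:R : R) by rewrite natr1 ler_nat.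
rewrite /child; set u := s / n%:R in u0 e *.
have h1 : (i%:R + 1) * u <= s by rewrite -e ler_wpM2r// ltW.
have h2 : 0 <= i%:R * u by rewrite mulr_ge0// ltW.
have -> : (2 * i%:R + 1) * u = 2 * (i%:R * u) + u by ring.
rewrite mulrDl mul1r in h1.
by rewrite !ler_norml; lra.
Qed.

Lemma child_far (n : nat) (c s x y : R) (i j : nat) : 0 < s -> (0 < n)%N ->
  (i.+2 <= j)%N ->
  `|x - child n c s i| <= s / n%:R -> `|y - child n c s j| <= s / n%:R ->
  2 * (s / n%:R) <= `|x - y|.
Proof.
move=> s0 n0 ij; have u0 : 0 < s / n%:R by rewrite divr_gt0// ltr0n.
rewrite /child; set u := s / n%:R in u0 *.
have h : (i%:R + 2) * u <= j%:R * u.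
  by rewrite ler_wpM2r ?(ltW u0)// -natrD ler_nat addn2.
have -> : (2 * i%:R + 1) * u = 2 * (i%:R * u) + u by ring.
have -> : (2 * j%:R + 1) * u = 2 * (j%:R * u) + u by ring.
rewrite mulrDl in h.
rewrite !ler_norml => /andP[a1 a2] /andP[b1 b2].
rewrite distrC; apply: le_trans (ler_norm _); lra.
Qed.

(** A bad child has a point without short vector at a time not covered by the goodness of the
    parent: it lies in [T, 2^m T] with T = (2 s 4^m)^(-1/2), that is in m + 1 dyadic windows. The
    factor 2 comes from the parity of the index: distinct children of equal parity are at least a
    child's length apart. *)
Lemma few_bad_children (C m : nat) (eta rho c s : R) :
  separation C eta rho -> 0 <= eta -> eta * 16 ^+ m <= 1 -> 0 < s ->
  good m rho c s ->
  (#|[pred i : 'I_(4 ^ m) | ~~ `[< good m rho (child (4 ^ m) c s i)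
     (s / (4 ^ m)%:R) >]]| <= 2 * m.+1 * C)%N.
Proof.
move=> sep eta0 eta1 s0 gc; set n := (4 ^ m)%N; set P := [pred i | _].
have n0 : (0 < n)%N by rewrite expn_gt0.
have nR : (0 : R) < n%:R by rewrite ltr0n.
have n4 : n%:R = 4 ^+ m :> R by rewrite natrX.
have nn := lt0r_neq0 nR.
have hP (i : 'I_n) : exists at_ : R * R, P i ->
    [/\ `|at_.1 - child n c s i| <= s / n%:R, 1 <= at_.2,
        at_.2 ^+ 2 * (2 * s) <= 1, 1 < at_.2 ^+ 2 * (2 * s * 4 ^+ m) &
        ~ short_vector p rho at_.1 at_.2].
  case: (boolP (P i)) => [|_]; last by exists (0, 0).
  move=> /asboolPn ng; apply: contrapT => nex; apply: ng => al hal t t1 ht.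
  apply: contrapT => ns; apply: nex; exists (al, t) => _ /=; split => //.
    apply: le_trans ht; rewrite le_eqVlt; apply/orP; left; apply/eqP.
    by rewrite -n4; field.
  rewrite ltNge; apply/negP => ht2; apply: ns; apply: gc => //.
  exact: (child_sub s0 (ltn_ord i)).
have [at_ {}hP] := choice hP.
pose T := Num.sqrt (2 * s * 4 ^+ m)^-1.
have s4 : 0 < 2 * s * 4 ^+ m by rewrite -n4 !mulr_gt0.
have T2 : T ^+ 2 = (2 * s * 4 ^+ m)^-1 by rewrite sqr_sqrtr// invr_ge0 ltW.
have T0 : 0 < T by rewrite sqrtr_gt0 invr_gt0.
have := @few_not_short C eta rho 'I_n bool P (fun i => odd i)
  (fun i => (at_ i).1) (fun i => (at_ i).2) T m sep eta0 T0.
rewrite card_bool; apply.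
- move=> i /hP[_ t1 h1 h2 _].
  have t0 : 0 <= (at_ i).2 by lra.
  rewrite -ler_sqr ?nnegrE ?(ltW T0)// T2.
  rewrite -[X in _ && X]ler_sqr ?nnegrE ?mulr_ge0 ?(ltW T0)//.
  rewrite exprMn T2 -exprM mulnC exprM (_ : 2 ^+ 2 = 4 :> R); last by ring.
  apply/andP; split.
    by rewrite -[leLHS]mul1r ler_pdivrMr// ltW.
  rewrite invfM mulrCA mulfV ?mulr1; last by rewrite -n4.
  by rewrite -[leRHS]mul1r ler_pdivlMr// mulr_gt0.
- by move=> i /hP[].
- move=> i j /hP[a1 t1 h1 h2 _] /hP[b1 _ _ _ _].
  have a2 := child_sub s0 (ltn_ord i) a1; have b2 := child_sub s0 (ltn_ord j) b1.
  apply: (@le_trans _ _ (2 * s)).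
    by move: a2 b2; rewrite !ler_norml; lra.
  have t0 : 0 < (at_ i).2 ^+ 2 by rewrite exprn_gt0//; lra.
  by rewrite -[leRHS]mul1r ler_pdivlMr// mulrC.
- move=> i j /hP[a1 t1 h1 h2 _] /hP[b1 _ _ _ _] oij ij.
  (* The distance 2 s / 4^m is compared with eta T^-2 = eta 2 s 4^m; this is the condition
     [eta * 16 ^+ m <= 1]. *)
  apply: (@le_trans _ _ (2 * (s / n%:R))).
    rewrite T2 invrK n4.
    have -> : eta * (2 * s * 4 ^+ m) = 2 * s / 4 ^+ m * (eta * 16 ^+ m).
      rewrite (_ : 16 = 4 * 4 :> R); last by ring.
      by rewrite exprMn; field; rewrite -n4.
    by rewrite [leRHS]mulrA -[leRHS]mulr1 ler_wpM2l// divr_ge0 ?mulr_ge0 ?(ltW s0)//.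
  have gap (k l : nat) : odd k = odd l -> (k < l)%N -> (k.+2 <= l)%N.
    move=> okl lt; rewrite ltn_neqAle lt andbT; apply/eqP => e.
    by move: okl; rewrite -e /=; case: (odd k).
  have [lt|lt|e] := ltngtP i j; last by move: ij; rewrite (val_inj e) eqxx.
    exact: (child_far s0 n0 (gap _ _ oij lt) a1 b1).
  rewrite distrC; exact: (child_far s0 n0 (gap _ _ (esym oij) lt) b1 a1).
Qed.

End Steps.

(** * Dirichlet approximations and Farey mediants *)

Section FareySelection.
Context {R : realType}.
Variable p : R.
Hypothesis p1 : 1 <= p.

(* A Dirichlet approximation m/q of x together with the Farey neighbour m'/q'
   such that m/q and m'/q' lie on the side of x given by e. *)
Lemma dirichlet_pair (x L : R) : 2 < L ->
  exists q m q' m' e : int, [/\ 0 < q, 0 <= q' < q, (e = 1 \/ e = -1) &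
    q * m' - q' * m = e] /\
    [/\ q%:~R <= 2 * L, 0 <= e%:~R * (q%:~R * x - m%:~R) &
        e%:~R * (q%:~R * x - m%:~R) <= 2 / L].
Proof.
move=> L2; have L0 : 0 < L by lra.
have ns : not_short p (L^-1) x L.
  move=> q m qm; have [q0|q0] := eqVneq q 0.
    apply: le_trans (nm_ge2 p1 _ _); rewrite q0 mul0r subr0 normrM (gtr0_norm L0).
    have m0 : m != 0 by apply: contra qm => /eqP->; rewrite q0.
    apply: (@le_trans _ _ (L * 1)); last by rewrite ler_pM2l//; exact: intr_norm_ge1.
    rewrite mulr1; apply: (@le_trans _ _ 1); last by lra.
    by rewrite invf_le1; lra.
  apply: le_trans (nm_ge1 p1 _ _); rewrite normrM [`|_^-1|]gtr0_norm ?invr_gt0//.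
  by rewrite -[leLHS]mulr1 ler_pM2l ?invr_gt0//; exact: intr_norm_ge1.
have m0 : 0 < (L^-1 / 2) ^+ 2 by rewrite exprn_gt0// divr_gt0 ?invr_gt0.
have D : L^-1 * L - 0 * (- (L * x)) = 1 by rewrite mulVf ?lt0r_neq0// mul0r subr0.
have Dn : L^-1 * L - 0 * (- (L * x)) != 0 by rewrite D oner_eq0.
have e1 (i j : int) : i%:~R * L^-1 + j%:~R * 0 = L^-1 * i%:~R by ring.
have e2 (i j : int) : i%:~R * (- (L * x)) + j%:~R * L = L * (j%:~R - i%:~R * x) by ring.
have hq (i j : int) : (i, j) != (0, 0) ->
    (L^-1 / 2) ^+ 2 <= (i%:~R * L^-1 + j%:~R * 0) ^+ 2 + (i%:~R * (- (L * x)) + j%:~R * L) ^+ 2.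
  move=> /ns; rewrite e1 e2; set X := L^-1 * _; set Y := L * _ => h.
  have {}h := le_trans h (nm_l1 p1 X Y).
  have [hX|hX] := leP (L^-1 / 2) `|X|.
    apply: ler_wpDr; first exact: sqr_ge0.
    rewrite -[X ^+ 2]real_normK ?num_real// lerXn2r ?nnegrE//.
    by rewrite divr_ge0 ?invr_ge0 ?(ltW L0).
  apply: ler_wpDl; first exact: sqr_ge0.
  rewrite -[Y ^+ 2]real_normK ?num_real// lerXn2r ?nnegrE//.
    by rewrite divr_ge0 ?invr_ge0 ?(ltW L0).
  by lra.
have [a [b [c [d [abcd h1 _]]]]] := reduced_basis m0 Dn hq.
rewrite D normr1 mulr1 e1 e2 in h1.
have [ha hb] : `|L^-1 * a%:~R| <= 2 /\ `|L * (b%:~R - a%:~R * x)| <= 2.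
  by apply: sqr_le4; lra.
have {}ha : `|a%:~R : R| <= 2 * L.
  by move: ha; rewrite normrM [`|_^-1|]gtr0_norm ?invr_gt0// mulrC ler_pdivrMr.
have {}hb : `|a%:~R * x - b%:~R| <= 2 / L.
  by move: hb; rewrite normrM (gtr0_norm L0) distrC mulrC ler_pdivlMr.
(* With a = 0, the nonzero integer b would satisfy |b| <= 2/L < 1. *)
have a0 : a != 0.
  apply/eqP => a0; have b0 : b != 0.
    by apply/eqP => b0; move: abcd; rewrite a0 b0 !mul0r subr0.
  move: hb; rewrite a0 mul0r sub0r normrN leNgt => /negP; apply.
  apply: lt_le_trans (@intr_norm_ge1 R b b0).
  by rewrite ltr_pdivrMr// mul1r.
have [sg hsg] : exists sg : int, (sg = 1 \/ sg = -1) /\ 0 < sg * a.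
  have [an|ap] := ltP a 0; [exists (-1)|exists 1]; split; try by [left|right].
    by rewrite mulN1r oppr_gt0.
  by rewrite mul1r lt_def a0.
case: hsg => sg1 sga.
have sgn : `|sg%:~R : R| = 1.
  by case: sg1 => ->; rewrite ?intrN ?normrN normr1.
pose q := sg * a; pose m := sg * b.
have [e [e1' he]] : exists e : int, (e = 1 \/ e = -1) /\
    e%:~R * (q%:~R * x - m%:~R) = `|q%:~R * x - m%:~R|.
  have [h|h] := ltP (q%:~R * x - m%:~R) 0.
    exists (-1); split; first by right.
    by rewrite (ltr0_norm h) intrN mulN1r.
  by exists 1; split; [left|rewrite (ger0_norm h) mul1r].
(* The factor e sg makes the determinant equal to e, which puts the mediants on the side of x;
   subtracting multiples of (q, m) does not change it. *)
pose c1 := e * sg * c; pose d1 := e * sg * d.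
have q0 : 0 < q by [].
pose k := divz c1 q.
exists q, m, (c1 - k * q), (d1 - k * m), e; split.
  split => //.
    have -> : c1 - k * q = modz c1 q by [].
    by rewrite modz_ge0 ?gt_eqF//= ltz_pmod.
  rewrite /c1 /d1 /q /m; transitivity (e * (sg * sg) * (a * d - b * c)); first by ring.
  by rewrite abcd mulr1; case: sg1 => ->; rewrite ?mulrNN !mulr1.
have eqm : `|q%:~R * x - m%:~R| = `|a%:~R * x - b%:~R|.
  transitivity (`|sg%:~R : R| * `|a%:~R * x - b%:~R|); last by rewrite sgn mul1r.
  by rewrite /q /m !intrM -normrM; congr (`| _ |); ring.
rewrite he eqm; split => //.
apply: le_trans ha; apply: le_trans (ler_norm _) _.
by rewrite /q intrM normrM sgn mul1r.
Qed.

(** For the case where the first mediant considered is already in range. The product of the two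
    upper bounds is q^2 d K2 <= 8, whence q^2 d A <= 8/36. *)
Lemma selection_first (q d P l K2 A Q : R) : 0 < q -> 0 <= d -> 0 < P -> 0 < l ->
  q * d * P <= 2 -> q * l * P <= 4 -> P ^+ 2 * l = K2 -> 36 * A <= K2 ->
  Q <= A * q -> d * (q * Q) <= 1.
Proof.
move=> q0 d0 P0 l0 h1 h2 h3 h4 h5.
have h6 : (q * d * P) * (q * l * P) <= 2 * 4.
  by apply: ler_pM => //; rewrite !mulr_ge0// ltW.
have e : (q * d * P) * (q * l * P) = q ^+ 2 * d * K2 by rewrite -h3; ring.
have h7 : q ^+ 2 * d * (36 * A) <= q ^+ 2 * d * K2.
  by rewrite ler_wpM2l// mulr_ge0// sqr_ge0.
have h8 : d * (q * Q) <= d * (q * (A * q)) by rewrite ler_wpM2l// ler_pM2l.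
have e2 : d * (q * (A * q)) = q ^+ 2 * d * (36 * A) / 36 by field.
by lra.
Qed.

(** For the case where the mediant of denominator Q is still too far away. Then Q >= P/6, and [H1]
    further mediants advance by H1/(Q Q2) <= 18 H1 l / K2 <= l/2; this is the origin of the 36. *)
Lemma selection_next (q d P l K2 H1 Q : R) : 0 < q -> 0 < d -> 0 < P -> 0 < l ->
  q * d * P <= 2 -> l <= 2 * d -> P ^+ 2 * l = K2 -> 36 * H1 <= K2 -> 1 <= H1 ->
  q <= Q -> (q * (Q + q))^-1 <= d + l / 4 -> d + l / 4 < (q * Q)^-1 ->
  d - l / 2 <= (q * (Q + H1 * q))^-1.
Proof.
move=> q0 d0 P0 l0 h1 ld h3 h4 H11 qQ h5 h6.
have Q0 : 0 < Q by lra.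
have qQ1 : 0 < q * (Q + q) by rewrite mulr_gt0//; lra.
have h7 : 1 <= (d + l / 4) * (q * (Q + q)) by rewrite -ler_pdivrMr// mul1r.
have h8 : P <= 3 * (Q + q).
  have a1 : 1 * P <= (d + l / 4) * (q * (Q + q)) * P by rewrite ler_pM2r.
  have a2 : (d + l / 4) * (q * (Q + q)) * P <= (3 / 2 * d) * (q * (Q + q)) * P.
    by rewrite ler_pM2r// ler_pM2r//; lra.
  have a3 : (3 / 2 * d) * (q * (Q + q)) * P = 3 / 2 * (Q + q) * (q * d * P) by ring.
  have a4 : 3 / 2 * (Q + q) * (q * d * P) <= 3 / 2 * (Q + q) * 2.
    by rewrite ler_pM2l// mulr_gt0//; lra.
  lra.
have qH : q <= H1 * q by rewrite ler_peMl// ltW.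
set Q2 := Q + H1 * q.
have hQ2 : Q + q <= Q2 by rewrite /Q2 lerD2l.
have h9 : P ^+ 2 <= 18 * (Q * Q2).
  have -> : 18 * (Q * Q2) = (6 * Q) * (3 * Q2) by ring.
  by rewrite expr2; apply: ler_pM; rewrite ?(ltW P0)//; lra.
have h10 : P ^+ 2 * l <= 18 * (Q * Q2) * l by rewrite ler_pM2r.
have QQ2 : 0 < Q * Q2 by rewrite mulr_gt0//; lra.
have h11 : H1 / (Q * Q2) <= l / 2.
  by rewrite ler_pdivrMr// mulrC; lra.
have -> : (q * Q2)^-1 = (q * Q)^-1 - H1 / (Q * Q2).
  by rewrite /Q2; field; rewrite !gt_eqF//; lra.
lra.
Qed.

(** Here l is the length of an interval, d the distance of its centre from m/q, and [x a] that of
    the mediant of denominator [Q a]. The index [a0] is the first from [amin] on whose mediant is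
    not beyond d + l/4, and the next H mediants approach m/q too slowly to leave the interval. The
    last clause serves to bound the largest denominator. *)
Lemma farey_selection (K amin H : nat) (q q' d l T : R) :
  (36 * (amin + H + 1) <= K ^ 2)%N -> (0 < amin)%N ->
  1 <= q -> 0 <= q' < q -> 0 < T -> T ^+ 2 * l = 1 ->
  0 <= d -> q * d <= 2 / (K%:R * T) ->
  let Q (a : nat) := a%:R * q + q' in let x a := (q * Q a)^-1 in
  exists a0 : nat, [/\ (amin <= a0)%N, x a0 <= d + l / 4,
    d - l / 2 <= x (a0 + H)%N &
    (a0 = amin \/ [/\ (amin < a0)%N, d + l / 4 < x a0.-1 &
       Q (a0 + H.+1)%N <= Q a0.-1 + (H.+2)%:R * q])].
Proof.
move=> hK am q1 /andP[q'0 q'q] T0 Tl d0 qd Q x.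
have q0 : 0 < q by lra.
have l0 : 0 < l.
  have : 0 < T ^+ 2 * l by rewrite Tl.
  by rewrite pmulr_rgt0 ?exprn_gt0.
have Qlow a : a%:R * q <= Q a by rewrite /Q; lra.
have Qup a : Q a <= a.+1%:R * q by rewrite /Q -natr1 mulrDl mul1r; lra.
have Qpos a : (0 < a)%N -> 0 < Q a.
  by move=> a0; apply: lt_le_trans (Qlow a); rewrite mulr_gt0// ltr0n.
have exa : exists a, (amin <= a)%N && (x a <= d + l / 4).
  have [B hB] := nat_bound (4 / l).
  exists (amin + B)%N; rewrite leq_addr/=.
  apply: (@le_trans _ _ (l / 4)); last by lra.
  have B1 : (0 < amin + B)%N by rewrite addn_gt0 am.
  rewrite /x -[leRHS]invrK lef_pV2 ?posrE ?invr_gt0 ?mulr_gt0 ?Qpos//.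
  rewrite invf_div; apply: le_trans hB _.
  apply: (@le_trans _ _ (Q (amin + B)%N)).
    apply: le_trans (Qlow _); rewrite -[leLHS]mulr1 ler_pM// ler_nat leq_addl//.
  by rewrite ler_peMl// ltW// Qpos.
have mp := find_ex_minn exa; move: mp => [a0 /andP[h1 h2] hmin].
exists a0; split => //.
  have [dl|dl] := leP d (l / 2).
    apply: (@le_trans _ _ 0); first by lra.
    by rewrite invr_ge0 mulr_ge0 ?(ltW q0)// ltW// Qpos// addn_gt0 (leq_trans am h1).
  have K0 : (0 < K)%N.
    by rewrite lt0n; apply: contraTneq hK => ->; rewrite -ltnNge muln_gt0 addn1.
  have KR : (0 : R) < K%:R by rewrite ltr0n.
  have hKR : 36 * (amin%:R + H%:R + 1) <= (K%:R : R) ^+ 2.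
    by move: hK; rewrite -(ler_nat R) natrM natrX !natrD.
  have qdT : q * d * (K%:R * T) <= 2 by rewrite -ler_pdivlMr// mulr_gt0.
  have dp : 0 < d by lra.
  pose P := K%:R * T; have P0 : 0 < P by rewrite mulr_gt0.
  have P2 : P ^+ 2 * l = K%:R ^+ 2 by rewrite exprMn -mulrA Tl mulr1.
  rewrite -/P in qdT.
  have xE (a : nat) : (0 < a)%N -> x a * q * Q a = 1.
    by move=> a0'; rewrite /x -mulrA mulVf// mulf_neq0 ?gt_eqF// Qpos.
  have aH : (0 < a0 + H)%N by rewrite addn_gt0 (leq_trans am h1).
  have QH := Qpos _ aH.
  have [ea|na] := eqVneq a0 amin.
    apply: (@le_trans _ _ d); first by lra.
    have qP : q * l * P <= 4.
      have : q * (l / 2) * P <= q * d * P by rewrite ler_pM2r// ler_pM2l//; lra.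
      by rewrite mulrA -mulrA [2^-1 * _]mulrC mulrA; lra.
    have := @selection_first q d P l (K%:R ^+ 2) (amin%:R + H%:R + 1) (Q (a0 + H)%N).
    move=> /(_ q0 (ltW dp) P0 l0 qdT qP P2 hKR) sel.
    have qQ0 : 0 < q * Q (a0 + H)%N by rewrite mulr_gt0.
    rewrite /x -[leRHS]mul1r ler_pdivlMr//.
    by apply: sel; have := Qup (a0 + H)%N; rewrite ea -natr1 natrD.
  have lt : (amin < a0)%N by rewrite ltn_neqAle eq_sym na.
  have a01 : a0 = a0.-1.+1 by rewrite prednK// (leq_ltn_trans _ lt).
  have a0p : (0 < a0.-1)%N by rewrite (leq_trans am)// -ltnS -a01.
  have xa : d + l / 4 < x a0.-1.
    rewrite ltNge; apply/negP => h.
    have := hmin a0.-1; rewrite h andbT -ltnS -a01 lt => /(_ erefl).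
    by rewrite {1}a01 ltnn.
  have Q1 : Q a0 = Q a0.-1 + q by rewrite /Q {1}a01 -natr1; ring.
  have Q2 : Q (a0 + H)%N = Q a0.-1 + (H%:R + 1) * q.
    by rewrite /Q {1}a01 addSnnS natrD -natr1; ring.
  have Qq : q <= Q a0.-1.
    by apply: le_trans (Qlow _); rewrite ler_peMl ?(ltW q0)// ler1n.
  rewrite /x in h2 xa *; rewrite Q1 in h2; rewrite Q2.
  have HR : 36 * (H%:R + 1) <= (K%:R : R) ^+ 2.
    by apply: le_trans hKR; rewrite ler_pM2l// lerD2r lerDr.
  apply: (selection_next q0 dp P0 l0 qdT _ P2 HR _ Qq h2 xa); first by lra.
  by rewrite lerDr.
have [ea|na] := eqVneq a0 amin; first by left.
right; have lt : (amin < a0)%N by rewrite ltn_neqAle eq_sym na.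
have a01 : a0 = a0.-1.+1 by rewrite prednK// (leq_ltn_trans _ lt).
split => //.
  rewrite ltNge; apply/negP => h.
  have := hmin a0.-1; rewrite h andbT -ltnS -a01 lt => /(_ erefl).
  by rewrite {1}a01 ltnn.
rewrite /Q {1}a01 addSnnS natrD; lra.
Qed.

End FareySelection.

(** Resolves the circular choices of an exponent: the number of dyadic windows to be beaten by 4^k
    itself grows linearly with k. *)
Lemma expn4_linear (A B k : nat) : (A + B <= k)%N -> (A * k + B <= 4 ^ k)%N.
Proof.
move=> hk; have h : (k.+1 <= 2 ^ k)%N by exact: ltn_expl.
have : (k.+1 * k.+1 <= 4 ^ k)%N by rewrite (_ : 4 = 2 * 2)%N// expnMn leq_mul.
apply: leq_trans; have Ak : (A <= k)%N by apply: leq_trans hk; rewrite leq_addr.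
have Bk : (B <= k)%N by apply: leq_trans hk; rewrite leq_addl.
by rewrite mulSn mulnS; have := leq_mul Ak (leqnn k); lia.
Qed.

Lemma mediant_close (R : realType) (q m q' m' e : int) (a : nat) (b c x : R) :
  0 < q -> 0 <= q' -> (e = 1 \/ e = -1) -> q * m' - q' * m = e ->
  let Q : R := a%:R * q%:~R + q'%:~R in
  (0 < a)%N -> Q ^+ 2 * b <= c ->
  (q%:~R * Q)^-1 <= x <= (q%:~R * Q)^-1 + b ->
  let N : int := a%:Z * q + q' in let M : int := a%:Z * m + m' in
  0 < N /\ `|m%:~R / q%:~R + e%:~R * x - M%:~R / N%:~R| <= c / N%:~R ^+ 2.
Proof.
move=> q0 q'0 he det Q a0 Qb /andP[x1 x2] QZ MZ.
have qn : (q%:~R : R) != 0 by rewrite intr_eq0 gt_eqF.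
have aR : 1 <= (a%:R : R) by rewrite ler1n.
have q'R : 0 <= (q'%:~R : R) by rewrite ler0z.
have Qp : 0 < Q.
  have q1 : 1 <= (q%:~R : R) by rewrite ler1z -gtz0_ge1.
  have : 1 <= a%:R * (q%:~R : R) by rewrite mulr_ege1.
  by rewrite /Q; lra.
have Qn := lt0r_neq0 Qp.
have QE : QZ%:~R = Q by rewrite /QZ intrD intrM.
have detR : q%:~R * m'%:~R - q'%:~R * m%:~R = e%:~R :> R by rewrite -det intrB !intrM.
have ne : `|e%:~R : R| = 1 by case: he => ->; rewrite ?intrN ?normrN normr1.
split; first by rewrite -(ltr0z R) QE.
rewrite QE.
have -> : m%:~R / q%:~R + e%:~R * x - MZ%:~R / Q = e%:~R * (x - (q%:~R * Q)^-1).
  transitivity (e%:~R * x - (q%:~R * m'%:~R - q'%:~R * m%:~R) / (q%:~R * Q)).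
    rewrite /MZ intrD intrM /Q; field.
    by rewrite qn -/Q Qn.
  by rewrite detR; field; rewrite qn Qn.
rewrite normrM ne mul1r ger0_norm; last by lra.
rewrite ler_pdivlMr ?exprn_gt0// mulrC; apply: le_trans Qb.
by rewrite ler_pM2l ?exprn_gt0//; lra.
Qed.

Section CuspStepMain.
Context {R : realType}.
Variable p : R.
Hypothesis p1 : 1 <= p.

Lemma short_vector_intro (q m : int) (rho alpha t u v : R) : 0 < q -> 0 < t ->
  q%:~R <= u * t -> t * `|q%:~R * alpha - m%:~R| <= v -> u + v < rho ->
  short_vector p rho alpha t.
Proof.
move=> q0 t0 hu hv uv; exists q, m; split.
  by apply: contraTneq q0 => -[-> _].
apply: le_lt_trans (nm_l1 p1 _ _) (le_lt_trans _ uv); apply: lerD.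
  by rewrite ger0_norm ?mulr_ge0 ?invr_ge0 ?(ltW t0) ?ler0z ?(ltW q0)// mulrC ler_pdivrMr.
by rewrite normrM (gtr0_norm t0) distrC.
Qed.

(* The point m/q + e x, just beyond the Farey mediant M/Q of m/q and m'/q' where
   M/Q = m/q + e/(qQ), has m/q as a short vector up to time Q and M/Q as a short
   vector from then on. *)
Lemma mediant_short (q m q' m' e : int) (a : nat) (D nu rho b x t : R) :
  0 < q -> 0 <= q' -> (e = 1 \/ e = -1) -> q * m' - q' * m = e ->
  let Q : R := a%:R * q%:~R + q'%:~R in
  0 < nu -> 1 + 2 * nu < rho -> 1 <= nu * D -> 0 < D ->
  0 < b -> (0 < a)%N -> Q ^+ 2 * b <= nu ^+ 2 -> Q ^+ 2 * b <= nu ->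
  (q%:~R * Q)^-1 <= x <= (q%:~R * Q)^-1 + b ->
  D * q%:~R <= t -> t ^+ 2 * b <= 1 ->
  short_vector p rho (m%:~R / q%:~R + e%:~R * x) t.
Proof.
move=> q0 q'0 he det Q nu0 hrho nuD D0 b0 a0 Qb2 Qb /andP[x1 x2] tD tb.
have q1 : 1 <= (q%:~R : R) by rewrite ler1z -gtz0_ge1.
set qR : R := q%:~R in q1 Q Qb2 Qb x1 x2 tD *.
have qp : 0 < qR by lra.
have qn := lt0r_neq0 qp.
have aR : 1 <= (a%:R : R) by rewrite ler1n.
have q'R : 0 <= (q'%:~R : R) by rewrite ler0z.
have qQ : qR <= Q.
  have : qR <= a%:R * qR by rewrite ler_peMl// ltW.
  by rewrite /Q; lra.
have Qp : 0 < Q by lra.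
have Qn := lt0r_neq0 Qp.
have t0 : 0 < t by apply: lt_le_trans tD; rewrite mulr_gt0.
have ne : `|e%:~R : R| = 1 by case: he => ->; rewrite ?intrN ?normrN normr1.
have x0 : 0 <= x by apply: le_trans x1; rewrite invr_ge0 mulr_ge0// ltW.
(* Up to time Q the vector of m/q has abscissa at most 1/D <= nu and ordinate at most t q x <= 1 +
   nu. Later the mediant has abscissa below 1 and ordinate at most t Q b <= nu, the square of t Q b
   being the product of t^2 b <= 1 and Q^2 b <= nu^2. *)
have [tQ|Qt] := leP t Q.
- apply: (@short_vector_intro q m _ _ _ nu (1 + nu) q0 t0); last by lra.
    rewrite -/qR; have : nu * (D * qR) <= nu * t by rewrite ler_pM2l.
    have : 1 * qR <= nu * D * qR by rewrite ler_pM2r.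
    by rewrite -mulrA; lra.
  have -> : q%:~R * (m%:~R / q%:~R + e%:~R * x) - m%:~R = e%:~R * (qR * x).
    by rewrite -/qR; field.
  rewrite normrM ne mul1r ger0_norm ?mulr_ge0 ?(ltW qp)//.
  apply: (@le_trans _ _ (Q * (qR * ((qR * Q)^-1 + b)))).
    by apply: ler_pM; rewrite ?(ltW t0) ?mulr_ge0 ?(ltW qp)// ler_pM2l.
  have -> : Q * (qR * ((qR * Q)^-1 + b)) = 1 + Q * qR * b by field; rewrite qn Qn.
  rewrite lerD2l; apply: le_trans Qb; rewrite ler_pM2r// expr2 ler_pM2l//.
pose QZ : int := a%:Z * q + q'; pose MZ : int := a%:Z * m + m'.
have QE : QZ%:~R = Q by rewrite /QZ intrD intrM.
have detR : qR * m'%:~R - q'%:~R * m%:~R = e%:~R by rewrite -det intrB !intrM.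
have QZ0 : 0 < QZ by rewrite -(ltr0z R) QE.
apply: (@short_vector_intro QZ MZ _ _ _ 1 nu QZ0 t0); last by lra.
  by rewrite QE mul1r ltW.
have -> : QZ%:~R * (m%:~R / q%:~R + e%:~R * x) - MZ%:~R =
    e%:~R * (Q * (x - (qR * Q)^-1)).
  transitivity (e%:~R * (Q * x) - (qR * m'%:~R - q'%:~R * m%:~R) / qR).
    by rewrite QE /MZ intrD intrM -/qR /Q; field.
  by rewrite detR; field; rewrite qn Qn.
rewrite normrM ne mul1r ger0_norm; last by rewrite mulr_ge0 ?(ltW Qp)//; lra.
apply: (@le_trans _ _ (t * (Q * b))); first by rewrite ler_pM2l// ler_pM2l//; lra.
rewrite -ler_sqr ?nnegrE ?mulr_ge0 ?(ltW t0) ?(ltW Qp) ?(ltW b0) ?(ltW nu0)//.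
have -> : (t * (Q * b)) ^+ 2 = (t ^+ 2 * b) * (Q ^+ 2 * b) by ring.
by apply: le_trans Qb2; rewrite ler_piMl// mulr_ge0 ?sqr_ge0// ltW.
Qed.

End CuspStepMain.

(** * The step towards a rational *)

Section CuspStep.
Context {R : realType}.
Variable p : R.
Hypothesis p1 : 1 <= p.

Lemma sqrt_inv (l : R) : 0 < l -> exists2 T, 0 < T & T ^+ 2 * l = 1.
Proof.
move=> l0; exists (Num.sqrt l^-1); first by rewrite sqrtr_gt0 invr_gt0.
by rewrite sqr_sqrtr ?invr_ge0 ?(ltW l0)// mulVf// lt0r_neq0.
Qed.

Lemma unit_sign (e : int) (y z w : R) : (e = 1 \/ e = -1) ->
  y = z + e%:~R * (e%:~R * (y - z)) /\ `|e%:~R * w| = `|w|.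
Proof.
by case=> ->; rewrite ?intrN ?mulN1r ?mul1r ?opprK ?normrN; split => //; ring.
Qed.

Lemma half_ball_itv (z A b : R) : `|z| <= b / 2 -> A <= z + (A + b / 2) <= A + b.
Proof. by rewrite ler_norml => /andP[h1 h2]; apply/andP; split; lra. Qed.

Lemma itv_sub_ball (d l A X b y : R) : d - l / 2 <= A -> A <= X -> X <= d + l / 4 ->
  b <= l / 4 -> A <= y <= A + b -> `|y - d| <= l / 2.
Proof. by move=> h1 h2 h3 h4 /andP[h5 h6]; rewrite ler_norml; lra. Qed.

Lemma itv_dist_le (A B X b Z y z : R) : 0 <= A -> 0 <= B -> A <= X -> B <= X ->
  X <= Z -> b <= Z -> A <= y <= A + b -> B <= z <= B + b -> `|y - z| <= 2 * Z.
Proof.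
by move=> ? ? ? ? ? ? /andP[? ?] /andP[? ?]; rewrite ler_norml; lra.
Qed.

Lemma itv_dist_ge (A A1 B b G g y z : R) : b <= 2^-1 * g -> g <= G -> A - A1 = G ->
  B <= A1 -> A <= y -> z <= B + b -> 2^-1 * g <= y - z.
Proof. by move=> *; lra. Qed.

Lemma le_quarter (u v : R) : u / 4 <= v -> u <= 4 * v.
Proof. by move=> *; lra. Qed.

Lemma half_le_quarter (d l : R) : 0 <= d -> d + l / 2 <= 2 * (d + l / 4).
Proof. by move=> *; lra. Qed.

(** In the new ball, the old ball provides short vectors up to time [T'], and [mediant_short] does
    from time [DR * qR] on. The times in between fill at most W + 1 dyadic windows, so at most H =
    (W + 1) C of the H + 1 candidate mediants can fail there. *)
Lemma cusp_step (C m : nat) (nu : R) : 0 < nu -> nu <= 1 ->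
  exists2 eta0, 0 < eta0 & forall eta rho,
    0 <= eta -> eta <= eta0 -> separation p C eta rho -> 1 + 2 * nu < rho ->
  forall c : R, 0 < c -> exists2 kap, 0 < kap <= 1 &
  forall x0 s, 0 < s -> 2 * s <= 1 -> good p m rho x0 s ->
  exists x1 s1, [/\ kap * s <= s1,
    forall x, `|x - x1| <= s1 -> `|x - x0| <= s, good p m rho x1 s1 &
    exists M N : int, 0 < N /\
      forall x, `|x - x1| <= s1 -> `|x - M%:~R / N%:~R| <= c / N%:~R ^+ 2].
Proof.
move=> nu0 nu1; have [D0 hD0] := nat_bound nu^-1; pose D := D0.+1.
(* D >= 1/nu makes q/t <= nu from time D q on. With [amin] = 2 D^2 the mediants are within (D q)^-2
   / 2 of m/q, so that the candidates are close enough for [few_not_short] up to that time. *)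
pose amin := (2 * D ^ 2)%N.
(* [W], hence [H], is linear in k, while K^2 = 4^k has to exceed 36 (amin + H + 1). *)
have [k hk] : exists k, (36 * C * k + 36 * (amin + (D + m + 2) * C + 1) <= 4 ^ k)%N.
  by eexists; exact: expn4_linear (leqnn _).
pose W := (D + m + k + 1)%N; pose H := (W.+1 * C)%N; pose K := (2 ^ k)%N.
have hK : (36 * (amin + H + 1) <= K ^ 2)%N.
  have -> : (K ^ 2 = 4 ^ k)%N by rewrite /K -expnM mulnC expnM.
  apply: leq_trans hk; rewrite /H /W.
  by rewrite leq_eqVlt; apply/orP; left; apply/eqP; ring.
have K6 : (6 <= K)%N.
  rewrite leqNgt; apply/negP => K5.
  have : (K ^ 2 <= 5 ^ 2)%N by rewrite leq_exp2r.
  by move: hK; move: (amin + H)%N (K ^ 2)%N => u v; lia.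
have am0 : (0 < amin)%N by rewrite muln_gt0 expn_gt0.
pose KR : R := K%:R; pose DR : R := D%:R.
have K6R : 6 <= KR by rewrite /KR ler_nat.
have DR1 : 1 <= DR by rewrite /DR ler1n.
have KR0 : 0 < KR by lra.
have DR0 : 0 < DR by lra.
have nuD : 1 <= nu * DR.
  rewrite mulrC -ler_pdivrMr// div1r; apply: le_trans hD0 _.
  by rewrite /DR ler_nat.
have aminR : amin%:R = 2 * DR ^+ 2 :> R by rewrite natrM natrX.
pose F : R := 2 * KR * (amin%:R + H%:R + 2).
(* E T bounds the largest denominator when there are times between [T'] and D q, for then q >= T /
   (D 2^m). Being independent of c, [E] may enter the bound on [eta]; the general bound [E'] below
   depends on c and enters [kap] only. *)
pose E : R := F + 4 * DR * 2 ^+ m.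
have AH : 0 < (amin%:R + H%:R + 2 : R) by rewrite -!natrD ltr0n addn2.
have F0 : 0 < F by rewrite /F !mulr_gt0.
have m20 : 0 < (2 ^+ m : R) by rewrite exprn_gt0.
have E0 : 0 < E by rewrite /E addr_gt0// !mulr_gt0.
have m40 : 0 < (4 ^+ m : R) by rewrite exprn_gt0.
exists (2 * E ^+ 2 * 4 ^+ m)^-1; first by rewrite invr_gt0 !mulr_gt0// exprn_gt0.
move=> eta rho eta0 etaE sep hrho c c0.
(* The three terms serve [mediant_short], the approximation within c/N^2, and the mutual closeness
   and disjointness of the candidate balls. *)
pose k0 : R := Num.min (nu ^+ 2) (Num.min c (2 * DR ^+ 2)^-1).
have D20 : 0 < 2 * DR ^+ 2 by rewrite mulr_gt0 ?exprn_gt0.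
have k00 : 0 < k0 by rewrite !lt_min exprn_gt0// c0 invr_gt0.
have k0nu2 : k0 <= nu ^+ 2 by rewrite /k0 ge_min lexx.
have k0c : k0 <= c by rewrite /k0 !ge_min lexx !orbT.
have k0D : k0 <= (2 * DR ^+ 2)^-1 by rewrite /k0 !ge_min lexx !orbT.
have k0nu : k0 <= nu by apply: le_trans k0nu2 _; rewrite expr2 ler_piMr// ltW.
have k02 : k0 <= 2^-1.
  apply: le_trans k0D _; rewrite lef_pV2 ?posrE//.
  by rewrite ler_peMr// exprn_ege1.
pose E' : R := F + 4 * KR / c.
have E'0 : 0 < E' by rewrite /E' addr_gt0// divr_gt0// mulr_gt0.
pose kap := Num.min (k0 / E' ^+ 2) 4^-1.
have kap0 : 0 < kap by rewrite lt_min invr_gt0 ltr0n andbT divr_gt0 ?exprn_gt0.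
have kap4 : kap <= 4^-1 by rewrite /kap ge_min lexx orbT.
exists kap; first by rewrite kap0; lra.
move=> x0 s s0 s1 gd.
pose l := 2 * s; have l0 : 0 < l by rewrite mulr_gt0.
have [T T0 Tl] := sqrt_inv l0.
have T1 : 1 <= T.
  rewrite leNgt; apply/negP => T1.
  have : T ^+ 2 < 1 by rewrite expr_lt1// ltW.
  have : T ^+ 2 * l <= T ^+ 2 * 1 by rewrite ler_wpM2l// sqr_ge0.
  by lra.
have KT2 : 2 < KR * T.
  have : 6 * 1 <= KR * T by apply: ler_pM.
  lra.
have [q [mm [q' [m' [e [[q0 /andP[q'0 q'q] he det] [qKT dge dle]]]]]]] :=
  dirichlet_pair p1 x0 KT2.
(* If the ball is already within c/q^2 of mm/q it is kept. Otherwise c < q^2 (d + l/2), which bounds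
   the denominators of the mediants in terms of c. *)
have [hin|/existsNP[xc /not_implyP[hxc /negP]]] :=
  pselect (forall x, `|x - x0| <= s -> `|x - mm%:~R / q%:~R| <= c / q%:~R ^+ 2).
  exists x0, s; split => //; last by exists mm, q.
  by rewrite ler_piMl ?(ltW s0)// (le_trans kap4)// invf_le1 ?ler1n.
rewrite -ltNge => cfar.
have q1 : 1 <= (q%:~R : R) by rewrite ler1z -gtz0_ge1.
set qR : R := q%:~R in q1 qKT dge dle cfar.
have qp : 0 < qR by exact: lt_le_trans q1.
have qn := lt0r_neq0 qp.
set q'R : R := q'%:~R.
have q'b : 0 <= q'R < qR by rewrite /q'R /qR ler0z q'0 ltr_int.
pose d := e%:~R * (x0 - mm%:~R / qR).
have ed : qR * d = e%:~R * (qR * x0 - mm%:~R) by rewrite /d; field.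
have d0 : 0 <= d by rewrite -(pmulr_rge0 _ qp) ed.
have qd : qR * d <= 2 / (KR * T) by rewrite ed.
have x0E : x0 = mm%:~R / qR + e%:~R * d by have [] := unit_sign x0 (mm%:~R / qR) 0 he.
have nm_e w := (unit_sign 0 0 w he).2.
have e2 : e%:~R * e%:~R = 1 :> R by case: he => ->; rewrite ?intrN ?mulrNN mul1r.
have cq : c < qR ^+ 2 * (d + l / 2).
  rewrite mulrC -ltr_pdivrMr ?exprn_gt0//; apply: lt_le_trans cfar _.
  have -> : xc - mm%:~R / qR = (xc - x0) + e%:~R * d by rewrite [in RHS]x0E; ring.
  apply: le_trans (ler_normD _ _) _; rewrite nm_e (ger0_norm d0) addrC lerD2l.
  by rewrite /l mulrAC divff ?mul1r.
have [a0 [ha0 xa0 xaH htop]] := farey_selection hK am0 q1 q'b T0 Tl d0 qd.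
pose Q (a : nat) : R := a%:R * qR + q'R.
rewrite -/(Q a0) -/(Q (a0 + H)%N) -/(Q a0.-1) -/(Q (a0 + H.+1)%N) in xa0 xaH htop.
have Qmono a b : (a <= b)%N -> Q a <= Q b.
  by move=> ab; rewrite /Q lerD2r ler_wpM2r ?(ltW qp)// ler_nat.
have Qlow a : a%:R * qR <= Q a by rewrite /Q lerDl; case/andP: q'b.
have Qpos a : (0 < a)%N -> 0 < Q a.
  by move=> a0'; apply: lt_le_trans (Qlow a); rewrite mulr_gt0// ltr0n.
pose Qm := Q (a0 + H.+1)%N.
have a0p : (0 < a0)%N := leq_trans am0 ha0.
have Qm0 : 0 < Qm by apply: Qpos; rewrite addn_gt0 a0p.
have qQm : qR <= Qm.
  apply: le_trans (Qlow _); rewrite ler_peMl ?(ltW qp)// ler1n addn_gt0 a0p//.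
have Fq : a0 = amin -> Qm <= F * T.
  move=> ea; apply: (@le_trans _ _ ((amin%:R + H%:R + 2) * qR)).
    by rewrite /Qm /Q ea natrD -natr1; have /andP[_ ?] := q'b; lra.
  apply: (@le_trans _ _ ((amin%:R + H%:R + 2) * (2 * (KR * T)))).
    by rewrite ler_wpM2l// -!natrD ler0n.
  by rewrite /F le_eqVlt; apply/orP; left; apply/eqP; ring.
have F2 : H.+2%:R * qR <= F * T.
  apply: (@le_trans _ _ ((amin%:R + H%:R + 2) * (2 * (KR * T)))).
    apply: ler_pM; rewrite ?(ltW qp)//.
    by rewrite -!natrD ler_nat addn2 -!addnS leq_addl.
  by rewrite /F le_eqVlt; apply/orP; left; apply/eqP; ring.
have top1 : (amin < a0)%N -> d + l / 4 < (qR * Q a0.-1)^-1 ->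
    qR * Q a0.-1 * (d + l / 4) < 1.
  move=> lt h; have Qp1 : 0 < Q a0.-1.
    by apply: Qpos; rewrite (leq_trans am0)// -ltnS prednK.
  by rewrite mulrC -ltr_pdivlMr ?mulr_gt0// div1r.
have QmE' : Qm <= E' * T.
  have [/Fq h|[lt /(top1 lt) h1 h2]] := htop.
    apply: le_trans h _; rewrite ler_pM2r// /E' lerDl.
    by rewrite divr_ge0 ?(ltW c0)// mulr_ge0// ltW.
  rewrite /E' mulrDl; apply: le_trans h2 _; rewrite addrC lerD//.
  have Qp1 : 0 < Q a0.-1.
    by apply: Qpos; rewrite (leq_trans am0)// -ltnS prednK.
  have : Q a0.-1 * c <= 2 * qR.
    apply: (@le_trans _ _ (Q a0.-1 * (qR ^+ 2 * (2 * (d + l / 4))))).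
      rewrite ler_pM2l//; apply: le_trans (ltW cq) _.
      by rewrite ler_pM2l ?exprn_gt0//; exact: half_le_quarter.
    have -> : Q a0.-1 * (qR ^+ 2 * (2 * (d + l / 4))) =
      2 * qR * (qR * Q a0.-1 * (d + l / 4)) by ring.
    by rewrite ler_piMr ?(ltW h1)// mulr_ge0// ltW.
  rewrite -ler_pdivlMr// => h3; apply: le_trans h3 _.
  have -> : 4 * KR / c * T = 2 * (2 * (KR * T)) / c by ring.
  by rewrite ler_pM2r ?invr_gt0// ler_pM2l.
pose b := Num.min (k0 / Qm ^+ 2) (l / 4).
have b0 : 0 < b by rewrite lt_min !divr_gt0// exprn_gt0.
have bl : b <= l / 4 by rewrite /b ge_min lexx orbT.
have bQ a : (a <= a0 + H.+1)%N -> Q a ^+ 2 * b <= k0.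
  move=> ha; have Qa0 : 0 <= Q a by apply: le_trans (Qlow a); rewrite mulr_ge0// ltW.
  apply: (@le_trans _ _ (Qm ^+ 2 * b)).
    by rewrite ler_pM2r// lerXn2r ?nnegrE ?(ltW Qm0)// Qmono.
  by rewrite mulrC -ler_pdivlMr ?exprn_gt0// /b ge_min lexx.
have bk : kap * l <= b.
  rewrite /b le_min; apply/andP; split; last by rewrite mulrC ler_pM2l.
  apply: (@le_trans _ _ (k0 / E' ^+ 2 * l)).
    by rewrite ler_pM2r// /kap ge_min lexx.
  have -> : k0 / E' ^+ 2 * l = k0 / (E' * T) ^+ 2.
    have T2 : T ^+ 2 != 0 by rewrite expf_neq0// lt0r_neq0.
    have -> : l = T ^- 2 by apply: (mulfI T2); rewrite Tl mulfV.
    have Tn := lt0r_neq0 T0; have En := lt0r_neq0 E'0.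
    by field; rewrite Tn En.
  rewrite ler_pM2l// lef_pV2 ?posrE ?exprn_gt0 ?mulr_gt0//.
  by rewrite lerXn2r ?nnegrE ?(ltW Qm0)// ltW// mulr_gt0.
pose xa (a : nat) := (qR * Q a)^-1.
have xamono a1 a2 : (0 < a1)%N -> (a1 <= a2)%N -> xa a2 <= xa a1.
  move=> h1 h2; have h3 := leq_trans h1 h2.
  by rewrite /xa lef_pV2 ?posrE ?mulr_gt0 ?Qpos// ler_pM2l// Qmono.
pose ctr (i : 'I_H.+1) := mm%:~R / qR + e%:~R * (xa (a0 + i)%N + b / 2).
have ballE i x : `|x - ctr i| <= b / 2 -> exists y,
    x = mm%:~R / qR + e%:~R * y /\ xa (a0 + i)%N <= y <= xa (a0 + i)%N + b.
  move=> hx; exists (e%:~R * (x - mm%:~R / qR)).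
  have [ex _] := unit_sign x (mm%:~R / qR) 0 he; split => //.
  have -> : e%:~R * (x - mm%:~R / qR) = e%:~R * (x - ctr i) + (xa (a0 + i)%N + b / 2).
    transitivity (e%:~R * (x - ctr i) + e%:~R * e%:~R * (xa (a0 + i)%N + b / 2)).
      by rewrite /ctr; ring.
    by rewrite e2 mul1r.
  by apply: half_ball_itv; rewrite nm_e.
have xi (i : 'I_H.+1) : [/\ d - l / 2 <= xa (a0 + i)%N,
    xa (a0 + i)%N <= xa a0 & 0 <= xa (a0 + i)%N].
  split.
  - by apply: le_trans xaH _; apply: xamono; rewrite ?addn_gt0 ?a0p// leq_add2l -ltnS.
  - by apply: xamono; rewrite ?leq_addr.
  - by rewrite invr_ge0 mulr_ge0 ?(ltW qp)// ltW// Qpos// addn_gt0 a0p.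
have ball_sub i x : `|x - ctr i| <= b / 2 -> `|x - x0| <= s.
  move=> /ballE[y [-> /andP[y1 y2]]]; have [h1 h2 h3] := xi i.
  rewrite {1}x0E opprD addrACA subrr add0r -mulrBr nm_e.
  have -> : s = l / 2 by rewrite /l mulrAC divff// mul1r.
  by apply: (itv_sub_ball h1 h2 xa0 bl); rewrite y1.
have [i hi] : exists i : 'I_H.+1, forall x, `|x - ctr i| <= b / 2 -> forall t,
    1 < t ^+ 2 * (l * 4 ^+ m) -> 0 < t -> t <= DR * qR -> short_vector p rho x t.
  apply: contrapT => /forallNP hn.
  have hn' (i : 'I_H.+1) : exists xt : R * R, [/\ `|xt.1 - ctr i| <= b / 2,
      1 < xt.2 ^+ 2 * (l * 4 ^+ m), 0 < xt.2, xt.2 <= DR * qR &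
      ~ short_vector p rho xt.1 xt.2].
    apply: contrapT => nex; apply: (hn i) => x hx t t1 t2 t3.
    by apply: contrapT => ns; apply: nex; exists (x, t).
  have [xt {}hn'] := choice hn'.
  have l4 : 0 < l * 4 ^+ m by rewrite mulr_gt0.
  have [T' T'0 T'l] := sqrt_inv l4.
  have T'T : T = T' * 2 ^+ m.
    have T'2 : 0 < T' * 2 ^+ m by rewrite mulr_gt0.
    apply/eqP; rewrite -(@eqrXn2 _ 2)// ?ltW// exprMn -exprM mulnC exprM.
    rewrite (_ : 2 ^+ 2 = 4 :> R); last by ring.
    apply/eqP; apply: (mulIf (lt0r_neq0 l0)); rewrite Tl -mulrA [_ * l]mulrC.
    by rewrite T'l.
  have Dq : T <= DR * qR * 2 ^+ m.
    have [_ h1 h2 h3 _] := hn' ord0.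
    rewrite T'T ler_pM2r//; apply: le_trans h3.
    rewrite -ler_sqr ?nnegrE ?(ltW T'0) ?(ltW h2)//.
    by rewrite -(ler_pM2r l4) T'l ltW.
  have QmE : Qm <= E * T.
    have [/Fq h|[lt /(top1 lt) h1 h2]] := htop.
      apply: le_trans h _; rewrite ler_pM2r// /E lerDl.
      by rewrite !mulr_ge0// ltW.
    rewrite /E mulrDl; apply: le_trans h2 _; rewrite addrC lerD//.
    have Qp1 : 0 < Q a0.-1.
      by apply: Qpos; rewrite (leq_trans am0)// -ltnS prednK.
    have h3 : qR * Q a0.-1 * (l / 4) <= 1.
      by apply: le_trans (ltW h1); rewrite ler_pM2l ?mulr_gt0// lerDr.
    rewrite -(ler_pM2r T0).
    apply: (@le_trans _ _ (Q a0.-1 * (DR * qR * 2 ^+ m))); first by rewrite ler_pM2l.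
    have -> : 4 * DR * 2 ^+ m * T * T = 4 * DR * 2 ^+ m * T ^+ 2 by ring.
    have h4 : qR * Q a0.-1 <= 4 * T ^+ 2.
      have : qR * Q a0.-1 * (l / 4) * T ^+ 2 <= 1 * T ^+ 2 by rewrite ler_pM2r ?exprn_gt0.
      have -> : qR * Q a0.-1 * (l / 4) * T ^+ 2 = qR * Q a0.-1 / 4 * (T ^+ 2 * l) by ring.
      by rewrite Tl mulr1 mul1r; exact: le_quarter.
    have : DR * 2 ^+ m * (qR * Q a0.-1) <= DR * 2 ^+ m * (4 * T ^+ 2).
      by rewrite ler_pM2l// mulr_gt0.
    by congr (_ <= _); ring.
  (* A single class suffices: neighbouring mediants differ by at least 1/Qm^2, and b is at most half
     of that. *)
  have := @few_not_short _ p C eta rho 'I_H.+1 unit predT (fun=> tt)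
    (fun i => (xt i).1) (fun i => (xt i).2) T' W sep eta0 T'0.
  rewrite (eq_card (B := 'I_H.+1))// card_ord card_unit mul1n -/H ltnn => few.
  suff : false by []; apply: few => //.
  - move=> i _; have [_ h1 h2 h3 _] := hn' i; apply/andP; split.
      rewrite -ler_sqr ?nnegrE ?(ltW T'0) ?(ltW h2)//.
      by rewrite -(ler_pM2r l4) T'l ltW.
    apply: le_trans h3 _.
    have D2 : DR <= 2 ^+ D by rewrite -natrX /DR ler_nat; apply: ltnW; exact: ltn_expl.
    apply: (@le_trans _ _ (2 ^+ D * (2 * (KR * T)))).
      by apply: ler_pM => //; exact: ltW.
    rewrite T'T /KR natrX /W le_eqVlt; apply/orP; left; apply/eqP.
    by rewrite !exprD expr1; ring.
  - by move=> i _; have [] := hn' i.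
  - move=> i j _ _; have [a1 b1 c1 d1 _] := hn' i; have [a2 b2 c2 d2 _] := hn' j.
    have [y1 [-> /andP[y1l y1u]]] := ballE _ _ a1.
    have [y2 [-> /andP[y2l y2u]]] := ballE _ _ a2.
    have [_ h2 h3] := xi i; have [_ h2' h3'] := xi j.
    rewrite opprD addrACA subrr add0r -mulrBr nm_e.
    have xa0D : xa a0 <= (2 * DR ^+ 2)^-1 / qR ^+ 2.
      rewrite /xa -invfM lef_pV2 ?posrE ?mulr_gt0 ?Qpos ?exprn_gt0//.
      have -> : 2 * DR ^+ 2 * qR ^+ 2 = qR * (amin%:R * qR) by rewrite aminR; ring.
      rewrite ler_pM2l//; apply: le_trans (Qlow a0).
      by rewrite ler_pM2r// ler_nat.
    have bD : b <= (2 * DR ^+ 2)^-1 / qR ^+ 2.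
      rewrite ler_pdivlMr ?exprn_gt0//; apply: le_trans k0D.
      apply: le_trans (bQ (a0 + H.+1)%N (leqnn _)); rewrite mulrC ler_pM2r//.
      by rewrite lerXn2r ?nnegrE ?(ltW qp) ?(ltW Qm0).
    apply: (@le_trans _ _ ((DR * qR) ^- 2)).
      have -> : (DR * qR) ^- 2 = 2 * ((2 * DR ^+ 2)^-1 / qR ^+ 2).
        by field; rewrite qn gt_eqF.
      by apply: (itv_dist_le h3 h3' h2 h2' xa0D bD); rewrite ?y1l ?y2l.
    rewrite lef_pV2 ?posrE ?exprn_gt0 ?mulr_gt0//.
    by rewrite lerXn2r ?nnegrE ?(ltW c1)// ltW// mulr_gt0.
  - move=> i j _ _ _.
    have T'i : T' ^- 2 = l * 4 ^+ m.
      have T'n := lt0r_neq0 T'0.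
      by apply: (mulfI (expf_neq0 2 T'n)); rewrite T'l mulfV// expf_neq0.
    have Qd : eta * T' ^- 2 <= (2 * Qm ^+ 2)^-1.
      apply: (@le_trans _ _ ((2 * E ^+ 2 * 4 ^+ m)^-1 * (l * 4 ^+ m))).
        by rewrite T'i ler_pM2r.
      have -> : (2 * E ^+ 2 * 4 ^+ m)^-1 * (l * 4 ^+ m) = (2 * (E * T) ^+ 2)^-1.
        have Tn := lt0r_neq0 T0; have En := lt0r_neq0 E0; have mn := lt0r_neq0 m40.
        have -> : l = T ^- 2.
          by apply: (mulfI (expf_neq0 2 Tn)); rewrite Tl mulfV// expf_neq0.
        by field; rewrite Tn En mn.
      rewrite lef_pV2 ?posrE ?mulr_gt0 ?exprn_gt0// ?mulr_gt0//.
      by rewrite ler_pM2l// lerXn2r ?nnegrE ?(ltW Qm0)// mulr_ge0// ltW.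
    have key (i' j' : 'I_H.+1) : (i' < j')%N ->
        eta * T' ^- 2 <= `|(xt i').1 - (xt j').1|.
      move=> ij; have [a1 _ _ _ _] := hn' i'; have [a2 _ _ _ _] := hn' j'.
      have [y1 [-> /andP[y1l y1u]]] := ballE _ _ a1.
      have [y2 [-> /andP[y2l y2u]]] := ballE _ _ a2.
      rewrite opprD addrACA subrr add0r -mulrBr nm_e.
      apply: le_trans (ler_norm _).
      set A := (a0 + i')%N in y1l y1u; set B := (a0 + j')%N in y2l y2u.
      have A0 : (0 < A)%N by rewrite addn_gt0 a0p.
      have AB : (A.+1 <= B)%N by rewrite ltn_add2l.
      have BH : (B <= a0 + H.+1)%N by rewrite leq_add2l ltnW.
      have xB : xa B <= xa A.+1 by apply: xamono.
      have gap : xa A - xa A.+1 = (Q A * Q A.+1)^-1.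
        have QA := lt0r_neq0 (Qpos _ A0); have QA1 := lt0r_neq0 (Qpos A.+1 isT).
        have e1 : Q A.+1 = Q A + qR by rewrite /Q -natr1; ring.
        by rewrite /xa e1 in QA1 *; field; rewrite QA qn QA1.
      have gap2 : (Qm ^+ 2)^-1 <= (Q A * Q A.+1)^-1.
        rewrite lef_pV2 ?posrE ?mulr_gt0 ?exprn_gt0 ?Qm0 ?Qpos//.
        have AH1 := leq_trans AB BH.
        rewrite expr2; apply: ler_pM; try exact/ltW/Qpos.
          by apply: Qmono; apply: leq_trans AH1.
        exact: Qmono.
      have b2 : b <= 2^-1 * (Qm ^+ 2)^-1.
        rewrite ler_pdivlMr ?exprn_gt0// mulrC; apply: le_trans k02.
        exact: bQ.
      apply: le_trans Qd _; rewrite invfM.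
      exact: (itv_dist_ge b2 gap2 gap xB y1l y2u).
    move=> ij; have [lt|lt|eij] := ltngtP i j; last by move: ij; rewrite (val_inj eij) eqxx.
      exact: key.
    by rewrite distrC; exact: key.
exists (ctr i), (b / 2).
have Qi : Q (a0 + i)%N ^+ 2 * b <= k0 by apply: bQ; rewrite leq_add2l ltnW// ltnS ltnW.
have ai0 : (0 < a0 + i)%N by rewrite addn_gt0 a0p.
split.
- by rewrite ler_pdivlMr// -mulrA [s * 2]mulrC.
- exact: ball_sub.
- move=> x hx t t1; rewrite (_ : 2 * (b / 2) = b); last by field.
  move=> tb; have t0 : 0 < t by exact: lt_le_trans t1.
  have tb1 : t ^+ 2 * b <= 1.
    apply: le_trans tb; rewrite ler_pM2l ?exprn_gt0// ler_peMr ?(ltW b0)//.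
    by rewrite exprn_ege1// ler1n.
  have [h|h] := leP (t ^+ 2 * (l * 4 ^+ m)) 1.
    by apply: gd => //; exact: ball_sub hx.
  have [tD|/ltW tD] := leP t (DR * qR); first exact: (hi x hx t h t0 tD).
  have [y [-> hy]] := ballE i x hx.
  apply: (@mediant_short _ p p1 q mm q' m' e (a0 + i)%N DR nu rho b) => //; try exact: le_trans Qi _.
exists ((a0 + i)%N%:Z * mm + m'), ((a0 + i)%N%:Z * q + q').
have hc : Q (a0 + i)%N ^+ 2 * b <= c by exact: le_trans Qi _.
have xa1 : (q%:~R * Q (a0 + i)%N)^-1 <= xa (a0 + i)%N <= (q%:~R * Q (a0 + i)%N)^-1 + b.
  by rewrite lexx lerDl ltW.
split; first by have [] := mediant_close q0 q'0 he det ai0 hc xa1.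
move=> x hx; have [y [-> hy]] := ballE i x hx.
by have [] := mediant_close q0 q'0 he det ai0 hc hy.
Qed.

End CuspStep.

(** * Escaping a cover *)

Lemma half_complement (a b n : nat) :
  (a + b = n -> 2 * b <= n -> n <= 2 * a)%N.
Proof. by lia. Qed.

Section CoverGame.
Context {R : realType}.
Variables (p : R) (U : nat -> set R) (w : nat -> R) (s : R).
Hypotheses (p1 : 1 <= p) (s0 : 0 < s) (s1 : s < 1).
Hypothesis w0 : forall k, 0 < w k.
Hypothesis wU : forall k x y, U k x -> U k y -> `|x - y| `^ s <= w k.

Definition meets (k : nat) (c d : R) : Prop := exists2 x, U k x & `|x - c| <= d.

Definition ball_weight (c d : R) : \bar R :=
  (\sum_(k <oo) (w k * (`[< meets k c d >])%:R)%:E)%E.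

Lemma weight_ge0 k c d : 0 <= w k * (`[< meets k c d >])%:R.
Proof. by rewrite mulr_ge0// ltW. Qed.

Lemma ball_weight_sub c d c' d' : (forall x, `|x - c'| <= d' -> `|x - c| <= d) ->
  (ball_weight c' d' <= ball_weight c d)%E.
Proof.
move=> sub; apply: lee_nneseries => [k _ _|k _]; first by rewrite lee_fin weight_ge0.
rewrite lee_fin ler_pM2l// ler_nat; case: asboolP => // -[x Ux xc].
by rewrite asboolT//; exists x => //; exact: sub.
Qed.

Lemma ball_weight_le_total c d : (ball_weight c d <= \sum_(k <oo) (w k)%:E)%E.
Proof.
apply: lee_nneseries => [k _ _|k _]; first by rewrite lee_fin weight_ge0.
by rewrite lee_fin ler_piMr ?(ltW (w0 k))//; case: asboolP.
Qed.

Lemma meets_weight k c d : meets k c d -> ((w k)%:E <= ball_weight c d)%E.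
Proof.
move=> h.
apply: le_trans (@nneseries_lim_ge R _ xpredT 0%N k.+1 _); last first.
  by move=> n _ _; rewrite lee_fin weight_ge0.
rewrite big_nat_recr//= asboolT// mulr1 leeDr// sume_ge0// => n _.
by rewrite lee_fin weight_ge0.
Qed.

(** A set meeting the ball weighs less than (d/n)^s, so its diameter is below d/n, whereas distinct
    children of equal parity are 2 d/n apart: it meets at most one child of each parity. *)
Lemma children_weight (n : nat) c d : 0 < d -> (0 < n)%N ->
  (ball_weight c d < ((d / n%:R) `^ s)%:E)%E ->
  (\sum_(i < n) ball_weight (child n c d i) (d / n%:R) <= 2%:E * ball_weight c d)%E.
Proof.
move=> d0 n0 hW; rewrite /ball_weight -nneseries_sum; last first.
  by move=> i j _; rewrite lee_fin weight_ge0.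
rewrite -nneseriesZl; last by move=> k _; rewrite lee_fin weight_ge0.
apply: lee_nneseries => [k _ _|k _].
  by apply: sume_ge0 => i _; rewrite lee_fin weight_ge0.
rewrite sumEFin -EFinM lee_fin -mulr_sumr mulrCA ler_pM2l//.
rewrite -natr_sum -natrM ler_nat.
have u0 : 0 < d / n%:R by rewrite divr_gt0// ltr0n.
have [mk|nmk] := pselect (meets k c d); last first.
  rewrite big1// => i _; rewrite asboolF// => -[x Ux xc]; apply: nmk.
  by exists x => //; exact: (child_sub d0 (ltn_ord i) xc).
rewrite (asboolT mk) muln1.
have diamU x y : U k x -> U k y -> `|x - y| < d / n%:R.
  move=> Ux Uy; have := le_lt_trans (meets_weight mk) hW; rewrite lte_fin => h.
  rewrite ltNge; apply/negP => h2.
  have := ler_powRl s0 (ltW u0) h2; have := wU Ux Uy; lra.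
rewrite -big_mkcond/= sum1_card -[2%N]muln1 -card_bool.
apply: (@card_le_fibers _ _ _ (fun i : 'I_n => odd i)) => b.
apply/card_le1_eqP => i j.
rewrite !inE => /andP[/asboolP[x Ux xi] /eqP oi] /andP[/asboolP[y Uy yj] /eqP oj].
have gap (a b' : nat) : odd a = odd b' -> (a < b')%N -> (a.+2 <= b')%N.
  move=> oab lt; rewrite ltn_neqAle lt andbT; apply/eqP => e.
  by move: oab; rewrite -e /=; case: (odd a).
have far (i' j' : 'I_n) x' y' : odd i' = odd j' -> (i' < j')%N -> U k x' -> U k y' ->
    `|x' - child n c d i'| <= d / n%:R -> `|y' - child n c d j'| <= d / n%:R -> False.
  move=> oij lt Ux' Uy' h1 h2.
  have := child_far d0 n0 (gap _ _ oij lt) h1 h2; have := diamU _ _ Ux' Uy'; lra.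
case: (ltngtP i j) => [lt|lt|/val_inj//]; exfalso.
  by apply: (far i j x y) => //; rewrite oi oj.
by apply: (far j i y x) => //; rewrite oi oj.
Qed.

Variables (C m : nat) (eta rho : R).
Hypotheses (sep : separation p C eta rho) (eta0 : 0 <= eta)
  (etam : eta * 16 ^+ m <= 1) (hCm : (4 * m.+1 * C <= 4 ^ m)%N)
  (hsm : 8 <= (4 ^ m)%:R `^ (1 - s)).

Local Notation n := (4 ^ m)%N.

(** Otherwise the good children, at least n/2 of them, would weigh at least v each, in total V g
    n^(1-s) / 4 >= 2 V g, while [children_weight] leaves less than 2 V g. Hence the 8 in [hsm]. *)
Lemma game_step (c d g : R) : 0 < d -> 0 < g -> g <= 1 -> good p m rho c d ->
  (ball_weight c d < ((d / n%:R) `^ s * g)%:E)%E ->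
  exists c', [/\ forall x, `|x - c'| <= d / n%:R -> `|x - c| <= d,
    good p m rho c' (d / n%:R) &
    (ball_weight c' (d / n%:R) < ((d / n%:R / n%:R) `^ s * (g / 2))%:E)%E].
Proof.
move=> d0 g0 g1 gd hW.
have n0 : (0 < n)%N by rewrite expn_gt0.
have nR : (0 : R) < n%:R by rewrite ltr0n.
have u0 : 0 < d / n%:R by rewrite divr_gt0.
set V := (d / n%:R) `^ s in hW; have V0 : 0 < V by rewrite powR_gt0.
have hW1 : (ball_weight c d < V%:E)%E.
  by apply: lt_le_trans hW _; rewrite lee_fin ler_piMr// ltW.
apply: contrapT => /forallNP H.
pose G : pred 'I_n := fun i => `[< good p m rho (child n c d i) (d / n%:R) >].
set v := (d / n%:R / n%:R) `^ s * (g / 2) in H.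
have v0 : 0 < v by rewrite mulr_gt0 ?powR_gt0 ?divr_gt0.
have Wv i : G i -> (v%:E <= ball_weight (child n c d i) (d / n%:R))%E.
  move=> /asboolP Gi; rewrite leNgt; apply/negP => lt; apply: (H (child n c d i)).
  by split => // x; exact: (child_sub d0 (ltn_ord i)).
have few := few_bad_children sep eta0 etam d0 gd.
have many : (n <= 2 * #|G|)%N.
  have := cardC G; rewrite card_ord => e.
  have e2 : #|[predC G]| = #|[pred i : 'I_n | ~~ G i]| by apply: eq_card.
  move: few; rewrite -/G -e2 => few.
  have : (2 * #|[predC G]| <= n)%N.
    by apply: leq_trans hCm; apply: leq_trans (leq_mul (leqnn 2) few) _; rewrite !mulnA.
  exact: half_complement.
have low : ((#|G|%:R * v)%:E <= \sum_(i < n) ball_weight (child n c d i) (d / n%:R))%E.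
  apply: (@le_trans _ _ (\sum_(i < n | G i) v%:E)%E).
    by rewrite sumEFin sumr_const mulr_natl.
  rewrite big_mkcond/=; apply: lee_sum => i _; case: ifP => [/Wv//|_].
  by apply: nneseries_ge0 => k _ _; rewrite lee_fin weight_ge0.
have up := children_weight d0 n0 hW1.
have : ((#|G|%:R * v)%:E < (2 * (V * g))%:E)%E.
  apply: le_lt_trans low (le_lt_trans up _).
  by rewrite EFinM lte_pmul2l// lte_fin.
rewrite lte_fin ltNge => /negP; apply.
have GR : n%:R / 2 <= (#|G|%:R : R).
  by rewrite ler_pdivrMr// -natrM ler_nat mulnC.
apply: (@le_trans _ _ (n%:R / 2 * v)); last by rewrite ler_pM2r.
have -> : n%:R / 2 * v = V * g * (n%:R `^ (1 - s)) / 4.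
  have -> : n%:R `^ (1 - s) = n%:R * (n%:R `^ s)^-1 :> R.
    rewrite powRD; last by rewrite (lt0r_neq0 nR) implybT.
    by rewrite powRr1 ?(ltW nR)// powRN.
  rewrite /v powRM ?(ltW u0) ?invr_ge0 ?(ltW nR)//.
  have -> : n%:R^-1 `^ s = (n%:R `^ s)^-1 :> R.
    by rewrite -powR_inv1 ?(ltW nR)// -powRrM mulN1r powRN.
  rewrite -/V.
  by field; rewrite gt_eqF ?powR_gt0.
have : V * g * 8 <= V * g * n%:R `^ (1 - s) by rewrite ler_pM2l// mulr_gt0.
lra.
Qed.

(** The reserve 2^-k accumulated here pays for the loss of scale [kap] in a step towards a
    rational. *)
Lemma game_iter (k : nat) (c d : R) : 0 < d -> good p m rho c d ->
  (ball_weight c d < ((d / n%:R) `^ s)%:E)%E ->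
  exists c' d', [/\ 0 < d', d' <= d / n%:R ^+ k,
    forall x, `|x - c'| <= d' -> `|x - c| <= d,
    good p m rho c' d' &
    (ball_weight c' d' < ((d' / n%:R) `^ s * (2 ^+ k)^-1)%:E)%E].
Proof.
move=> d0 gd hW; elim: k => [|k [c' [d' [d'0 dd sub gd' hW']]]].
  by exists c, d; rewrite !expr0 invr1 !mulr1; split.
have nR : (0 : R) < n%:R by rewrite ltr0n expn_gt0.
have g0 : 0 < (2 ^+ k : R)^-1 by rewrite invr_gt0 exprn_gt0.
have g1 : (2 ^+ k : R)^-1 <= 1 by rewrite invf_le1 ?exprn_gt0// exprn_ege1// ler1n.
have [c2 [sub2 gd2 hW2]] := game_step d'0 g0 g1 gd' hW'.
exists c2, (d' / n%:R); split => //.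
- by rewrite divr_gt0.
- by rewrite exprSr invfM mulrA ler_pM2r ?invr_gt0.
- by move=> x /sub2 /sub.
- by move: hW2; rewrite exprSr invfM.
Qed.

Hypothesis m0 : (0 < m)%N.
Hypothesis cusp : forall c : R, 0 < c -> exists2 kap, 0 < kap <= 1 &
  forall x0 s, 0 < s -> 2 * s <= 1 -> good p m rho x0 s ->
  exists x1 s1, [/\ kap * s <= s1,
    forall x, `|x - x1| <= s1 -> `|x - x0| <= s, good p m rho x1 s1 &
    exists M N : int, 0 < N /\
      forall x, `|x - x1| <= s1 -> `|x - M%:~R / N%:~R| <= c / N%:~R ^+ 2].

Definition position (J : R * R) : Prop := [/\ 0 < J.2, 2 * J.2 <= 1,
  good p m rho J.1 J.2 & (ball_weight J.1 J.2 < ((J.2 / n%:R) `^ s)%:E)%E].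

Lemma game_round (c : R) (J : R * R) : 0 < c -> position J ->
  exists J', [/\ position J', J'.2 <= J.2 / 2,
    forall x, `|x - J'.1| <= J'.2 -> `|x - J.1| <= J.2 &
    exists M N : int, 0 < N /\
      forall x, `|x - J'.1| <= J'.2 -> `|x - M%:~R / N%:~R| <= c / N%:~R ^+ 2].
Proof.
move=> c0 [d0 d1 gd hW]; have [kap /andP[kap0 kap1] hk] := cusp c0.
have [B hB] := nat_bound kap^-1.
have nR : (0 : R) < n%:R by rewrite ltr0n expn_gt0.
have n2 : (2 : R) <= n%:R.
  by rewrite ler_nat; apply: (@leq_trans (4 ^ 1)); rewrite ?leq_exp2l.
(* B + 1 steps bring the reserve below kap <= kap^s, which compensates for shrinking the radius by
   [kap]; performing at least one step also halves the radius. *)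
have [c' [d' [d'0 dd sub gd' hW']]] := game_iter B.+1 d0 gd hW.
have d'2 : d' <= J.2 / 2.
  apply: le_trans dd _; rewrite ler_pM2l// lef_pV2 ?posrE ?exprn_gt0//.
  apply: (le_trans n2); rewrite exprS ler_peMr ?(ltW nR)// exprn_ege1//.
  by apply: le_trans n2; rewrite ler1n.
have d'1 : 2 * d' <= 1 by lra.
have [x1 [t1 [kt sub1 gd1 hMN]]] := hk c' d' d'0 d'1 gd'.
have t10 : 0 < t1 by apply: lt_le_trans kt; rewrite mulr_gt0.
have t1d : t1 <= d'.
  have h1 : `|x1 + t1 - x1| <= t1 by rewrite addrAC subrr add0r gtr0_norm.
  have h2 : `|x1 - t1 - x1| <= t1 by rewrite addrAC subrr add0r normrN gtr0_norm.
  by have := sub1 _ h1; have := sub1 _ h2; rewrite !ler_norml; lra.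
exists (x1, t1); split => //=.
- split => //=; first by lra.
  apply: le_lt_trans (ball_weight_sub sub1) (lt_le_trans hW' _).
  rewrite lee_fin.
  have kB : (2 ^+ B.+1)^-1 <= kap.
    rewrite -[leRHS]invrK lef_pV2 ?posrE ?invr_gt0 ?exprn_gt0//.
    apply: le_trans hB _; rewrite -natrX ler_nat.
    by apply: ltnW; apply: leq_trans (ltn_expl B.+1 _).
  have u0 : 0 < d' / n%:R by rewrite divr_gt0.
  apply: (@le_trans _ _ ((d' / n%:R) `^ s * kap `^ s)).
    rewrite ler_pM2l ?powR_gt0//; apply: (le_trans kB).
    by rewrite -[leLHS]powRr1 ?(ltW kap0)// ger_powR ?kap0// ltW.
  rewrite -powRM ?(ltW u0) ?(ltW kap0)//; apply: ler_powRl => //.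
    by rewrite mulr_ge0// ltW.
  by rewrite mulrAC ler_pM2r ?invr_gt0// mulrC.
- by lra.
- by move=> x /sub1 /sub.
Qed.

(** The k-th round is played with c = 1/(k + 1), and x is the common point of the nested balls. A
    set containing x would weigh less than (d j / n)^s for every j, which tends to 0. *)
Lemma game_point (J0 : R * R) : position J0 ->
  exists x : R, [/\ forall k, ~ U k x,
    forall t, 1 <= t -> short_vector p rho x t &
    forall c, 0 < c -> exists M N : int, 0 < N /\ `|x - M%:~R / N%:~R| <= c / N%:~R ^+ 2].
Proof.
move=> PJ0.
have H (kJ : nat * {J | position J}) : exists J' : {J | position J},
   [/\ (sval J').2 <= (sval kJ.2).2 / 2,
    forall x, `|x - (sval J').1| <= (sval J').2 -> `|x - (sval kJ.2).1| <= (sval kJ.2).2 &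
    exists M N : int, 0 < N /\ forall x, `|x - (sval J').1| <= (sval J').2 ->
      `|x - M%:~R / N%:~R| <= kJ.1.+1%:R^-1 / N%:~R ^+ 2].
  have c0 : 0 < (kJ.1.+1%:R : R)^-1 by rewrite invr_gt0.
  have [J' [PJ' h1 h2 h3]] := game_round c0 (svalP kJ.2).
  by exists (exist _ J' PJ').
have [next hnext] := choice H.
pose J := fix J k := if k is k'.+1 then next (k', J k') else exist _ J0 PJ0.
pose c k := (sval (J k)).1; pose d k := (sval (J k)).2.
have PJ k : position (sval (J k)) := svalP (J k).
have d0 k : 0 < d k by have [] := PJ k.
have dS k : d k.+1 <= d k / 2 by have [] := hnext (k, J k).
have subS k x : `|x - c k.+1| <= d k.+1 -> `|x - c k| <= d k.
  by have [_ + _] := hnext (k, J k); exact.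
have sub k l x : (k <= l)%N -> `|x - c l| <= d l -> `|x - c k| <= d k.
  move=> /subnK <-; elim: (l - k)%N => [|j IH]; first by rewrite add0n.
  by rewrite addSn => /subS; exact: IH.
have lows k l : c k - d k <= c l + d l.
  pose i := maxn k l.
  have h : `|c i - c i| <= d i by rewrite subrr normr0 ltW.
  have := sub k i _ (leq_maxl _ _) h; have := sub l i _ (leq_maxr _ _) h.
  by rewrite !ler_norml; lra.
pose S := [set z | exists k, z = c k - d k].
have Sub k : ubound S (c k + d k) by move=> _ [l ->]; exact: lows.
have Ssup : has_sup S by split; [exists (c 0%N - d 0%N), 0%N|exists (c 0%N + d 0%N)].
pose x := sup S.
have xJ k : `|x - c k| <= d k.
  have h1 : x <= c k + d k by apply: ge_sup (Sub k); case: Ssup.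
  have h2 : c k - d k <= x by apply: ub_le_sup; [case: Ssup|exists k].
  by rewrite ler_norml; lra.
have dk k : d k <= (2 ^+ k)^-1.
  elim: k => [|k IH].
    have [_ + _ _] := PJ 0%N; have := d0 0%N.
    by rewrite /d /= expr0 invr1; lra.
  by apply: le_trans (dS k) _; rewrite exprSr invfM ler_pM2r.
have small e : 0 < e -> exists k, d k < e.
  move=> e0; have [B hB] := nat_bound e^-1; exists B.
  apply: le_lt_trans (dk B) _; rewrite -[ltRHS]invrK ltf_pV2 ?posrE ?invr_gt0 ?exprn_gt0//.
  by apply: le_lt_trans hB _; rewrite -natrX ltr_nat ltn_expl.
exists x; split.
- move=> k Ux.
  have nR : (0 : R) < n%:R by rewrite ltr0n expn_gt0.
  have e0 : 0 < w k `^ s^-1 * n%:R by rewrite mulr_gt0 ?powR_gt0.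
  have [j hj] := small _ e0.
  have mk : meets k (c j) (d j) by exists x.
  have [_ _ _ hW] := PJ j.
  have := le_lt_trans (meets_weight mk) hW; rewrite lte_fin ltNge => /negP; apply.
  have -> : w k = (w k `^ s^-1) `^ s.
    by rewrite -powRrM mulVf ?gt_eqF// powRr1// ltW.
  rewrite -/(d j); apply: ler_powRl => //.
    by apply: divr_ge0; [exact: ltW (d0 j)|exact: ltW].
  by rewrite ler_pdivrMr//; exact: ltW.
- move=> t t1.
  have e0 : 0 < (t ^+ 2 * 2 * 4 ^+ m)^-1.
    have t0 : 0 < t := lt_le_trans ltr01 t1.
    by rewrite invr_gt0 !mulr_gt0 ?exprn_gt0.
  have [j hj] := small _ e0; have [_ _ gd _] := PJ j.
  apply: (gd x (xJ j) t t1); rewrite -/(d j).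
  have -> : t ^+ 2 * (2 * d j * 4 ^+ m) = d j * (t ^+ 2 * 2 * 4 ^+ m) by ring.
  by rewrite -ler_pdivlMr ?div1r ?(ltW hj)// -invr_gt0.
- move=> c1 c10; have [B hB] := nat_bound c1^-1.
  have [_ _ [M [N [N0 hN]]]] := hnext (B, J B).
  exists M, N; split => //; apply: le_trans (hN x (xJ B.+1)) _.
  rewrite ler_pM2r; last by rewrite invr_gt0 exprn_gt0// ltr0z.
  rewrite -[leRHS]invrK lef_pV2 ?posrE ?invr_gt0//.
  by apply: le_trans hB _; rewrite ler_nat.
Qed.

End CoverGame.

(** * Hausdorff dimension *)

Section HausdorffUpper.
Context {R : realType}.
Implicit Types (s c d : R) (A U : set R).

Lemma diam_finite U (b : R) : U !=set0 -> (diam U <= b%:E)%E ->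
  exists D : R, [/\ diam U = D%:E, 0 <= D, D <= b &
    forall x y, U x -> U y -> `|x - y| <= D].
Proof.
move=> [z Uz] hb.
have ub x y : U x -> U y -> ((`|x - y|)%:E <= diam U)%E.
  by move=> Ux Uy; apply: ereal_sup_ubound; exists (x, y).
have h0 : (0%:E <= diam U)%E by have := ub z z Uz Uz; rewrite subrr normr0.
case: (diam U) hb h0 ub => [D| |] // hb h0 ub.
exists D; split => //.
Qed.

Lemma diam_pow_ge0 s U : (0 <= diam_pow s U)%E.
Proof. by rewrite /diam_pow; case: ifP => // _; exact: poweR_ge0. Qed.

Lemma diam_pow_le s U (b : R) : 0 < s -> 0 <= b ->
  (forall x y, U x -> U y -> `|x - y| <= b) -> (diam_pow s U <= (b `^ s)%:E)%E.
Proof.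
move=> s0 b0 hb; rewrite /diam_pow; case: asboolP => [_|/eqP/set0P U0].
  by rewrite lee_fin powR_ge0.
have hd : (diam U <= b%:E)%E.
  by apply: ge_ereal_sup => _ [[x y] [Ux Uy] <-]; rewrite lee_fin; exact: hb.
have [D [-> D0 Db _]] := diam_finite U0 hd.
by rewrite poweR_EFin lee_fin; apply: ler_powRl.
Qed.

Lemma hausdorff_premeasure_ge0 s d A : (0 <= hausdorff_premeasure s d A)%E.
Proof.
apply: le_ereal_inf_tmp => _ [U _ <-]; apply: nneseries_ge0 => k _ _.
exact: diam_pow_ge0.
Qed.

Lemma powR_neg_tangent s x : 0 <= s -> 0 < x -> 1 + s * (1 - x) <= x `^ (- s).
Proof.
move=> s0 x0; rewrite /powR gt_eqF//; apply: le_trans (expR_ge1Dx _).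
rewrite lerD2l mulNr -mulrN ler_wpM2l//.
have : ln (1 + (x - 1)) <= x - 1 by apply: le_ln1Dx; lra.
by rewrite addrC subrK; lra.
Qed.

(** Comparison with the integral of x^(-s-1), telescoped: [powR_neg_tangent] at a/(a + 1) gives (a +
    1)^(-s-1) <= (a^(-s) - (a + 1)^(-s)) / s. *)
Lemma riemann_sum_le s n : 0 < s ->
  \sum_(i < n.+1) (i.+1%:R : R) `^ (- (s + 1)) <=
  1 + s^-1 - s^-1 * n.+1%:R `^ (- s).
Proof.
move=> s0; elim: n => [|n IH]; first by rewrite big_ord1 !powR1; lra.
rewrite big_ord_recr/=; set S := \sum_(_ < _) _ in IH *.
set a : R := n.+1%:R in IH *.
have eb : n.+2%:R = a + 1 :> R by rewrite -natr1.
have a0 : 0 < a by rewrite ltr0n.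
have b0 : 0 < a + 1 by lra.
rewrite eb; have h := powR_neg_tangent (ltW s0) (divr_gt0 a0 b0).
have e1 : (a + 1) `^ (- (s + 1)) = (a + 1) `^ (- s) * (a + 1)^-1.
  rewrite opprD powRD; last by rewrite (lt0r_neq0 b0) implybT.
  by rewrite powR_inv1// ltW.
have e2 : a `^ (- s) = (a / (a + 1)) `^ (- s) * (a + 1) `^ (- s).
  have ab : a / (a + 1) * (a + 1) = a by rewrite divfK// gt_eqF.
  by rewrite -powRM ?ab// ?divr_ge0// ltW.
have P0 : 0 < (a + 1) `^ (- s) by rewrite powR_gt0.
have : (1 + s * (1 - a / (a + 1))) * (a + 1) `^ (- s) <= a `^ (- s).
  by rewrite e2 ler_pM2r.
have -> : 1 - a / (a + 1) = (a + 1)^-1 by field; rewrite gt_eqF.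
rewrite e1 => h2.
have : s^-1 * ((1 + s * (a + 1)^-1) * (a + 1) `^ (- s)) <= s^-1 * a `^ (- s).
  by rewrite ler_pM2l ?invr_gt0.
have -> : s^-1 * ((1 + s * (a + 1)^-1) * (a + 1) `^ (- s)) =
  s^-1 * (a + 1) `^ (- s) + (a + 1) `^ (- s) * (a + 1)^-1.
  by field; rewrite !gt_eqF.
lra.
Qed.

(* The line is covered by intervals between consecutive values of c ln(j + 1)
   and their mirror images, alternately, the k-th of length at most 2c/(k + 1). *)
Definition log_cover c (k : nat) : set R :=
  [set x | c * ln (k./2.+1%:R) <= (-1) ^+ k * x <= c * ln (k./2.+2%:R)].

Lemma dist_le_width (a b u v e : R) : a <= u -> u <= b -> a <= v -> v <= b ->
  b <= a + e -> `|u - v| <= e.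
Proof. by move=> *; rewrite ler_norml; lra. Qed.

Lemma log_cover_diam c k x y : 0 <= c -> log_cover c k x -> log_cover c k y ->
  `|x - y| <= 2 * c / k.+1%:R.
Proof.
move=> c0 /andP[x1 x2] /andP[y1 y2].
have -> : `|x - y| = `|(-1) ^+ k * x - (-1) ^+ k * y|.
  by rewrite -mulrBr normrM normrX normrN1 expr1n mul1r.
set j := k./2 in x1 x2 y1 y2.
have j0 : (0 : R) < j.+1%:R by rewrite ltr0n.
have hl : ln (j.+2%:R : R) <= ln (j.+1%:R) + (j.+1%:R)^-1.
  have -> : j.+2%:R = j.+1%:R * (1 + (j.+1%:R)^-1) :> R.
    by rewrite mulrDr mulfV ?gt_eqF// mulr1 natr1.
  have i0 : (0 : R) < (j.+1%:R)^-1 by rewrite invr_gt0.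
  have i1 : (0 : R) < 1 + (j.+1%:R)^-1 by rewrite addr_gt0.
  rewrite lnM ?posrE//.
  by rewrite lerD2l; apply: le_ln1Dx; apply: lt_trans i0; rewrite ltrN10.
have hc : c * ln (j.+2%:R : R) <= c * ln (j.+1%:R) + c / j.+1%:R.
  by rewrite -mulrDr ler_wpM2l.
apply: (@le_trans _ _ (c / j.+1%:R)); first exact: (dist_le_width x1 x2 y1 y2 hc).
have kj : (k.+1 <= 2 * j.+1)%N.
  rewrite mul2n doubleS -[X in (X < _)%N](odd_double_half k) -/j.
  by case: (odd k); rewrite ?add1n ?add0n.
have -> : c / j.+1%:R = 2 * c / (2 * j.+1%:R) by field; rewrite gt_eqF.
rewrite ler_wpM2l ?mulr_ge0// lef_pV2 ?posrE ?mulr_gt0 ?ltr0n//.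
by rewrite -natrM ler_nat.
Qed.

Lemma log_cover_total c x : 0 < c -> exists k, log_cover c k x.
Proof.
move=> c0.
have [j hj] : exists j : nat, c * ln (j.+1%:R) <= `|x| <= c * ln (j.+2%:R).
  pose n := Num.truncn (expR (`|x| / c)).
  have e1 : 1 <= expR (`|x| / c) by rewrite -expR0 ler_expR divr_ge0// ltW.
  have n0 : (0 < n)%N by rewrite truncn_gt0.
  exists n.-1; rewrite prednK//.
  have en : c * (`|x| / c) = `|x| by rewrite mulrC divfK// gt_eqF.
  rewrite -en !ler_pM2l// -[`|x| / c]expRK !ler_ln ?posrE ?expR_gt0 ?ltr0n//.
  rewrite truncn_le ?expR_ge0//=; exact/ltW/truncnS_gt.
have [x0|x0] := leP 0 x.
  exists j.*2; rewrite /log_cover /mkset doubleK -signr_odd odd_double mul1r.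
  by move: hj; rewrite (ger0_norm x0).
exists j.*2.+1; rewrite /log_cover /mkset -signr_odd /= uphalf_double odd_double /=.
by rewrite expr1 mulN1r; move: hj; rewrite (ltr0_norm x0).
Qed.

(** The sets of [log_cover c] cover the whole line, and their diameters to the power s sum to at
    most (2c)^s (1 + 1/(s - 1)) <= 2 c Z, which is small with c. *)
Lemma hausdorff_measure_gt1 s A : 1 < s -> hausdorff_measure s A = 0%E.
Proof.
move=> s1; apply/le_anti/andP; split; last first.
  apply: le_trans (hausdorff_premeasure_ge0 s 1 A) _.
  by apply: ereal_sup_ubound; exists 1 => //=; exact: ltr01.
apply: ge_ereal_sup => _ [d /= d0 <-].
pose t := s - 1; have t0 : 0 < t by rewrite subr_gt0.
have st : s = t + 1 by rewrite subrK.
pose Z := 1 + t^-1; have Z0 : 0 < Z by rewrite addr_gt0// invr_gt0.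
apply/lee_addgt0Pr => e e0; rewrite add0e.
pose c := Num.min 1 (Num.min d (e / Z)) / 2.
have c0 : 0 < c by rewrite divr_gt0// !lt_min ltr01 d0 divr_gt0.
have c2 : 2 * c = Num.min 1 (Num.min d (e / Z)) by rewrite mulrC divfK.
have c21 : 2 * c <= 1 by rewrite c2 ge_min lexx.
have c2d : 2 * c <= d by rewrite c2 !ge_min lexx orbT.
have c2e : 2 * c * Z <= e by rewrite -ler_pdivlMr// c2 !ge_min lexx !orbT.
have c20 : 0 <= 2 * c by rewrite mulr_ge0// ltW.
have bk k : 2 * c / k.+1%:R <= 2 * c by rewrite ler_pdivrMr// ler_peMr// ler1n.
apply: (@le_trans _ _ (\sum_(k <oo) diam_pow s (log_cover c k))%E).
  apply: ereal_inf_lbound; exists (log_cover c) => //; split.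
    by move=> x _; have [k hk] := log_cover_total x c0; exists k.
  move=> k; apply: ge_ereal_sup => _ [[x y] [/= Ux Uy] <-]; rewrite lee_fin.
  exact: le_trans (log_cover_diam (ltW c0) Ux Uy) (le_trans (bk k) c2d).
apply: lime_le; first by apply: is_cvg_nneseries => k _ _; exact: diam_pow_ge0.
apply: nearW => n; apply: (@le_trans _ _ (2 * c * Z)%:E); last by rewrite lee_fin.
apply: (@le_trans _ _ (\sum_(0 <= k < n) (2 * c * k.+1%:R `^ (- (t + 1)))%:E)%E).
  apply: lee_sum => k _.
  have s0 : 0 < s by lra.
  have b0 : 0 <= 2 * c / k.+1%:R by rewrite divr_ge0.
  have hd x y := @log_cover_diam c k x y (ltW c0).
  apply: le_trans (diam_pow_le s0 b0 hd) _.
  rewrite lee_fin powRM ?invr_ge0//.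
  rewrite -[(k.+1%:R)^-1]powR_inv1// -powRrM mulN1r -st ler_wpM2r ?powR_ge0//.
  have h : 0 < 2 * c <= 1 by rewrite c21 andbT mulr_gt0.
  by rewrite -[leRHS]powRr1//; apply: ger_powR => //; exact: ltW.
rewrite sumEFin lee_fin -mulr_sumr ler_wpM2l//.
case: n => [|n]; first by rewrite big_geq// ltW.
rewrite big_mkord; apply: le_trans (riemann_sum_le n t0) _.
by rewrite /Z lerBlDr lerDl mulr_ge0 ?invr_ge0 ?(ltW t0)// powR_ge0.
Qed.

End HausdorffUpper.

(** * Membership in the set and the lower bound for the dimension *)

Section Membership.
Context {R : realType}.
Variable p : R.
Hypothesis p1 : 1 <= p.

Lemma short_vector_DI (rho x : R) : rho < critical_radius p ->
  (forall t, 1 <= t -> short_vector p rho x t) -> DI p x.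
Proof.
move=> hr sh; rewrite /DI /= -/(critical_radius p).
apply: (@le_lt_trans _ _ rho%:E); last by rewrite lte_fin.
rewrite /dirichlet_const /limf_esup.
apply: (@le_trans _ _ (ereal_sup
  ((fun t => (lambda1 p x t)%:E) @` [set t : R | 1 < t]))).
  apply: ereal_inf_lbound; exists [set t : R | 1 < t] => //.
  by exists 1; split.
apply: ge_ereal_sup => _ [t /= /ltW t1 <-]; rewrite lee_fin.
have [q [m [qm lt]]] := sh t t1; have t0 : 0 < t := lt_le_trans ltr01 t1.
apply: (@le_trans _ _ (nm p (t^-1 * q%:~R) (t * (m%:~R - q%:~R * x)))); last exact: ltW.
apply: ge_inf; first by exists 0 => _ [z _ <-]; rewrite /lpnorm2 powR_ge0.
exists (t^-1 * q%:~R, t * (m%:~R - q%:~R * x)); last by rewrite nm.unlock.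
split; first by exists q, m.
apply: contra qm => /eqP[/eqP h1 /eqP h2].
move: h1; rewrite mulf_eq0 invr_eq0 gt_eqF//= intr_eq0 => /eqP q0.
move: h2; rewrite q0 mul0r subr0 mulf_eq0 gt_eqF//= intr_eq0 => /eqP m0.
by rewrite m0.
Qed.

Lemma not_BA (x : R) : (forall c, 0 < c -> exists M N : int, 0 < N /\
  `|x - M%:~R / N%:~R| <= c / N%:~R ^+ 2) -> ~ BA x.
Proof.
move=> h [c c0 hc]; have [M [N [N0 le]]] := h c c0.
by have := hc M N (lt0r_neq0 N0); rewrite ltNge le.
Qed.

Lemma DI_minus_BA_uncovered (s : R) : 0 < s -> s < 1 ->
  exists2 th, 0 < th & forall (U : nat -> set R) (w : nat -> R),
    (forall k, 0 < w k) ->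
    (forall k x y, U k x -> U k y -> `|x - y| `^ s <= w k) ->
    (\sum_(k <oo) (w k)%:E < th%:E)%E ->
    exists x, (DI p `\` BA) x /\ forall k, ~ U k x.
Proof.
move=> s0 s1; have r1 := critical_radius_gt1 p1.
set r := critical_radius p in r1.
have [C hC] := separated_short p1.
have [B hB] := nat_bound (2 / (1 - s)).
have s10 : 0 < 1 - s by rewrite subr_gt0.
(* 8 C <= m gives 4 (m + 1) C <= 4^m by [expn4_linear], and B >= 2/(1 - s) gives 4^(m(1-s)) >=
   4^2. *)
pose m := (4 * C + 4 * C + B + 1)%N.
have m0 : (0 < m)%N by rewrite /m addn1.
have hCm : (4 * m.+1 * C <= 4 ^ m)%N.
  have : (4 * C + (4 * C) <= m)%N by rewrite /m -!addnA !leq_add2l leq_addr.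
  move=> /expn4_linear; apply: leq_trans.
  by rewrite leq_eqVlt; apply/orP; left; apply/eqP; ring.
have hsm : 8 <= ((4 ^ m)%:R : R) `^ (1 - s).
  have Bm : (2 : R) <= m%:R * (1 - s).
    rewrite -ler_pdivrMr//; apply: le_trans hB _; rewrite ler_nat /m.
    by rewrite -addnA addnCA leq_addr.
  rewrite natrX -powR_mulrn// -powRrM.
  apply: (@le_trans _ _ (4 `^ 2)); last by apply: ler_powR => //; lra.
  by rewrite powR_mulrn//; lra.
(* With nu and r - rho both at most (r - 1)/4, one gets 1 + 2 nu <= (r + 1)/2 < (3 r + 1)/4 <=
   rho. *)
pose nu := Num.min 1 ((r - 1) / 4).
have nu0 : 0 < nu by rewrite lt_min ltr01 divr_gt0// subr_gt0.
have nu1 : nu <= 1 by rewrite ge_min lexx.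
have nur : nu <= (r - 1) / 4 by rewrite ge_min lexx orbT.
have [eta0 eta00 cusp] := cusp_step p1 C m nu0 nu1.
pose eta := Num.min eta0 (16 ^+ m)^-1.
have m160 : 0 < (16 ^+ m : R) by rewrite exprn_gt0.
have eta_gt0 : 0 < eta by rewrite lt_min eta00 invr_gt0.
have etae : eta <= eta0 by rewrite ge_min lexx.
have etam : eta * 16 ^+ m <= 1 by rewrite -ler_pdivlMr// div1r ge_min lexx orbT.
have [eps eps0 hsep] := hC eta eta_gt0.
pose e' := Num.min eps ((r - 1) / 4).
have e'0 : 0 < e' by rewrite lt_min eps0 divr_gt0// subr_gt0.
have e'e : e' <= eps by rewrite ge_min lexx.
have e'r : e' <= (r - 1) / 4 by rewrite ge_min lexx orbT.
pose rho := r - e'.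
have sep : separation p C eta rho.
  move=> I al t T h1 h2 h3 h4 h5; have [i [q [k [qk lt]]]] := hsep I al t T h1 h2 h3 h4 h5.
  exists i, q, k; split => //; apply: lt_le_trans lt _.
  by rewrite /rho lerD2l lerN2.
have rho1 : 1 + 2 * nu < rho by rewrite /rho; lra.
have rhor : rho < r by rewrite /rho ltrBlDr ltrDl.
have cusp' := cusp eta rho (ltW eta_gt0) etae sep rho1.
have nR : (0 : R) < (4 ^ m)%:R by rewrite ltr0n expn_gt0.
exists ((2^-1 / (4 ^ m)%:R) `^ s); first by rewrite powR_gt0// divr_gt0.
move=> U w w0 wU hw.
(* The game starts on [0, 1], which is good vacuously: t >= 1 and m > 0 exclude t^2 4^m <= 1. *)
have P0 : position p U w s m rho (2^-1, 2^-1).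
  split => //=; first by lra.
    move=> al _ t t1; rewrite (_ : 2 * 2^-1 = 1); last by field.
    rewrite mul1r => h; exfalso; move: h; apply/negP; rewrite -ltNge.
    have : 1 <= t ^+ 2 by rewrite exprn_ege1.
    have : (4 : R) <= 4 ^+ m by rewrite -[leLHS]expr1 ler_eXn2l//; lra.
    by move=> h1 h2; apply: lt_le_trans (_ : 1 * 4 <= _); [lra|apply: ler_pM].
  by apply: le_lt_trans (ball_weight_le_total _ w0 _ _) hw.
have [x [xU xs xc]] := game_point s0 s1 w0 wU sep (ltW eta_gt0) etam hCm hsm m0 cusp' P0.
exists x; split => //; split; first exact: (short_vector_DI rhor xs).
exact: not_BA.
Qed.

Lemma hausdorff_measure_lt1 (s : R) : 0 <= s -> s < 1 ->
  hausdorff_measure s (DI p `\` BA) <> 0%E.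
Proof.
(* The game is played with a positive exponent, and s may be 0. Passing to s' > s is harmless, since
   the sets of the cover have diameter at most 1. *)
move=> s0 s1 h0; pose s' := (s + 1) / 2.
have s'0 : 0 < s' by rewrite divr_gt0//; lra.
have s'1 : s' < 1 by rewrite /s'; lra.
have ss' : s <= s' by rewrite /s'; lra.
have [th th0 hth] := DI_minus_BA_uncovered s'0 s'1.
have : (hausdorff_premeasure s 1 (DI p `\` BA) < (th / 2)%:E)%E.
  apply: (@le_lt_trans _ _ 0%E); last by rewrite lte_fin divr_gt0.
  by rewrite -h0; apply: ereal_sup_ubound; exists 1 => //=; exact: ltr01.
move=> /ereal_inf_lt[_ [U [cov small] <-] hU].
pose dp k := fine (diam_pow s (U k)).
have dpE k : [/\ diam_pow s (U k) = (dp k)%:E, 0 <= dp k &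
    forall x y, U k x -> U k y -> `|x - y| `^ s' <= dp k].
  rewrite /dp /diam_pow; case: asboolP => [e|/eqP/set0P U0].
    by split => // x y; rewrite e.
  have [D [-> D0 D1 hD]] := diam_finite U0 (small k).
  rewrite poweR_EFin /=; split; [by []|exact: powR_ge0|].
  move=> x y Ux Uy; have xyD := hD _ _ Ux Uy.
  have [->|xy] := eqVneq `|x - y| 0; first by rewrite powR0 ?gt_eqF// powR_ge0.
  have xy0 : 0 < `|x - y| by rewrite lt_def xy/=.
  apply: (@le_trans _ _ (`|x - y| `^ s)).
    by apply: ger_powR => //; rewrite xy0 (le_trans xyD).
  by apply: ge0_ler_powR; rewrite ?nnegrE.
(* The game wants positive weights, also for sets of weight 0; the added geometric series sums to
   th/4. *)
pose w k := dp k + th / 2 / 2 / (2 ^ k.+1)%:R.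
have e0 : 0 < th / 2 / 2 by rewrite !divr_gt0.
have ek0 k : 0 < th / 2 / 2 / (2 ^ k.+1)%:R by rewrite divr_gt0// ltr0n expn_gt0.
have w0 k : 0 < w k by have [_ h _] := dpE k; rewrite /w ltr_wpDl.
have wU k x y : U k x -> U k y -> `|x - y| `^ s' <= w k.
  have [_ _ h] := dpE k => Ux Uy; apply: le_trans (h _ _ Ux Uy) _.
  by rewrite /w lerDl ltW.
have [|x [Ax nU]] := hth U w w0 wU.
  apply: (@le_lt_trans _ _ (\sum_(k <oo) (dp k)%:E + (th / 2 / 2)%:E)%E).
    apply: le_trans (epsilon_trick _ _ (ltW e0)); last first.
      by move=> k; rewrite lee_fin; have [] := dpE k.
    apply: lee_nneseries => [k _ _|k _]; first by rewrite lee_fin ltW.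
    by rewrite /w EFinD.
  have -> : (\sum_(k <oo) (dp k)%:E = \sum_(k <oo) diam_pow s (U k))%E.
    by apply: eq_eseriesr => k _; have [-> _ _] := dpE k.
  apply: (@lt_le_trans _ _ ((th / 2)%:E + (th / 2 / 2)%:E)%E).
    by rewrite lteD2rE.
  by rewrite -EFinD lee_fin; lra.
by have [k _ Ukx] := cov x Ax; exact: (nU k).
Qed.

End Membership.

Theorem theorem1p1 (R : realType) (p : R) (hp : 1 <= p) :
  hausdorff_dim (DI p `\` BA) = 1%E.
Proof.
apply/le_anti/andP; split.
  apply/lee_addgt0Pr => e e0; apply: ereal_inf_lbound; exists (1 + e) => //=.
  by split; [lra|apply: hausdorff_measure_gt1; lra].
apply: le_ereal_inf_tmp => _ [s [s0 hs] <-]; rewrite lee_fin leNgt; apply/negP => s1.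
exact: (hausdorff_measure_lt1 hp s0 s1 hs).
Qed.
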